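(* Let $\mathrm{w}$ be a uniformizer of $\mathbb{Z}_p$, let $P(X)=\mathrm{w}X+\cdots\in\mathbb{Z}_p[[X]]$ be a Lubin-Tate series, and let $\boldsymbol{\varpi}=(\varpi_j)_{j\ge0}$ be a generator of the Tate module $\mathrm{T}(\mathfrak{G}_P)$. For $m\ge 0$ put $$E_m(T)=\exp\Bigl(\varpi_mT+\varpi_{m-1}\frac{T^p}{p}+\cdots+\varpi_0\frac{T^{p^m}}{p^m}\Bigr).$$ Then the formal series $E_m(T^p)/E_m(T)$ is over-convergent (i.e. convergent for $|T|<1+\varepsilon$ for some $\varepsilon>0$) if and only if $$|\mathrm{w}-p|\le|p|^{m+2}.$$ In particular, $E_m(T^p)/E_m(T)$ is over-convergent for all $m\ge0$ if and only if $\mathfrak{G}_P$ is isomorphic (as a formal group over $\mathbb{Z}_p$) to the formal multiplicative group $\widehat{\mathbb{G}}_m$.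
   Context: $p$ is a prime and $|.|$ is the $p$-adic absolute value. A Lubin-Tate series for the uniformizer $\mathrm{w}$ of $\mathbb{Z}_p$ is $P(X)\in\mathbb{Z}_p[[X]]$ with $P(X)\equiv \mathrm{w}X\pmod{X^2\mathbb{Z}_p[[X]]}$ and $P(X)\equiv X^p\pmod{\mathrm{w}\mathbb{Z}_p[[X]]}$. $\mathfrak{G}_P$ is the unique formal group law over $\mathbb{Z}_p$ having $P$ as an endomorphism. A generator of the Tate module $\mathrm{T}(\mathfrak{G}_P)$ is a sequence $(\varpi_j)_{j\ge0}$ in the open unit disk of $\mathbb{Q}_p^{\mathrm{alg}}$ with $P(\varpi_0)=0$, $\varpi_0\neq0$, $P(\varpi_{j+1})=\varpi_j$ for all $j\ge0$. *)

(* Defs.v *)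
(* MathComp + Multinomials; the reals only serve as values of absolute values. *)
From HB Require Import structures.
From mathcomp Require Import all_boot all_order all_algebra.
From mathcomp Require Import reals.
From mathcomp Require Import mpoly.

Set Implicit Arguments.
Unset Strict Implicit.
Unset Printing Implicit Defensive.

Import Order.TTheory GRing.Theory Num.Theory.
Local Open Scope ring_scope.

Section AbsoluteValues.
Variables (R : realType) (L : fieldType) (abs : L -> R).

Record nonarch_abs : Prop := NonarchAbs {
  abs_ge0 : forall x, 0 <= abs x;
  abs_eq0 : forall x, abs x = 0 <-> x = 0;
  absM : forall x y, abs (x * y) = abs x * abs y;
  abs_ultra : forall x y, abs (x + y) <= Num.max (abs x) (abs y) }.

Definition converges_to (u : nat -> L) (l : L) : Prop :=
  forall e : R, 0 < e -> exists N, forall n, (N <= n)%N -> abs (u n - l) < e.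

Definition cauchy_seq (u : nat -> L) : Prop :=
  forall e : R, 0 < e ->
  exists N, forall m n, (N <= m)%N -> (N <= n)%N -> abs (u m - u n) < e.

Definition series_sum_at (a : nat -> L) (x l : L) : Prop :=
  converges_to (fun n => \sum_(i < n) a i * x ^+ i) l.

Definition overconvergent (a : nat -> L) : Prop :=
  exists2 e : R, 0 < e &
    forall x : L, abs x < 1 + e -> exists l, series_sum_at a x l.

End AbsoluteValues.

(* (L, abs) is the completion of the rationals at p, with its normalized
   absolute value: a non-archimedean absolute value with |p| = 1/p restricts on
   the rationals to the p-adic one, so density and completeness determine
   (L, abs) up to a unique isometric isomorphism. *)
Record is_Qp (R : realType) (p : nat) (L : fieldType) (abs : L -> R) : Prop :=
  IsQp {
    Qp_abs : nonarch_abs abs;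
    Qp_abs_p : abs p%:R = p%:R^-1;
    Qp_dense : forall (x : L) (e : R), 0 < e ->
      exists q : rat, abs (x - ratr q) < e;
    Qp_complete : forall u : nat -> L, cauchy_seq abs u ->
      exists l, converges_to abs u l }.

(* K is algebraically closed by its type. *)
Record is_Qp_alg (R : realType) (L : fieldType) (absL : L -> R)
    (K : closedFieldType) (iota : {rmorphism L -> K}) (absK : K -> R) : Prop :=
  IsQpAlg {
    Qp_alg_abs : nonarch_abs absK;
    Qp_alg_ext : forall x, absK (iota x) = absL x;
    Qp_alg_algebraic : forall y, algebraicOver iota y }.

Section PowerSeries.
Variable A : comNzRingType.
Implicit Types f g : nat -> A.

(* A series in one variable is the sequence of its coefficients; the coefficient
   of degree n of a product or composite is computed on truncations. *)
Definition truncps (n : nat) f : {poly A} := \poly_(i < n.+1) f i.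

Definition Xps (d : nat) : nat -> A := fun n => (n == d)%:R.

Definition mulps f g : nat -> A := fun n => (truncps n f * truncps n g)`_n.

(* f(g(T)), meaningful when g has no constant term. *)
Definition compps f g : nat -> A := fun n => (truncps n f \Po truncps n g)`_n.

End PowerSeries.

Section PowerSeriesField.
Variable K : fieldType.
Implicit Types f g : nat -> K.

(* For characteristic 0 and f without constant term. *)
Definition expps f : nat -> K := compps (fun n => n`!%:R^-1) f.

(* For f with nonzero constant term c: c^-1 * G(1 - c^-1 * f), where G is the
   geometric series 1/(1 - T). *)
Definition invps f : nat -> K := fun n =>
  (f 0)^-1 * compps (fun=> 1) (fun i => Xps K 0 i - (f 0)^-1 * f i) n.

Definition divps f g : nat -> K := mulps f (invps g).

Lemma mulpsV f : f 0 != 0 -> mulps f (invps f) =1 Xps K 0.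
Proof.
move=> f0 n; rewrite /mulps /invps /compps.
set h := fun i => Xps K 0 i - _.
have h0 : h 0 = 0 by rewrite /h /Xps eqxx mulVf // subrr.
have geom r : truncps r (fun=> 1 : K) \Po truncps r h
              = \sum_(k < r.+1) truncps r h ^+ k.
  rewrite {2}/truncps poly_def raddf_sum; apply: eq_bigr => k _.
  by rewrite scale1r; apply: comp_Xn_poly.
have low r k i : (i < k)%N -> (truncps r h ^+ k)`_i = 0.
  elim: k i => // k IH i lt_ik; rewrite exprS coefM big1 // => -[[|j] ltj] _ /=.
    by rewrite coef_poly h0 mul0r.
  by rewrite IH ?mulr0 //; case: i lt_ik ltj => // i lt_ik _; rewrite subSS;
     exact: leq_ltn_trans (leq_subr j i) lt_ik.
have stable r k i : (i <= r)%N -> (truncps i h ^+ k)`_i = (truncps r h ^+ k)`_i.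
  suff ext j : (j <= i)%N -> (i <= r)%N ->
      (truncps i h ^+ k)`_j = (truncps r h ^+ k)`_j by move=> ?; apply: ext.
  move=> + le_ir; elim: k j => // k IH j le_ji; rewrite !exprS !coefM.
  apply: eq_bigr => -[l /= lt_lj] _.
  have le_li : (l <= i)%N by apply: leq_trans le_ji.
  rewrite IH ?(leq_trans (leq_subr _ _)) // !coef_poly !ltnS le_li.
  by rewrite (leq_trans le_li).
pose H := truncps n h; pose S := \sum_(k < n.+1) H ^+ k.
have -> : (truncps n f *
    truncps n (fun r => (f 0)^-1 * (truncps r (fun=> 1 : K) \Po truncps r h)`_r))`_n
    = ((1 - H) * S)`_n.
  rewrite !coefM; apply: eq_bigr => -[i /=]; rewrite ltnS => le_in _.
  rewrite !coef_poly !ltnS le_in leq_subr geom coefB coef1 coef_poly ltnS le_in.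
  rewrite /h /Xps opprB addrC subrK mulrCA mulrA; congr (_ * _).
  set r := (n - i)%N; have le_rn : (r <= n)%N by apply: leq_subr.
  rewrite !coef_sum (eq_bigr (fun k : 'I_r.+1 => (H ^+ k)`_r)); last first.
    by move=> k _; apply: stable.
  rewrite -(big_mkord xpredT (fun k => (H ^+ k)`_r)).
  rewrite -(big_mkord xpredT (fun k => (H ^+ k)`_r)).
  rewrite [RHS](big_cat_nat (n := r.+1)) //= [X in _ = _ + X]big1_seq ?addr0 //.
  by move=> k; rewrite mem_index_iota => /and3P[_ lt_rk _]; apply: low.
have -> : (1 - H) * S = 1 - H ^+ n.+1 by rewrite -opprB mulNr -subrX1 opprB.
by rewrite coefB coef1 low // subr0.
Qed.

End PowerSeriesField.

Section MultivariateSeries.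
Variable A : comNzRingType.

(* A series in n variables maps each monomial to its coefficient. *)
Definition mtruncps n (d : nat) (F : 'X_{1..n} -> A) : {mpoly A[n]} :=
  \sum_(m : 'X_{1..n < d.+1}) F m *: 'X_[m].

(* F(G_1, ..., G_k), for G_i without constant term. *)
Definition mcompps k n (F : 'X_{1..k} -> A) (G : k.-tuple ('X_{1..n} -> A)) :
    'X_{1..n} -> A := fun m =>
  (mtruncps (mdeg m) F \mPo [tuple of map (mtruncps (mdeg m)) G])@_m.

(* f(G) for f in one variable and G in n variables without constant term. *)
Definition ucompps n (f : nat -> A) (G : 'X_{1..n} -> A) : 'X_{1..n} -> A :=
  fun m => (\sum_(k < (mdeg m).+1) f k *: mtruncps (mdeg m) G ^+ k)@_m.

Definition mXps n (i : 'I_n) : 'X_{1..n} -> A := fun m => 'X_i@_m.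

End MultivariateSeries.

Arguments mXps A {n} i.

Section FormalGroups.
Variables (R : realType) (L : fieldType) (abs : L -> R).

(* When (L, abs) is Q_p, this unit ball is Z_p. *)
Definition in_Zp (x : L) : Prop := abs x <= 1.

(* w generates the maximal ideal of the unit ball. *)
Definition uniformizer (w : L) : Prop :=
  forall x, abs x < 1 <-> exists2 y, in_Zp y & x = w * y.

Record lubin_tate_series (p : nat) (w : L) (P : nat -> L) : Prop :=
  LubinTateSeries {
    LT_integral : forall n, in_Zp (P n);
    LT_coef0 : P 0 = 0;
    LT_coef1 : P 1 = w;
    LT_frobenius : forall n, exists2 z, in_Zp z & P n - Xps L p n = w * z }.

(* One-dimensional commutative formal group laws over Z_p. *)
Record formal_group_law (F : 'X_{1..2} -> L) : Prop := FormalGroupLaw {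
  FGL_integral : forall m, in_Zp (F m);
  FGL_coef0 : F 0%MM = 0;
  FGL_coefX : forall i : 'I_2, F U_(i)%MM = 1;
  FGL_assoc :
    mcompps F [tuple mcompps F [tuple mXps L (0 : 'I_3); mXps L 1]; mXps L 2]
    =1 mcompps F [tuple mXps L 0; mcompps F [tuple mXps L 1; mXps L 2]];
  FGL_comm : mcompps F [tuple mXps L (1 : 'I_2); mXps L 0] =1 F }.

(* f(F(X, Y)) = G(f(X), f(Y)), over Z_p. *)
Record FGL_hom (F G : 'X_{1..2} -> L) (f : nat -> L) : Prop := FGLHom {
  FGL_hom_integral : forall n, in_Zp (f n);
  FGL_hom_coef0 : f 0 = 0;
  FGL_homD : ucompps f F
    =1 mcompps G [tuple ucompps f (mXps L (0 : 'I_2)); ucompps f (mXps L 1)] }.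

Definition FGL_isomorphic (F G : 'X_{1..2} -> L) : Prop :=
  exists f g, [/\ FGL_hom F G f, FGL_hom G F g,
    compps f g =1 Xps L 1 & compps g f =1 Xps L 1].

(* The formal group attached by Lubin and Tate to P is the unique F with this
   property. *)
Definition lubin_tate_group (P : nat -> L) (F : 'X_{1..2} -> L) : Prop :=
  formal_group_law F /\ FGL_hom F F P.

(* (1 + X)(1 + Y) - 1 *)
Definition Gm_hat : 'X_{1..2} -> L := fun m =>
  ('X_(0 : 'I_2) + 'X_1 + 'X_0 * 'X_1 : {mpoly L[2]})@_m.

End FormalGroups.

Section TateModule.
Variables (R : realType) (L : fieldType) (K : closedFieldType).
Variables (iota : {rmorphism L -> K}) (absK : K -> R).

Record tate_generator (P : nat -> L) (varpi : nat -> K) : Prop :=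
  TateGenerator {
    tate_disk : forall j, absK (varpi j) < 1;
    tate_root0 : series_sum_at absK (iota \o P) (varpi 0) 0;
    tate_neq0 : varpi 0 != 0;
    tate_step : forall j,
      series_sum_at absK (iota \o P) (varpi j.+1) (varpi j) }.

End TateModule.

Section Exponentials.
Variables (K : fieldType) (p : nat) (varpi : nat -> K) (m : nat).

Definition E_exponent : {poly K} :=
  \sum_(i < m.+1) (varpi (m - i)%N / p%:R ^+ i) *: 'X^(p ^ i).

Definition E_series : nat -> K := expps (fun n => E_exponent`_n).

(* E_m(T^p) / E_m(T) *)
Definition E_quotient : nat -> K :=
  divps (compps E_series (Xps K p)) E_series.

End Exponentials.

(* Main.v *)
Require Import Defs.
From HB Require Import structures.
From mathcomp Require Import all_boot all_order all_algebra.
From mathcomp Require Import separable.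
From mathcomp Require Import reals boolp.
From mathcomp Require Import mpoly.
From mathcomp Require Import ring lra zify.

Set Implicit Arguments.
Unset Strict Implicit.
Unset Printing Implicit Defensive.

Import Order.TTheory GRing.Theory Num.Theory.
Local Open Scope ring_scope.

(* Attach to a finite sequence x the series exp(sum_i x_i T^(p^i) / p^i), put
   N = m + 1 and x = (varpi_N, ..., varpi_0). Products of series correspond to
   sums of sequences, and E_m(T^p) / E_m(T) is the series of
   y_i = p x_i - P(x_i) (without the term p x_0 when i = 0). Since
   P(X) - w X lies in X^2 Z_p[[X]], the sequence y differs from (p - w) x by
   sequences (a_k x_i^k)_i with k >= 2 and by small terms, and all of these have
   overconvergent series:
   - by Dwork's lemma x is, up to a small error, the ghost vector of a Witt
     vector lam whose components lie in the open disk, because P lifts the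
     Frobenius; hence the series of x is integral, as a product of
     Artin-Hasse exponentials AH(lam_j T^(p^j));
   - x^k is then the sum over j of V^j (lam_j x'^(k-1)), where x' is the sequence
     x for N - j, so |lam_j| < 1 gives overconvergence by induction on k.
   So the quotient is overconvergent iff the series of (p - w) x is. If
   |p - w| = |p|^n with n <= N, removing the leading ghost components one by one
   would make exp(c varpi_0 T) overconvergent with |c| = 1, which it is not since
   |varpi_0|^(p-1) = |p|.
   For the last claim, w = p gives an isomorphism by the lemma of Lubin and
   Tate. Conversely an isomorphism f turns P into an endomorphism e of the
   multiplicative group, so (1 + X) e' = w (1 + e); as e = X^p mod p, the series
   (1 + X)^(w - p) is 1 mod p, but its coefficient of degree 1 / |w - p| is a
   unit if w != p. *)

(** * Ultrametric and p-adic absolute values *)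

(** The field K is not complete, so the argument works with geometric decay of coefficients instead
    of convergence. The return to convergence uses that the coefficients of E_m(T^p) / E_m(T) and a
    given point lie in one finite extension of Q_p, which is complete. Overconvergence is stable
    under products of series but not under inversion, hence not under negation of sequences. This is
    why signs are carried explicitly and why integer multiples need care. Dwork's lemma is applied
    in Z[X], where a multiple of p^n can be divided exactly: P is replaced by an integral polynomial
    approximating it on the disk of radius |varpi_N|, and the Witt components are polynomials
    evaluated at varpi_N. The precision |p|^(N+3) suffices because a finitely supported sequence
    with |x_i| < |p|^(i+1) has an overconvergent series. The same bound explains the threshold: if
    |p - w| <= |p|^(N+1), then (p - w) x satisfies it, because |x_i| < 1 and x_i = 0 for i > N. *)

Section Ultrametric.
Variables (R : realType) (K : fieldType) (abs : K -> R).
Hypothesis Habs : nonarch_abs abs.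

Lemma na_ge0 x : 0 <= abs x. Proof. exact: abs_ge0 Habs x. Qed.

Lemma naM x y : abs (x * y) = abs x * abs y. Proof. exact: absM. Qed.

Lemma na0 : abs 0 = 0. Proof. exact/(abs_eq0 Habs). Qed.

Lemma na_eq0 x : (abs x == 0) = (x == 0).
Proof. by apply/eqP/eqP => /(abs_eq0 Habs). Qed.

Lemma na_gt0 x : (0 < abs x) = (x != 0).
Proof. by rewrite lt_def na_eq0 na_ge0 andbT. Qed.

Lemma na1 : abs 1 = 1.
Proof.
have n0 : abs 1 != 0 by rewrite na_eq0 oner_neq0.
by apply: (mulfI n0); rewrite -naM !mulr1.
Qed.

Lemma naX x n : abs (x ^+ n) = abs x ^+ n.
Proof. by elim: n => [|n IH]; rewrite ?expr0 ?na1 // !exprS naM IH. Qed.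

Lemma naV x : abs x^-1 = (abs x)^-1.
Proof.
have [->|x0] := eqVneq x 0; first by rewrite invr0 na0 invr0.
have ax0 : abs x != 0 by rewrite na_eq0.
by apply: (mulfI ax0); rewrite -naM !divff // na1.
Qed.

Lemma naN x : abs (- x) = abs x.
Proof.
have : abs (-1) ^+ 2 == 1 by rewrite -naX sqrrN expr1n na1.
rewrite sqrf_eq1 => /orP[] /eqP e; first by rewrite -mulN1r naM e mul1r.
by have := na_ge0 (-1); rewrite e oppr_ge0 ler10.
Qed.

Lemma naD_le x y c : abs x <= c -> abs y <= c -> abs (x + y) <= c.
Proof.
by move=> xc yc; apply: le_trans (abs_ultra Habs x y) _; rewrite ge_max xc yc.
Qed.

Lemma naB_le x y c : abs x <= c -> abs y <= c -> abs (x - y) <= c.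
Proof. by move=> xc yc; apply: naD_le; rewrite ?naN. Qed.

Lemma naD_lt x y c : abs x < c -> abs y < c -> abs (x + y) < c.
Proof.
by move=> xc yc; apply: le_lt_trans (abs_ultra Habs x y) _; rewrite gt_max xc yc.
Qed.

Lemma naBC x y : abs (x - y) = abs (y - x).
Proof. by rewrite -naN opprB. Qed.

Lemma naD_eq x y : abs x < abs y -> abs (x + y) = abs y.
Proof.
move=> xy; apply/eqP; rewrite eq_le naD_le ?(ltW xy) //= leNgt; apply/negP => s.
have : abs ((x + y) - x) < abs y by apply: naD_lt; rewrite ?naN.
by rewrite addrC addKr ltxx.
Qed.

Lemma na_sum_le (I : Type) (r : seq I) (Q : pred I) (F : I -> K) c :
  0 <= c -> (forall i, Q i -> abs (F i) <= c) -> abs (\sum_(i <- r | Q i) F i) <= c.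
Proof.
move=> c0 Fc; elim/big_ind: _ => [|x y|//]; first by rewrite na0.
exact: naD_le.
Qed.

Lemma naM_le x y c d : abs x <= c -> abs y <= d -> abs (x * y) <= c * d.
Proof. by move=> xc yd; rewrite naM ler_pM ?na_ge0. Qed.

Lemma naM_le1 x y : abs x <= 1 -> abs y <= 1 -> abs (x * y) <= 1.
Proof. by move=> xc yd; rewrite naM mulr_ile1 ?na_ge0. Qed.

Lemma naX_le1 x n : abs x <= 1 -> abs (x ^+ n) <= 1.
Proof. by move=> x1; rewrite naX exprn_ile1 ?na_ge0. Qed.

Lemma na_nat_le1 n : abs n%:R <= 1.
Proof. by elim: n => [|n IH]; rewrite ?na0 // -natr1 naD_le ?na1. Qed.

Lemma na_int_le1 (z : int) : abs z%:~R <= 1.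
Proof. by case: z => n; rewrite ?NegzE ?mulrNz ?naN; apply: na_nat_le1. Qed.

Lemma na_exp_sub x y n : abs x <= 1 -> abs y <= 1 ->
  abs (x ^+ n - y ^+ n) <= abs (x - y).
Proof.
move=> x1 y1; rewrite subrXX -[leRHS]mulr1; apply: naM_le => //.
by apply: na_sum_le => // i _; apply: naM_le1; apply: naX_le1.
Qed.

Lemma na_horner_sub (q : {poly int}) x y : abs x <= 1 -> abs y <= 1 ->
  abs ((map_poly intr q).[x] - (map_poly intr q).[y]) <= abs (x - y).
Proof.
move=> x1 y1; rewrite !horner_poly -sumrB; apply: na_sum_le => [|i _].
  exact: na_ge0.
rewrite -mulrBr -[leRHS]mul1r; apply: naM_le; first exact: na_int_le1.
exact: na_exp_sub.
Qed.

Lemma na_horner_le (q : {poly int}) x : abs x <= 1 -> q`_0 = 0 ->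
  abs (map_poly intr q).[x] <= abs x.
Proof.
move=> x1 q0; have := @na_horner_sub q x 0 x1.
by rewrite na0 ler01 horner_coef0 coef_map q0 !subr0; apply.
Qed.

End Ultrametric.

(** A substitute for the real k-th root: s = 1 - (1 - rho) / k works by Bernoulli's inequality. It
    converts a bound on k-th powers, or decay along multiples of k, into a geometric rate below
    1. *)
Lemma rrootP (R : realType) (k : nat) (rho : R) : 0 < rho < 1 -> (0 < k)%N ->
  exists2 s : R, 0 < s < 1 & rho <= s ^+ k.
Proof.
move=> /andP[r0 r1] k0; have k0R : 0 < k%:R :> R by rewrite ltr0n.
pose d := (1 - rho) / k%:R; have d0 : 0 < d by rewrite divr_gt0 ?subr_gt0.
have dk : d <= 1 - rho.
  by rewrite ler_pdivrMr // ler_peMr ?subr_ge0 ?(ltW r1) // (ler_nat R 1).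
have kd : k%:R * d = 1 - rho by rewrite mulrC divfK // gt_eqF.
clearbody d; exists (1 - d); first by apply/andP; split; lra.
have bern n : 1 - n%:R * d <= (1 - d) ^+ n.
  elim: n => [|n IH]; first by rewrite mul0r subr0 expr0.
  rewrite exprS; apply: le_trans (ler_wpM2l _ IH); last by lra.
  rewrite -natr1; have : 0 <= n%:R * d * d by rewrite !mulr_ge0 // ltW.
  by lra.
by apply: le_trans (bern k); rewrite kd; lra.
Qed.

Lemma exp_small (R : realType) (s e : R) : 0 <= s < 1 -> 0 < e ->
  exists n, s ^+ n < e.
Proof.
move=> /andP[s0 s1] e0; have [->|sn0] := eqVneq s 0; first by exists 1%N.
have sp : 0 < s by rewrite lt_def sn0.
have d0 : 0 < s^-1 - 1 by rewrite subr_gt0 invf_gt1.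
have bern n : 1 + n%:R * (s^-1 - 1) <= s^-1 ^+ n.
  elim: n => [|n IH]; first by rewrite mul0r addr0 expr0.
  rewrite exprS -natr1; have i0 : 0 <= s^-1 by rewrite invr_ge0.
  apply: le_trans (ler_wpM2l i0 IH).
  have : 0 <= n%:R * (s^-1 - 1) * (s^-1 - 1) by rewrite !mulr_ge0 // ltW.
  by lra.
have /archi_boundP : 0 <= e^-1 / (s^-1 - 1) by rewrite divr_ge0 ?invr_ge0 ?ltW.
move: (Num.bound _) => n; rewrite ltr_pdivrMr // => ltn.
exists n; rewrite -[ltLHS]invrK invf_plt ?posrE ?invr_gt0 ?exprn_gt0 // -exprVn.
by apply: lt_le_trans ltn _; apply: le_trans (bern n); rewrite lerDr.
Qed.
(** Legendre's formula, bounded by telescoping: p times n %/ p^(K+1) is at most n %/ p^K. Stopping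
    at the last K with p^K <= n leaves a positive remainder, whence the strict inequality. *)
Lemma logn_fact_le p n : prime p -> (0 < n)%N -> (p.-1 * logn p n`! < n)%N.
Proof.
move=> pr_p n_gt0; have p_gt1 := prime_gt1 pr_p.
have tel K : (p.-1 * (\sum_(1 <= k < K.+1) n %/ p ^ k) + n %/ p ^ K <= n)%N.
  elim: K => [|K IH]; first by rewrite big_geq // expn0 divn1 muln0.
  rewrite big_nat_recr //=; apply: leq_trans IH.
  have : (n %/ p ^ K.+1 * p <= n %/ p ^ K)%N.
    by rewrite expnSr divnMA leq_divM.
  by move: (n %/ _)%N (n %/ _)%N (\sum_(_ <= _ < _) _)%N p_gt1 => a c S; clear; case: p => //= r; nia.
rewrite logn_fact //; have lt_tr := trunc_log_ltn n p_gt1.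
have le_tr := trunc_logP p_gt1 n_gt0; move: (trunc_log p n) lt_tr le_tr => K ltK leK.
have leKn : (K <= n)%N by apply: leq_trans leK; rewrite ltnW // ltn_expl.
rewrite (big_cat_nat (n := K.+1)) //= [X in (_ + X)%N]big1_seq ?addn0; last first.
  move=> k /andP[_]; rewrite mem_index_iota => /andP[ltKk _]; apply: divn_small.
  by apply: leq_trans ltK _; rewrite leq_pexp2l // ltnW.
by apply: leq_trans (tel K); rewrite -addn1 leq_add2l divn_gt0 ?expn_gt0 ?(ltnW p_gt1).
Qed.

(** The powers of p are the indices where the previous bound is attained; they detect the exact
    radius of convergence of exp. *)
Lemma logn_fact_expn p k : prime p -> (p.-1 * logn p (p ^ k)`!).+1 = (p ^ k)%N.
Proof.
move=> pr_p; have p_gt0 := prime_gt0 pr_p.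
apply/eqP; rewrite eqn_leq logn_fact_le ?expn_gt0 ?p_gt0 //=.
elim: k => [|k IH]; first by rewrite expn0.
suff : (logn p (p ^ k)`! + p ^ k <= logn p (p ^ k.+1)`!)%N.
  move: IH p_gt0; rewrite expnS; move: (p ^ k)%N => d.
  by move: (logn p d`!) (logn p (p * d)`!) => a c; clear; case: p => //= r; nia.
rewrite !logn_fact // [leqRHS](big_cat_nat (n := 2)) //=; last first.
  by rewrite ltnS expn_gt0 p_gt0.
rewrite big_nat1 expnS expn1 mulKn // addnC leq_add2l.
have -> : (\sum_(1 <= i < (p ^ k).+1) p ^ k %/ p ^ i
  = \sum_(2 <= i < (p ^ k).+2) p * p ^ k %/ p ^ i)%N.
  by rewrite [RHS]big_add1 /=; apply: eq_bigr => i _; rewrite expnS divnMl.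
rewrite [leqRHS](big_cat_nat (n := (p ^ k).+2)) //= ?leq_addr //.
rewrite ltnS -[X in (X < _)%N]mul1n ltn_pmul2r ?prime_gt1 //.
by rewrite expn_gt0 p_gt0.
Qed.

Section PadicAbs.
Variables (R : realType) (K : fieldType) (abs : K -> R).
Hypothesis Habs : nonarch_abs abs.
Variable p : nat.
Hypotheses (pr_p : prime p) (abs_p : abs p%:R = p%:R^-1).
Local Notation q := (p%:R^-1 : R).

Lemma pinv_gt0 : 0 < q. Proof. by rewrite invr_gt0 ltr0n prime_gt0. Qed.

Lemma pinv_lt1 : q < 1. Proof. by rewrite invf_lt1 ?ltr0n ?prime_gt0 // (ltr_nat R 1) prime_gt1. Qed.

Lemma pinvX_gt0 n : 0 < q ^+ n. Proof. by rewrite exprn_gt0 ?pinv_gt0. Qed.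

Lemma pinvX_le m n : (m <= n)%N -> q ^+ n <= q ^+ m.
Proof. by move=> mn; rewrite ler_wiXn2l ?ltW ?pinv_gt0 ?pinv_lt1. Qed.

Lemma abs_pX n : abs (p%:R ^+ n) = q ^+ n. Proof. by rewrite (naX Habs) abs_p. Qed.

Lemma abs_nat_coprime n : ~~ (p %| n)%N -> abs n%:R = 1.
Proof.
rewrite -prime_coprime // coprime_sym => cop.
have [/eqP|n_gt0] := posnP n.
  move=> /eqP n0; move: cop; rewrite n0 /coprime gcd0n => /eqP p1.
  by move: (prime_gt1 pr_p); rewrite p1.
have [u v e _] := egcdnP p n_gt0; rewrite (eqP cop) in e.
apply/eqP; rewrite eq_le na_nat_le1 //= leNgt; apply/negP => lt1.
have : abs ((u * n)%:R - (v * p)%:R) < 1.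
  apply: (naD_lt Habs); rewrite ?(naN Habs) // natrM (naM Habs) ?abs_p.
    by apply: le_lt_trans lt1; rewrite ler_piMl ?(na_ge0 Habs) ?(na_nat_le1 Habs).
  apply: le_lt_trans pinv_lt1.
  by rewrite ler_piMl ?(na_nat_le1 Habs) // ltW // pinv_gt0.
by rewrite e natrD addrC addKr (na1 Habs) ltxx.
Qed.

Lemma abs_natE n : (0 < n)%N -> abs n%:R = q ^+ logn p n.
Proof.
move=> n_gt0; have [m cop e] := pfactor_coprime pr_p n_gt0.
rewrite {1}e natrM natrX (naM Habs) abs_pX abs_nat_coprime ?mul1r //.
by rewrite -prime_coprime.
Qed.

Lemma abs_nat_gt0 n : (0 < n)%N -> 0 < abs n%:R.
Proof. by move=> n_gt0; rewrite abs_natE // pinvX_gt0. Qed.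

Lemma natS_neq0 n : n.+1%:R != 0 :> K.
Proof. by rewrite -(na_gt0 Habs) abs_nat_gt0. Qed.

Lemma natr_neq0 n : (0 < n)%N -> n%:R != 0 :> K.
Proof. by case: n => // n _; apply: natS_neq0. Qed.

Lemma pchar_padic : [pchar K] =i pred0.
Proof.
by apply/pcharf0P => -[|n]; rewrite ?eqxx // (negPf (natS_neq0 n)).
Qed.

Lemma abs_nat_dvd k n : (p ^ k %| n)%N -> abs n%:R <= q ^+ k.
Proof.
move=> /dvdnP[m ->]; rewrite natrM natrX (naM Habs) abs_pX.
by rewrite ler_piMl ?(na_nat_le1 Habs) // ltW // pinvX_gt0.
Qed.

(** Raising to the power p - 1 avoids the real number |p|^(1/(p-1)), the radius of convergence of
    exp. The same device is used for all bounds on exp(cT). *)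
Lemma abs_exp_term_le c n :
  abs (c ^+ n / n`!%:R) ^+ p.-1 <= (abs c ^+ p.-1 / q) ^+ n.
Proof.
rewrite (naM Habs) (naX Habs) (naV Habs) exprMn exprMn exprAC.
rewrite ler_wpM2l ?exprn_ge0 ?(na_ge0 Habs) //.
rewrite abs_natE ?fact_gt0 // exprVn -exprM -exprVn invrK.
rewrite ler_weXn2l ?(ler_nat R 1) ?prime_gt0 // mulnC.
by have [->|n_gt0] := posnP n; rewrite ?logn1 ?muln0 // ltnW // logn_fact_le.
Qed.

Lemma abs_exp_term_ge c k : q <= abs c ^+ p.-1 ->
  q <= abs (c ^+ (p ^ k) / (p ^ k)`!%:R) ^+ p.-1.
Proof.
move=> le_c; rewrite (naM Habs) (naX Habs) (naV Habs) exprMn exprAC.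
rewrite abs_natE ?fact_gt0 //; set v := logn _ _.
have <- : (p.-1 * v).+1 = (p ^ k)%N by apply: logn_fact_expn.
rewrite (exprVn (q ^+ v)) -(exprM q) [(v * _)%N]mulnC ler_pdivlMr ?pinvX_gt0 //.
rewrite -exprS.
by rewrite lerXn2r ?nnegrE ?exprn_ge0 ?(na_ge0 Habs) // ltW ?pinv_gt0.
Qed.

Lemma abs_exp_p_le j : (0 < j)%N -> abs (p%:R ^+ j / j`!%:R) <= q.
Proof.
move=> j_gt0; rewrite (naM Habs) (naV Habs) abs_pX abs_natE ?fact_gt0 //.
rewrite ler_pdivrMr ?pinvX_gt0 // -exprS pinvX_le //.
have := logn_fact_le pr_p j_gt0; apply: leq_trans; rewrite ltnS leq_pmull //.
by rewrite -subn1 subn_gt0 prime_gt1.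
Qed.

Lemma pinv_small (t : R) : 0 <= t <= q -> t ^+ p.-1 <= q.
Proof.
move=> /andP[t0 tq]; have : (0 < p.-1)%N by rewrite -subn1 subn_gt0 prime_gt1.
case: p.-1 => // r _; rewrite exprS -[leRHS]mulr1 ler_pM ?exprn_ge0 //.
by rewrite exprn_ile1 // (le_trans tq) // ltW // pinv_lt1.
Qed.

Lemma pinv_small_lt (t : R) : 0 <= t < q -> t ^+ p.-1 < q.
Proof.
move=> /andP[t0 tq]; have : (0 < p.-1)%N by rewrite -subn1 subn_gt0 prime_gt1.
case: p.-1 => // r _; apply: le_lt_trans (tq); rewrite exprS ler_piMr //.
by rewrite exprn_ile1 // ltW // (lt_trans tq) // pinv_lt1.
Qed.

End PadicAbs.

(** * Formal exponentials *)

Section Truncation.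
Variable A : comNzRingType.
Implicit Types (f g : nat -> A) (u v : {poly A}).

(** Congruence modulo X^d. The multivariate [meq d] below includes the degree d, so it corresponds
    to [coef_eq d.+1]. *)
Definition coef_eq d u v := forall i, (i < d)%N -> u`_i = v`_i.

Lemma coef_eq_sym d u v : coef_eq d u v -> coef_eq d v u.
Proof. by move=> e i id; rewrite e. Qed.

Lemma coef_eq_trans d u v w : coef_eq d u v -> coef_eq d v w -> coef_eq d u w.
Proof. by move=> e1 e2 i id; rewrite e1 ?e2. Qed.

Lemma coef_eqW c d u v : (c <= d)%N -> coef_eq d u v -> coef_eq c u v.
Proof. by move=> cd e i ic; apply: e; apply: leq_trans cd. Qed.

Lemma coef_eqD d u u' v v' :
  coef_eq d u u' -> coef_eq d v v' -> coef_eq d (u + v) (u' + v').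
Proof. by move=> e1 e2 i id; rewrite !coefD e1 ?e2. Qed.

Lemma coef_eqZ d c u v : coef_eq d u v -> coef_eq d (c *: u) (c *: v).
Proof. by move=> e i id; rewrite !coefZ e. Qed.

Lemma coef_eq_sum d (I : Type) (r : seq I) (F G : I -> {poly A}) :
  (forall i, coef_eq d (F i) (G i)) ->
  coef_eq d (\sum_(i <- r) F i) (\sum_(i <- r) G i).
Proof. by move=> e i id; rewrite !coef_sum; apply: eq_bigr => j _; apply: e. Qed.

Lemma coef_eqM d u u' v v' :
  coef_eq d u u' -> coef_eq d v v' -> coef_eq d (u * v) (u' * v').
Proof.
move=> e1 e2 i id; rewrite !coefM; apply: eq_bigr => -[j /= ji] _.
by rewrite e1 ?e2 // (leq_ltn_trans _ id) // leq_subr.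
Qed.

Lemma coef_eqX d u v n : coef_eq d u v -> coef_eq d (u ^+ n) (v ^+ n).
Proof. by move=> e; elim: n => [|n IH]; rewrite // !exprS; apply: coef_eqM. Qed.

Lemma coef_eq_deriv d u v : coef_eq d.+1 u v -> coef_eq d u^`() v^`().
Proof. by move=> e i id; rewrite !coef_deriv e. Qed.

Lemma coef_exp_low u n i : u`_0 = 0 -> (i < n)%N -> (u ^+ n)`_i = 0.
Proof.
move=> u0; elim: n i => // n IH i lt_in; rewrite exprS coefM big1 // => -[[|j] ji] _ /=.
  by rewrite u0 mul0r.
rewrite IH ?mulr0 //; case: i lt_in ji => // i lt_in _.
by rewrite subSS; exact: leq_ltn_trans (leq_subr j i) lt_in.
Qed.

Lemma coef_truncps d f i : (truncps d f)`_i = if (i <= d)%N then f i else 0.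
Proof. by rewrite coef_poly ltnS. Qed.

Lemma truncps_le d e f : (d <= e)%N -> coef_eq d.+1 (truncps e f) (truncps d f).
Proof.
move=> de i; rewrite ltnS => id; rewrite !coef_truncps id.
by rewrite (leq_trans id de).
Qed.

Lemma mulpsE f g n : mulps f g n = \sum_(i < n.+1) f i * g (n - i)%N.
Proof.
rewrite /mulps coefM; apply: eq_bigr => -[i /=]; rewrite ltnS => id _.
by rewrite !coef_truncps id leq_subr.
Qed.

Lemma mulps_truncps d f g n : (n <= d)%N ->
  mulps f g n = (truncps d f * truncps d g)`_n.
Proof.
by move=> nd; apply: (@coef_eqM n.+1) => //; apply/coef_eq_sym/truncps_le.
Qed.

Lemma truncps_mulps d f g :
  coef_eq d.+1 (truncps d (mulps f g)) (truncps d f * truncps d g).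
Proof.
by move=> i; rewrite ltnS => id; rewrite coef_truncps id; apply: mulps_truncps.
Qed.

Lemma comp_truncps d f u : truncps d f \Po u = \sum_(k < d.+1) f k *: u ^+ k.
Proof.
rewrite /truncps poly_def raddf_sum; apply: eq_bigr => k _.
by rewrite /= comp_polyZ comp_Xn_poly.
Qed.

(** Any sufficiently long truncation may be used, since g^i has order at least i. This brings series
    identities down to identities of polynomials. *)
Lemma compps_truncps d f g n : g 0 = 0 -> (n <= d)%N ->
  compps f g n = (truncps d f \Po truncps d g)`_n.
Proof.
move=> g0 nd; have c0 e : (truncps e g)`_0 = 0 by rewrite coef_truncps.
rewrite /compps !comp_truncps !coef_sum.
rewrite -[RHS](big_mkord xpredT (fun i => (f i *: truncps d g ^+ i)`_n)).
rewrite (big_cat_nat (n := n.+1)) //= big_mkord [X in _ + X]big1_seq ?addr0.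
  apply: eq_bigr => i _; rewrite !coefZ; congr (_ * _).
  by apply: (@coef_eqX n.+1) => //; apply/coef_eq_sym/truncps_le.
move=> i /andP[_]; rewrite mem_index_iota => /andP[ni _].
by rewrite coefZ coef_exp_low ?mulr0.
Qed.

Lemma compps_Xps f q n : (0 < q)%N ->
  compps f (Xps A q) n = if (q %| n)%N then f (n %/ q)%N else 0.
Proof.
move=> q0; rewrite (compps_truncps (d := n + q)) ?leq_addr //; last first.
  by rewrite /Xps eq_sym gt_eqF // ltEnat.
have -> : truncps (n + q) (Xps A q) = 'X^q.
  apply/polyP => i; rewrite coef_truncps coefXn /Xps.
  by case: eqP => [->|]; rewrite ?leq_addl ?if_same.
rewrite coef_comp_poly_Xn //; case: ifP => // _.
by rewrite coef_truncps (leq_trans (leq_div _ _)) ?leq_addr.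
Qed.

End Truncation.

Section FormalExp.
Variable K : fieldType.
Hypothesis K0 : forall n, n.+1%:R != 0 :> K.
Implicit Types f g e : nat -> K.

(* The recursion says e' = f' e. *)
Definition exp_rec f e := e 0 = 1 /\ forall n,
  n.+1%:R * e n.+1 = \sum_(i < n.+1) (i.+1%:R * f i.+1) * e (n - i)%N.

Lemma exp_rec_deriv f e : exp_rec f e -> forall d,
  coef_eq d (truncps d e)^`() ((truncps d f)^`() * truncps d e).
Proof.
move=> [_ rec] d n nd; rewrite coefM coef_deriv coef_truncps nd -mulr_natl rec.
apply: eq_bigr => -[i /=]; rewrite ltnS => id _.
rewrite coef_deriv !coef_truncps (leq_ltn_trans id nd) mulr_natl.
by rewrite (leq_trans (leq_subr _ _) (ltnW nd)).
Qed.

Lemma deriv_exp_rec f e : e 0 = 1 ->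
  (forall d, coef_eq d (truncps d e)^`() ((truncps d f)^`() * truncps d e)) ->
  exp_rec f e.
Proof.
move=> e0 rec; split=> // n; have /(_ n (ltnSn n)) := rec n.+1.
rewrite coefM coef_deriv coef_truncps leqnn => E; rewrite mulr_natl E.
apply: eq_bigr => -[i /=]; rewrite ltnS => id _.
rewrite coef_deriv !coef_truncps ltnS id mulr_natl.
by rewrite (leq_trans (leq_subr _ _)).
Qed.

Lemma exp_rec_uniq f e e' : exp_rec f e -> exp_rec f e' -> e =1 e'.
Proof.
move=> [e0 re] [e0' re'] n; elim/ltn_ind: n => -[|n] IH; first by rewrite e0.
apply: (mulfI (K0 n)); rewrite re re'; apply: eq_bigr => i _; congr (_ * _).
by apply: IH; rewrite ltnS leq_subr.
Qed.

(** Each coefficient of an exponential depends on finitely many coefficients of the exponent, so an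
    infinite ghost sequence may be cut off when a single coefficient is estimated. *)
Lemma exp_rec_local f f' e e' d : exp_rec f e -> exp_rec f' e' ->
  (forall i, (i <= d)%N -> f i = f' i) -> e d = e' d.
Proof.
move=> [e0 re] [e0' re']; elim/ltn_ind: d => -[|n] IH ff; first by rewrite e0.
apply: (mulfI (K0 n)); rewrite re re'; apply: eq_bigr => -[i id] _ /=.
rewrite ff // IH // ?ltnS ?leq_subr // => j jd; apply: ff.
by rewrite (leq_trans jd) // (leq_trans (leq_subr _ _)).
Qed.

(** The truncated exponential S, the sum of f^k / k! for k <= d, satisfies S' = f' S except for the
    last term f' f^d / d!, which has order at least d. *)
Lemma expps_rec f : f 0 = 0 -> exp_rec f (expps f).
Proof.
move=> f0; pose S d := \sum_(k < d.+1) k`!%:R^-1 *: truncps d f ^+ k.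
have fd0 d : (truncps d f)`_0 = 0 by rewrite coef_truncps.
have ES d n : (n <= d)%N -> expps f n = (S d)`_n.
  by move=> nd; rewrite /expps (compps_truncps _ f0 nd) comp_truncps.
apply: deriv_exp_rec => [|d].
  rewrite (ES 0 0) // /S big_ord_recl big_ord0 addr0 fact0 invr1 scale1r expr0.
  by rewrite coef1.
apply: (@coef_eq_trans _ _ _ (S d)^`()).
  by apply: coef_eq_deriv => n nd; rewrite coef_truncps -ltnS nd; apply: ES.
apply: (@coef_eq_trans _ _ _ ((truncps d f)^`() * S d)); last first.
  apply: coef_eqM => // n nd; rewrite coef_truncps (ltnW nd); apply/esym/ES.
  exact: ltnW.
move=> n nd; rewrite /S raddf_sum big_ord_recl /= expr0 alg_polyC derivC add0r.
rewrite [in RHS]big_ord_recr /= mulrDr coefD.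
rewrite [X in _ = _ + X]coefM [X in _ = _ + X]big1 ?addr0; last first.
  move=> -[i /=]; rewrite ltnS => id _; rewrite coefZ coef_exp_low ?mulr0 //.
  by apply: leq_ltn_trans nd; apply: leq_subr.
rewrite mulr_sumr !coef_sum; apply: eq_bigr => k _.
rewrite derivZ deriv_exp /= /bump /= add1n -scalerAr !coefZ coefMn.
rewrite -[X in _ * X]mulr_natl mulrA; congr (_ * _).
by rewrite factS natrM invfM mulrAC mulVf ?mul1r ?K0.
Qed.

Lemma exp_recD f f' e e' : exp_rec f e -> exp_rec f' e' ->
  exp_rec (fun n => f n + f' n) (mulps e e').
Proof.
move=> E E'; have [[e0 _] [e0' _]] := (E, E').
apply: deriv_exp_rec => [|d].
  by rewrite mulpsE big_ord_recl big_ord0 e0 e0' mul1r addr0.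
apply: coef_eq_trans; first by apply/coef_eq_deriv/truncps_mulps.
rewrite derivM.
have -> : truncps d (fun n => f n + f' n) = truncps d f + truncps d f'.
  by apply/polyP => i; rewrite coefD !coef_truncps; case: ifP; rewrite ?addr0.
rewrite derivD mulrDl; apply: coef_eqD.
  apply: (@coef_eq_trans _ _ _ ((truncps d f)^`() * truncps d e * truncps d e')).
    by apply: coef_eqM => //; apply: exp_rec_deriv.
  rewrite -mulrA; apply: coef_eqM => //.
  by apply/coef_eq_sym/(@coef_eqW _ d d.+1)/truncps_mulps.
apply: (@coef_eq_trans _ _ _ (truncps d e * ((truncps d f')^`() * truncps d e'))).
  by apply: coef_eqM => //; apply: exp_rec_deriv.
rewrite mulrCA; apply: coef_eqM => //.
by apply/coef_eq_sym/(@coef_eqW _ d d.+1)/truncps_mulps.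
Qed.

Lemma exp_rec0 f : f =1 (fun=> 0) -> exp_rec f (Xps K 0).
Proof.
move=> f0; split=> // n; rewrite /Xps mulr0 big1 // => i _.
by rewrite f0 mulr0 mul0r.
Qed.

Lemma exp_rec_scale a f e : exp_rec f e ->
  exp_rec (fun n => a ^+ n * f n) (fun n => a ^+ n * e n).
Proof.
move=> [e0 re]; split=> [|n]; first by rewrite e0 mul1r.
rewrite mulrCA re mulr_sumr; apply: eq_bigr => -[i /=]; rewrite ltnS => id _.
by rewrite -{1}(subnKC id) -addSn exprD; ring.
Qed.

Lemma exp_rec_comp q f e : (0 < q)%N -> exp_rec f e ->
  exp_rec (compps f (Xps K q)) (compps e (Xps K q)).
Proof.
move=> q0 E; have [e0 _] := E; apply: deriv_exp_rec => [|d].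
  by rewrite compps_Xps // dvdn0 div0n.
have T g : coef_eq d.+1 (truncps d (compps g (Xps K q))) (truncps d g \Po 'X^q).
  move=> i; rewrite ltnS => id; rewrite coef_truncps id compps_Xps //.
  rewrite coef_comp_poly_Xn //; case: ifP => // _.
  by rewrite coef_truncps (leq_trans (leq_div _ _)).
apply: coef_eq_trans (coef_eq_deriv (T e)) _.
apply: (@coef_eq_trans _ _ _ ((truncps d f \Po 'X^q)^`() * (truncps d e \Po 'X^q))).
  rewrite !deriv_comp [X in coef_eq _ _ X]mulrAC; apply: coef_eqM => //.
  rewrite -comp_polyM => i id; rewrite !coef_comp_poly_Xn //; case: ifP => // _.
  by apply: exp_rec_deriv => //; apply: leq_ltn_trans (leq_div _ _) id.
apply/coef_eq_sym/coef_eqM; first exact/coef_eq_deriv/T.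
exact: (@coef_eqW _ d d.+1).
Qed.

Lemma exp_rec_linear c : exp_rec (fun n => c *+ (n == 1)) (fun n => c ^+ n / n`!%:R).
Proof.
split=> [|n]; first by rewrite expr0 fact0 divr1.
rewrite big_ord_recl /= big1 ?addr0 => [|i _]; last by rewrite mulr0n mulr0 mul0r.
rewrite mulr1n mul1r subn0 factS natrM invfM exprS.
by rewrite mulrCA [n.+1%:R * _]mulrA divff ?K0 // mul1r mulrA.
Qed.

Lemma mulps_lreg (e u v : nat -> K) : e 0 = 1 -> mulps e u =1 mulps e v -> u =1 v.
Proof.
move=> e0 euv n; elim/ltn_ind: n => n IH; have := euv n.
rewrite !mulpsE !big_ord_recl !subn0 e0 !mul1r.
rewrite (eq_bigr (fun i : 'I_n => e (lift ord0 i) * v (n - lift ord0 i)%N)) => [/addIr//|i _].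
rewrite IH // /bump /=; case: n {IH} i => [[]//|n i].
by rewrite ?add1n subSS ltnS leq_subr.
Qed.

End FormalExp.

Section GhostExp.
Variable K : fieldType.
Hypothesis K0 : forall n, n.+1%:R != 0 :> K.
Variable p : nat.
Hypothesis pr_p : prime p.
Implicit Types x y : nat -> K.

Let pK i : p%:R ^+ i != 0 :> K.
Proof. by rewrite -natrX -(prednK (n := p ^ i)) ?K0 // expn_gt0 prime_gt0. Qed.

(* sum_i x_i T^(p^i) / p^i *)
Definition ghost_series x : nat -> K := fun n =>
  if n == (p ^ logn p n)%N then x (logn p n) / p%:R ^+ logn p n else 0.

Definition ghost_exp x := expps (ghost_series x).

(* The Verschiebung, in ghost coordinates. *)
Definition ghostV x : nat -> K := fun i => if i is j.+1 then p%:R * x j else 0.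

Lemma ghost_series0 x : ghost_series x 0 = 0.
Proof. by rewrite /ghost_series logn0. Qed.

Lemma ghost_series_pow x i : ghost_series x (p ^ i) = x i / p%:R ^+ i.
Proof. by rewrite /ghost_series pfactorK // eqxx. Qed.

Lemma ghost_series_npow x n : (forall i, n != p ^ i)%N -> ghost_series x n = 0.
Proof. by move=> np; rewrite /ghost_series (negPf (np _)). Qed.

Lemma pow_or n : (exists i, n = p ^ i)%N \/ (forall i, n != p ^ i)%N.
Proof.
have [e|ne] := eqVneq n (p ^ logn p n)%N; first by left; exists (logn p n).
by right=> i; apply: contraNneq ne => ->; rewrite pfactorK.
Qed.

Lemma ghost_expP x : exp_rec (ghost_series x) (ghost_exp x).
Proof. exact/expps_rec/ghost_series0. Qed.

Lemma ghost_exp_local x y n : (forall i, (p ^ i <= n)%N -> x i = y i) ->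
  ghost_exp x n = ghost_exp y n.
Proof.
move=> xy; apply: (exp_rec_local K0 (ghost_expP x) (ghost_expP y)) => j jn.
rewrite /ghost_series; case: eqP => // e; rewrite xy //.
by rewrite -e.
Qed.

Lemma eq_ghost_exp x y : x =1 y -> ghost_exp x =1 ghost_exp y.
Proof. by move=> xy n; apply: ghost_exp_local => i _. Qed.

Lemma exp_rec_eq (f f' e : nat -> K) : f =1 f' -> exp_rec f e -> exp_rec f' e.
Proof.
move=> ff [e0 re]; split=> // n; rewrite re.
by apply: eq_bigr => i _; rewrite ff.
Qed.

Lemma ghost_expD x y :
  ghost_exp (fun i => x i + y i) =1 mulps (ghost_exp x) (ghost_exp y).
Proof.
apply: (exp_rec_uniq K0 (ghost_expP _)).
apply: exp_rec_eq (exp_recD (ghost_expP x) (ghost_expP y)) => n.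
by rewrite /ghost_series; case: ifP => _; rewrite ?addr0 // mulrDl.
Qed.

Lemma ghost_exp0 : ghost_exp (fun=> 0) =1 Xps K 0.
Proof.
apply: (exp_rec_uniq K0 (ghost_expP _)); apply: exp_rec0 => n.
by rewrite /ghost_series mul0r if_same.
Qed.

Lemma ghost_expV x : ghost_exp (ghostV x) =1 compps (ghost_exp x) (Xps K p).
Proof.
have p0 := prime_gt0 pr_p.
apply: (exp_rec_uniq K0 (ghost_expP _)).
apply: exp_rec_eq (exp_rec_comp p0 (ghost_expP x)) => n.
rewrite compps_Xps //; case: ifP => [/dvdnP[m ->]|np].
  rewrite mulnK //; case: (pow_or m) => [[i ->]|nm].
    rewrite -expnSr !ghost_series_pow /= exprS invfM.
    rewrite mulrACA [p%:R / _]divff ?mul1r //.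
    by have := pK 1; rewrite expr1.
  rewrite !ghost_series_npow // => -[|i]; last by rewrite expnSr eqn_pmul2r.
  by rewrite expn0 muln_eq1 negb_and (gtn_eqF (prime_gt1 pr_p)) orbT.
case: (pow_or n) => [[[|i] e]|nn]; last by rewrite ghost_series_npow.
  by rewrite e ghost_series_pow /= mul0r.
by move: np; rewrite e expnS dvdn_mulr.
Qed.

(** The substitution of aT for T. In ghost coordinates it is multiplication by the Teichmüller
    vector (a, a^p, a^(p^2), ...). *)
Lemma ghost_exp_scale a x n :
  ghost_exp (fun i => a ^+ (p ^ i) * x i) n = a ^+ n * ghost_exp x n.
Proof.
apply: (exp_rec_uniq K0 (ghost_expP _) (e' := fun n => a ^+ n * ghost_exp x n)).
apply: exp_rec_eq (exp_rec_scale a (ghost_expP x)) => k.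
rewrite /ghost_series; case: eqP => [e|_]; last by rewrite mulr0.
by rewrite [in a ^+ k]e mulrA.
Qed.

Lemma ghost_exp_single c n :
  ghost_exp (fun i => c *+ (i == 0)) n = c ^+ n / n`!%:R.
Proof.
apply: (exp_rec_uniq K0 (ghost_expP _) (e' := fun n => c ^+ n / n`!%:R)).
apply: exp_rec_eq (exp_rec_linear K0 c) => k.
case: (pow_or k) => [[[|i] ->]|nk].
- by rewrite ghost_series_pow expr0 divr1 expn0.
- rewrite ghost_series_pow /= mulr0n mul0r gtn_eqF //.
  by rewrite (leq_trans (prime_gt1 pr_p)) // expnS leq_pmulr // expn_gt0 prime_gt0.
by rewrite ghost_series_npow // (negPf (nk 0)).
Qed.

Variable varpi : nat -> K.

(** The order is reversed so that P sends each component to the next one. The zeros beyond N agree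
    with P(varpi_0) = 0 and P(0) = 0, so this holds for every i. *)
Definition tate_ghost N : nat -> K := fun i =>
  if (i <= N)%N then varpi (N - i) else 0.

Lemma E_seriesE m : E_series p varpi m =1 ghost_exp (tate_ghost m).
Proof.
apply: (exp_rec_uniq K0) (ghost_expP _).
have E : (fun n => (E_exponent p varpi m)`_n) =1 ghost_series (tate_ghost m).
  move=> n; rewrite /E_exponent coef_sum.
  case: (pow_or n) => [[i ->]|nn]; last first.
    rewrite ghost_series_npow // big1 // => i _.
    by rewrite coefZ coefXn (negPf (nn i)) mulr0.
  rewrite ghost_series_pow /tate_ghost; case: leqP => im; last first.
    rewrite mul0r big1 // => j _; rewrite coefZ coefXn eqn_exp2l ?prime_gt1 //.
    by rewrite gtn_eqF ?mulr0 // (leq_trans (ltn_ord j)).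
  rewrite (bigD1 (Ordinal (im : (i < m.+1)%N))) //= big1 ?addr0.
    by rewrite coefZ coefXn eqxx mulr1.
  move=> j; rewrite -val_eqE /= => ji; rewrite coefZ coefXn eqn_exp2l ?prime_gt1 //.
  by rewrite eq_sym (negPf ji) mulr0.
apply: (exp_rec_eq E); apply: (expps_rec K0).
by rewrite (E 0) ghost_series0.
Qed.

(** Substituting T^p in E_m is Verschiebung, and the formal inverse of E_m is the exponential of the
    opposite sequence because a series with constant term 1 can be cancelled. *)
Lemma E_quotientE m : E_quotient p varpi m =1
  ghost_exp (fun i => ghostV (tate_ghost m) i - tate_ghost m i).
Proof.
have p0 := prime_gt0 pr_p; pose e := ghost_exp (tate_ghost m).
have e0 : E_series p varpi m 0 = 1 by rewrite E_seriesE; have [] := ghost_expP (tate_ghost m).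
have inv : invps (E_series p varpi m) =1 ghost_exp (fun i => - tate_ghost m i).
  apply: (mulps_lreg e0) => n; rewrite mulpsV ?e0 ?oner_neq0 //.
  rewrite -ghost_exp0 -(eq_ghost_exp (x := fun i => tate_ghost m i + - tate_ghost m i)).
    by rewrite ghost_expD !mulpsE; apply: eq_bigr => i _; rewrite E_seriesE.
  by move=> i; rewrite subrr.
move=> n; rewrite ghost_expD /E_quotient /divps !mulpsE; apply: eq_bigr => i _.
rewrite inv ghost_expV !compps_Xps //; case: ifP => // _.
by rewrite E_seriesE.
Qed.

End GhostExp.

(** * Overconvergence of exponentials of ghost vectors *)

Section Growth.
Variables (R : realType) (K : fieldType) (abs : K -> R).
Hypothesis Habs : nonarch_abs abs.
Implicit Types a b : nat -> K.

Definition integral_series a := forall n, abs (a n) <= 1.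

(** Overconvergence expressed by coefficients alone, hence usable without completeness. It is
    compared with convergence at points only after all exponentials have been analysed. *)
Definition geometric_decay a := exists C s : R,
  [/\ 0 <= C, 0 < s < 1 & forall n, abs (a n) <= C * s ^+ n].

Lemma geometric_decay_ext a b : a =1 b -> geometric_decay a -> geometric_decay b.
Proof. by move=> e [C [s [C0 s01 h]]]; exists C, s; split=> // n; rewrite -e. Qed.

Lemma geometric_decayM a b : geometric_decay a -> geometric_decay b ->
  geometric_decay (mulps a b).
Proof.
move=> [C [s [C0 /andP[s0 s1] ha]]] [D [t [D0 /andP[t0 t1] hb]]].
exists (C * D), (Num.max s t); split; first exact: mulr_ge0.
  by rewrite lt_max s0 gt_max s1.
have m0 : 0 <= Num.max s t by rewrite le_max ltW.
move=> n; rewrite mulpsE; apply: (na_sum_le Habs) => [|[i /=]].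
  by rewrite !mulr_ge0 // exprn_ge0.
rewrite ltnS => ni _; rewrite -{2}(subnKC ni) exprD mulrACA.
apply: (naM_le Habs).
  by apply: le_trans (ha i) _; rewrite ler_wpM2l // lerXn2r ?nnegrE ?(ltW s0) // le_max lexx.
apply: le_trans (hb _) _; rewrite ler_wpM2l // lerXn2r ?nnegrE ?(ltW t0) //.
by rewrite le_max lexx orbT.
Qed.

Lemma integral_seriesM a b : integral_series a -> integral_series b ->
  integral_series (mulps a b).
Proof.
move=> ha hb n; rewrite mulpsE; apply: (na_sum_le Habs) => // i _.
exact: (naM_le1 Habs).
Qed.

Lemma integral_scale_decay a nu : integral_series a -> abs nu < 1 ->
  geometric_decay (fun n => nu ^+ n * a n).
Proof.
move=> ha nu1; exists 1, (Num.max (abs nu) 2^-1); split=> //.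
  by rewrite lt_max gt_max nu1 invr_gt0 ltr0n orbT invf_lt1 ?ltr0n ?ltr1n.
move=> n; rewrite mul1r -[leRHS]mulr1; apply: (naM_le Habs) => //.
rewrite (naX Habs) lerXn2r ?nnegrE ?(na_ge0 Habs) ?le_max ?lexx //.
by rewrite (na_ge0 Habs).
Qed.

Lemma geometric_decay_scale a nu : geometric_decay a -> abs nu <= 1 ->
  geometric_decay (fun n => nu ^+ n * a n).
Proof.
move=> [C [s [C0 s01 h]]] nu1; exists C, s; split=> // n.
by rewrite -[leRHS]mul1r; apply: (naM_le Habs) => //; apply: (naX_le1 Habs).
Qed.

Lemma geometric_decay_comp a q : (0 < q)%N ->
  geometric_decay a <-> geometric_decay (compps a (Xps K q)).
Proof.
move=> q0; split=> -[C [s [C0 s01 h]]].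
  have [t t01 st] := rrootP s01 q0; exists C, t; split=> // n.
  rewrite compps_Xps //; case: ifP => [/dvdnP[m ->]|_].
    rewrite mulnK //; apply: le_trans (h m) _.
    rewrite ler_wpM2l // mulnC exprM lerXn2r ?nnegrE ?exprn_ge0 //.
      by case/andP: s01 => /ltW.
    by case/andP: t01 => /ltW.
  by rewrite (na0 Habs) mulr_ge0 // exprn_ge0 //; case/andP: t01 => /ltW.
have /andP[s0 s1] := s01; exists C, (s ^+ q); split=> //.
  by rewrite exprn_gt0 // exprn_ilt1 ?(ltW s0) // -lt0n.
move=> n; have := h (q * n)%N; rewrite compps_Xps // dvdn_mulr // mulKn //.
by rewrite exprM.
Qed.

Variable p : nat.
Hypotheses (pr_p : prime p) (abs_p : abs p%:R = p%:R^-1).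
Local Notation q := (p%:R^-1 : R).
Let K0 := natS_neq0 Habs pr_p abs_p.
Let p_neq0 : p%:R != 0 :> K. Proof. exact: (natr_neq0 Habs pr_p abs_p (prime_gt0 pr_p)). Qed.
Implicit Types x y : nat -> K.

(** Together with integrality [ig], this is the property followed through the ghost computations.
    Integrality becomes decay when T is scaled by an element of absolute value less than 1. *)
Definition oc x := geometric_decay (ghost_exp p x).
Definition ig x := integral_series (ghost_exp p x).

Lemma oc_ext x y : x =1 y -> oc x -> oc y.
Proof. by move=> e; apply/geometric_decay_ext/eq_ghost_exp. Qed.

Lemma ocD x y : oc x -> oc y -> oc (fun i => x i + y i).
Proof.
move=> hx hy; apply: geometric_decay_ext (geometric_decayM hx hy) => n.
by rewrite ghost_expD.
Qed.

Lemma igD x y : ig x -> ig y -> ig (fun i => x i + y i).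
Proof. by move=> hx hy n; rewrite (ghost_expD K0); apply: integral_seriesM. Qed.

Lemma ig0 : ig (fun=> 0).
Proof.
move=> n; rewrite (ghost_exp0 K0) /Xps.
by case: (n == 0)%N; rewrite ?(na1 Habs) ?(na0 Habs) ?ler01.
Qed.

Lemma oc0 : oc (fun=> 0).
Proof.
exists 1, 2^-1; split=> //; first by rewrite invr_gt0 ltr0n invf_lt1 ?ltr0n ?ltr1n.
move=> n; rewrite (ghost_exp0 K0) /Xps mul1r.
by case: n => [|n]; rewrite ?(na1 Habs) ?(na0 Habs) ?expr0 ?exprn_ge0 // invr_ge0 ler0n.
Qed.

Lemma oc_sum n (F : nat -> nat -> K) : (forall k, (k < n)%N -> oc (F k)) ->
  oc (fun i => \sum_(k < n) F k i).
Proof.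
elim: n => [|n IH] hF; first by apply: oc_ext oc0 => i; rewrite big_ord0.
apply: oc_ext (ocD (IH _) (hF n _)) => // [i|k kn]; first by rewrite big_ord_recr.
by apply: hF; apply: ltnW.
Qed.

Lemma ig_sum n (F : nat -> nat -> K) : (forall k, (k < n)%N -> ig (F k)) ->
  ig (fun i => \sum_(k < n) F k i).
Proof.
elim: n => [|n IH] hF m.
  by rewrite (eq_ghost_exp K0 _ (y := fun=> 0)) ?ig0 // => i; rewrite big_ord0.
rewrite (eq_ghost_exp K0 _ (y := fun i => \sum_(k < n) F k i + F n i)) => [|i].
  by apply: igD; [apply: IH => k kn; apply: hF; apply: ltnW|apply: hF].
by rewrite big_ord_recr.
Qed.

Lemma oc_VP x : oc x <-> oc (ghostV p x).
Proof.
apply: iff_trans (geometric_decay_comp _ (prime_gt0 pr_p)) _.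
by split; apply: geometric_decay_ext => n; rewrite (ghost_expV K0 pr_p).
Qed.

Lemma ig_V x : ig x -> ig (ghostV p x).
Proof.
move=> h n; rewrite (ghost_expV K0 pr_p) compps_Xps ?prime_gt0 //.
by case: ifP => // _; rewrite (na0 Habs).
Qed.

Lemma oc_iterV k x : oc x -> oc (iter k (ghostV p) x).
Proof. by elim: k => //= k IH h; apply/(oc_VP _).1/IH. Qed.

Lemma ig_iterV k x : ig x -> ig (iter k (ghostV p) x).
Proof. by elim: k => //= k IH h; apply/ig_V/IH. Qed.

Lemma iterVE k x i :
  iter k (ghostV p) x i = if (k <= i)%N then p%:R ^+ k * x (i - k)%N else 0.
Proof.
elim: k i => [|k IH] i; first by rewrite subn0 mul1r.
by case: i => [|i] //=; rewrite IH ltnS subSS; case: ifP; rewrite ?mulr0 // exprS mulrA.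
Qed.

Lemma oc_scale nu x : oc x -> abs nu <= 1 -> oc (fun i => nu ^+ (p ^ i) * x i).
Proof.
move=> h nu1; apply: geometric_decay_ext (geometric_decay_scale h nu1) => n.
by rewrite ghost_exp_scale.
Qed.

Lemma ig_scale_oc nu x : ig x -> abs nu < 1 -> oc (fun i => nu ^+ (p ^ i) * x i).
Proof.
move=> h nu1; apply: geometric_decay_ext (integral_scale_decay h nu1) => n.
by rewrite ghost_exp_scale.
Qed.

Lemma ig_scale nu x : ig x -> abs nu <= 1 -> ig (fun i => nu ^+ (p ^ i) * x i).
Proof.
move=> h nu1 n; rewrite (ghost_exp_scale K0).
by apply: (naM_le1 Habs) => //; apply: (naX_le1 Habs).
Qed.

Definition ghost_single (c : K) : nat -> K := fun i => c *+ (i == 0).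

Lemma p1_gt0 : (0 < p.-1)%N. Proof. by rewrite -subn1 subn_gt0 prime_gt1. Qed.

Lemma oc_single c : abs c ^+ p.-1 < q -> oc (ghost_single c).
Proof.
move=> hc; pose rho := abs c ^+ p.-1 / q.
have rho0 : 0 <= rho by rewrite divr_ge0 ?exprn_ge0 ?(na_ge0 Habs) ?ltW ?pinv_gt0.
have rho1 : rho < 1 by rewrite ltr_pdivrMr ?mul1r ?pinv_gt0.
have [r /andP[rr r1]] : exists r, rho < r < 1.
  by exists ((rho + 1) / 2); apply/andP; split; lra.
have r0 : 0 < r by apply: le_lt_trans rr.
have [s /andP[s0 s1] rs] := @rrootP _ p.-1 r (introT andP (conj r0 r1)) p1_gt0.
exists 1, s; split=> //; first by rewrite s0.
move=> n; rewrite (ghost_exp_single K0 pr_p) mul1r.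
rewrite -(ler_pXn2r p1_gt0) ?nnegrE ?(na_ge0 Habs) ?exprn_ge0 ?(ltW s0) //.
apply: le_trans (abs_exp_term_le Habs pr_p abs_p c n) _.
rewrite -exprM mulnC exprM lerXn2r ?nnegrE ?exprn_ge0 ?(ltW s0) //.
by apply: le_trans rs; apply: ltW.
Qed.

Lemma ig_single c : abs c ^+ p.-1 <= q -> ig (ghost_single c).
Proof.
move=> hc n; rewrite (ghost_exp_single K0 pr_p).
rewrite -(ler_pXn2r p1_gt0) ?nnegrE ?(na_ge0 Habs) // expr1n.
apply: le_trans (abs_exp_term_le Habs pr_p abs_p c n) _.
apply: exprn_ile1; first by rewrite divr_ge0 ?exprn_ge0 ?(na_ge0 Habs) ?ltW ?pinv_gt0.
by rewrite ler_pdivrMr ?mul1r ?pinv_gt0.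
Qed.

(** At the indices p^k the (p-1)-th power of the absolute value of the coefficient stays at least
    |p|, so the coefficients of exp(cT) do not tend to 0. *)
Lemma not_oc_single c : q <= abs c ^+ p.-1 -> ~ oc (ghost_single c).
Proof.
move=> hc [C [s [C0 /andP[s0 s1] h]]].
have q0 : 0 < q := pinv_gt0 R pr_p.
have D0 : 0 < C + 1 by rewrite ltr_wpDl.
have [k hk] : exists k, s ^+ k < q / (C + 1).
  by apply: exp_small; rewrite ?(ltW s0) ?s1 ?divr_gt0.
have := abs_exp_term_ge Habs pr_p abs_p k hc.
rewrite leNgt => /negP; apply; apply: pinv_small_lt => //.
rewrite (na_ge0 Habs) /= -(ghost_exp_single K0 pr_p).
apply: le_lt_trans (h _) _; apply: (@le_lt_trans _ _ (C * s ^+ k)).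
  rewrite ler_wpM2l // ler_wiXn2l ?(ltW s0) ?(ltW s1) //.
  by rewrite ltnW // ltn_expl // prime_gt1.
apply: (@le_lt_trans _ _ ((C + 1) * s ^+ k)).
  by rewrite ler_wpM2r ?exprn_ge0 ?(ltW s0) // lerDl.
by rewrite mulrC -ltr_pdivlMr.
Qed.

Lemma abs_divp_lt (u : K) i c : abs u < q ^+ i * c -> abs (u / p%:R ^+ i) < c.
Proof.
move=> h; rewrite (naM Habs) (naV Habs) (abs_pX Habs abs_p).
by rewrite ltr_pdivrMr ?(pinvX_gt0 _ pr_p) // mulrC.
Qed.

Lemma abs_divp_le (u : K) i c : abs u <= q ^+ i * c -> abs (u / p%:R ^+ i) <= c.
Proof.
move=> h; rewrite (naM Habs) (naV Habs) (abs_pX Habs abs_p).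
by rewrite ler_pdivrMr ?(pinvX_gt0 _ pr_p) // mulrC.
Qed.

(** On series: the exponential of a sum is the product of the factors exp((x_k / p^k) T^(p^k)). *)
Lemma single_decomp n x i : (i < n)%N ->
  \sum_(k < n) iter k (ghostV p) (ghost_single (x k / p%:R ^+ k)) i = x i.
Proof.
move=> lt_in; rewrite (bigD1 (Ordinal lt_in)) //= big1 ?addr0.
  by rewrite iterVE leqnn subnn /ghost_single mulr1n mulrC divfK // expf_neq0.
move=> k; rewrite -val_eqE /= => ki; rewrite iterVE /ghost_single.
case: leqP => // ik; rewrite subn_eq0 leqNgt ltn_neqAle ki ik mulr0n mulr0.
by [].
Qed.

(** Every factor exp((x_k / p^k) T^(p^k)) is overconvergent because |x_k / p^k| < |p|. The finite
    support gives a finite product, hence a common rate of decay. For integrality, in the next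
    lemma, each coefficient is treated separately. *)
Lemma oc_small n x : (forall i, (n <= i)%N -> x i = 0) ->
  (forall i, abs (x i) < q ^+ i.+1) -> oc x.
Proof.
move=> x0 hx.
apply: (@oc_ext (fun i => \sum_(k < n) iter k (ghostV p) (ghost_single (x k / p%:R ^+ k)) i)).
  move=> i; case: (ltnP i n) => [|ni]; first exact: single_decomp.
  rewrite x0 // big1 // => k _; rewrite iterVE /ghost_single; case: leqP => // _.
  by rewrite subn_eq0 leqNgt (leq_trans (ltn_ord k)) // mulr0n mulr0.
apply: (oc_sum (F := fun k => iter k (ghostV p) (ghost_single (x k / p%:R ^+ k)))) => k _.
apply/oc_iterV/oc_single/pinv_small_lt => //.
by rewrite (na_ge0 Habs) /= abs_divp_lt // -exprSr.
Qed.

Lemma ig_small x : (forall i, abs (x i) <= q ^+ i.+1) -> ig x.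
Proof.
move=> hx n; rewrite (@ghost_exp_local _ K0 _ _
  (fun i => \sum_(k < n.+1) iter k (ghostV p) (ghost_single (x k / p%:R ^+ k)) i)); last first.
  move=> i pin; rewrite single_decomp // ltnS (leq_trans _ pin) // ltnW //.
  by rewrite ltn_expl // prime_gt1.
apply: (ig_sum (F := fun k => iter k (ghostV p) (ghost_single (x k / p%:R ^+ k)))) => k _.
apply/ig_iterV/ig_single/pinv_small => //.
by rewrite (na_ge0 Habs) /= abs_divp_le // -exprSr.
Qed.

Lemma oc_nat n x : oc x -> oc (fun i => n%:R * x i).
Proof.
move=> h; elim: n => [|n IH]; first by apply: oc_ext oc0 => i; rewrite mul0r.
by apply: oc_ext (ocD IH h) => i; rewrite -natr1 mulrDl mul1r.
Qed.

(** A negative z cannot be handled by inverting the series, as the inverse of an overconvergent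
    series may fail to be overconvergent. Adding p^n |z| to z gives a natural number and changes the
    sequence by one covered by [oc_small]. *)
Lemma oc_int n (z : int) x : (forall i, (n <= i)%N -> x i = 0) ->
  (forall i, abs (x i) < 1) -> oc x -> oc (fun i => z%:~R * x i).
Proof.
move=> x0 x1 h; pose b := (z + (p ^ n * `|z|)%:Z)%R.
have b0 : (0 <= b)%R.
  rewrite /b PoszM; have : (0 < p ^ n)%N by rewrite expn_gt0 prime_gt0.
  by nia.
have [b' eb] : exists b' : nat, b = b' by exists `|b|%N; rewrite gez0_abs.
have small : oc (fun i => - ((p ^ n * `|z|)%:R * x i)).
  apply: (@oc_small n) => [i /x0->|i]; first by rewrite mulr0 oppr0.
  have [ni|ni] := leqP n i; first by rewrite x0 // mulr0 oppr0 (na0 Habs) pinvX_gt0.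
  rewrite (naN Habs) (naM Habs).
  have le : abs (p ^ n * `|z|)%:R <= q ^+ i.+1.
    apply: le_trans (pinvX_le _ pr_p ni); apply: (abs_nat_dvd Habs pr_p abs_p).
    exact: dvdn_mulr.
  have [->|xi] := eqVneq (x i) 0; first by rewrite (na0 Habs) mulr0 pinvX_gt0.
  apply: le_lt_trans (ler_wpM2r (na_ge0 Habs _) le) _.
  by rewrite gtr_pMr ?pinvX_gt0.
apply: oc_ext (ocD (oc_nat b' h) small) => i.
rewrite -mulrBl; congr (_ * _); rewrite -[b'%:R]/(b'%:Z%:~R) -eb /b.
by rewrite rmorphD /= addrK.
Qed.

(** Multiplying by exp(- x_0 T), overconvergent under the bound on x_0, leaves a series in T^p, that
    is, a Verschiebung, which can be undone. *)
Lemma oc_shift x : abs (x 0) < q -> oc x -> oc (fun i => x i.+1 / p%:R).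
Proof.
move=> x0 h; apply/(oc_VP _).2.
have s : oc (ghost_single (- x 0)).
  by apply/oc_single/pinv_small_lt => //; rewrite (na_ge0 Habs) (naN Habs).
apply: oc_ext (ocD h s) => -[|i]; rewrite /ghost_single /=; first by rewrite mulr1n subrr.
by rewrite mulr0n addr0 mulrC divfK.
Qed.

End Growth.

(** * Dwork's lemma and the Artin-Hasse exponential *)

Section RingCongruence.
Variable A : comNzRingType.
Implicit Types a b c : A.

Definition ndvd (m : nat) a := exists c, a = c *+ m.

Lemma ndvd0 m : ndvd m 0. Proof. by exists 0; rewrite mul0rn. Qed.

Lemma ndvdD m a b : ndvd m a -> ndvd m b -> ndvd m (a + b).
Proof. by move=> [c ->] [d ->]; exists (c + d); rewrite mulrnDl. Qed.

Lemma ndvdN m a : ndvd m a -> ndvd m (- a).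
Proof. by move=> [c ->]; exists (- c); rewrite mulNrn. Qed.

Lemma ndvdB m a b : ndvd m a -> ndvd m b -> ndvd m (a - b).
Proof. by move=> ha /ndvdN; apply: ndvdD. Qed.

Lemma ndvdMr m a b : ndvd m a -> ndvd m (a * b).
Proof. by move=> [c ->]; exists (c * b); rewrite mulrnAl. Qed.

Lemma ndvdMl m a b : ndvd m b -> ndvd m (a * b).
Proof. by rewrite mulrC; apply: ndvdMr. Qed.

Lemma ndvdn m a : ndvd m (a *+ m). Proof. by exists a. Qed.

Lemma ndvd_dvdn m n a : (m %| n)%N -> ndvd n a -> ndvd m a.
Proof. by move=> /dvdnP[k ->] [c ->]; exists (c *+ k); rewrite mulrnA. Qed.

Lemma ndvd_sum m (I : Type) (r : seq I) (F : I -> A) :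
  (forall i, ndvd m (F i)) -> ndvd m (\sum_(i <- r) F i).
Proof.
move=> h; elim/big_ind: _ => [|x y|i _] //; [exact: ndvd0|exact: ndvdD].
Qed.

Lemma ndvd_subX m a b k : ndvd m (a - b) -> ndvd m (a ^+ k - b ^+ k).
Proof. by rewrite subrXX; apply: ndvdMr. Qed.

(** The cofactor of a - b in a^p - b^p is congruent to p b^(p-1) modulo p, since a and b agree
    modulo p; this yields the additional factor p. *)
Lemma ndvd_sub_expp p m a b : (p %| m)%N -> ndvd m (a - b) ->
  ndvd (p * m) (a ^+ p - b ^+ p).
Proof.
move=> pm ab; rewrite subrXX.
have : ndvd p (\sum_(i < p) a ^+ (p.-1 - i) * b ^+ i).
  have -> : \sum_(i < p) a ^+ (p.-1 - i) * b ^+ i =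
      \sum_(i < p) (a ^+ (p.-1 - i) - b ^+ (p.-1 - i)) * b ^+ i + b ^+ p.-1 *+ p.
    rewrite -[X in _ *+ X]card_ord -sumr_const -big_split; apply: eq_bigr => i _ /=.
    rewrite mulrBl -exprD subnK ?subrK //.
    by case: p {ab pm} i => [[]//|p] i; rewrite -ltnS.
  apply: ndvdD; last exact: ndvdn.
  apply: ndvd_sum => i; apply: ndvdMr; apply: (ndvd_dvdn pm).
  exact: ndvd_subX.
have [c ->] := ab => -[d ->]; exists (c * d).
by rewrite mulrnAl mulrnAr -mulrnA.
Qed.

(** The integral form of ((a + b)^p - a^p - b^p) / p, meaningful in any commutative ring. *)
Definition frob_rest p a b : A :=
  \sum_(1 <= i < p) (a ^+ (p - i) * b ^+ i) *+ ('C(p, i) %/ p).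

Lemma exprD_prime p a b : prime p ->
  (a + b) ^+ p = a ^+ p + b ^+ p + frob_rest p a b *+ p.
Proof.
move=> pr_p; have p0 := prime_gt0 pr_p.
rewrite exprDn -(big_mkord xpredT (fun i => a ^+ (p - i) * b ^+ i *+ 'C(p, i))).
rewrite big_nat_recr //= binn subnn mul1r mulr1n big_ltn // subn0 bin0 mulr1 mulr1n.
rewrite -!addrA [b ^+ p + _]addrC; congr (_ + (_ + _)).
rewrite /frob_rest -sumrMnl; apply: eq_big_nat => i /andP[i0 ip].
by rewrite -mulrnA divnK // prime_dvd_bin // i0.
Qed.

End RingCongruence.

Lemma ndvd_fermat p (c : int) : prime p -> ndvd p (c ^+ p - c).
Proof.
move=> pr_p; have p0 := prime_gt0 pr_p.
have add (x y : int) : ndvd p (x ^+ p - x) -> ndvd p ((x + y) ^+ p - (x + y)) ->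
    ndvd p (y ^+ p - y).
  move=> hx /ndvdB/(_ hx); rewrite exprD_prime // => /ndvdB/(_ (ndvdn p (frob_rest p x y))).
  by congr (ndvd _ _); ring.
have nat (n : nat) : ndvd p ((n%:Z) ^+ p - n%:Z).
  elim: n => [|n IH]; first by rewrite expr0n gtn_eqF // subr0; apply: ndvd0.
  rewrite -addn1 PoszD exprD_prime // expr1n.
  rewrite (_ : _ - _ = (n%:Z ^+ p - n%:Z) + frob_rest p n%:Z 1 *+ p); last by ring.
  by apply: ndvdD => //; apply: ndvdn.
case: c => n //; apply: (add n.+1%:Z) => //.
by rewrite NegzE subrr expr0n gtn_eqF // subr0; apply: ndvd0.
Qed.

Section GhostPolynomials.
Variables (p : nat) (P0 R0 : {poly int}).
Hypotheses (pr_p : prime p) (EP0 : P0 = 'X^p + R0 *+ p) (P00 : P0`_0 = 0).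

(** Composition with [P0] is a ring endomorphism of Z[X] lifting Frobenius: this holds for X by the
    form of [P0], for constants by Fermat, and passes to sums and products. *)
Lemma ndvd_frobenius (f : {poly int}) : ndvd p (f \Po P0 - f ^+ p).
Proof.
elim/poly_ind: f => [|f c IH].
  by rewrite comp_poly0 expr0n gtn_eqF ?prime_gt0 // subr0; apply: ndvd0.
rewrite comp_polyD comp_polyM comp_polyX comp_polyC exprD_prime // exprMn.
have [d ed] := ndvd_fermat c pr_p.
rewrite (_ : _ - _ = (f \Po P0 - f ^+ p) * P0 + f ^+ p * (R0 *+ p)
   - (c ^+ p - c)%:P - frob_rest p (f * 'X) c%:P *+ p).
  apply: ndvdB; last exact: ndvdn; apply: ndvdB.
    by apply: ndvdD; [apply: ndvdMr|apply/ndvdMl/ndvdn].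
  by rewrite ed polyCMn; apply: ndvdn.
have -> : 'X^p = P0 - R0 *+ p by rewrite EP0 addrK.
rewrite polyCB polyC_exp; move: (R0 *+ p) (frob_rest _ _ _ *+ p) (f ^+ p) (c%:P ^+ p).
by move=> r s u v; ring.
Qed.

Fixpoint poly_iter i : {poly int} := if i is j.+1 then poly_iter j \Po P0 else 'X.

Lemma poly_iterS i : poly_iter i.+1 = P0 \Po poly_iter i.
Proof.
elim: i => [|i IH]; first by rewrite /= comp_polyX comp_polyXr.
by rewrite -[poly_iter i.+2]/(poly_iter i.+1 \Po P0) {1}IH -comp_polyA.
Qed.

Lemma ndvd_frobenius_expn (f : {poly int}) j :
  ndvd (p ^ j.+1) ((f \Po P0) ^+ (p ^ j) - f ^+ (p ^ j.+1)).
Proof.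
elim: j => [|j IH]; first by rewrite expr1 expn1; apply: ndvd_frobenius.
have /ndvd_sub_expp/(_ IH) : (p %| p ^ j.+1)%N by rewrite expnS dvdn_mulr.
by rewrite -!exprM -!expnSr -expnS.
Qed.

(* Dwork's lemma for the lift P0 of Frobenius: the iterates of P0 are the ghost
   components of a Witt vector. *)
Lemma ghost_polys n : exists lam : nat -> {poly int},
  (forall k, (lam k)`_0 = 0) /\
  forall i, (i < n)%N -> poly_iter i = \sum_(k < i.+1) lam k ^+ (p ^ (i - k)) *+ p ^ k.
Proof.
elim: n => [|n [lam [lam0 hlam]]]; first by exists (fun=> 0); split=> // k; rewrite coef0.
pose S := \sum_(k < n) lam k ^+ (p ^ (n - k)) *+ p ^ k.
have p0 i : (p ^ i != 0)%N by rewrite -lt0n expn_gt0 prime_gt0.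
have iter0 i : (poly_iter i)`_0 = 0.
  elim: i => [|i IH] /=; first by rewrite coefX.
  by rewrite -horner_coef0 horner_comp horner_coef0 P00 horner_coef0.
have S0 : S`_0 = 0.
  rewrite coef_sum big1 // => k _; rewrite coefMn -horner_coef0 horner_exp horner_coef0.
  by rewrite lam0 expr0n (negPf (p0 _)) mul0rn.
have [mu emu] : ndvd (p ^ n) (poly_iter n - S).
  rewrite /S; case: n hlam {S S0} => [|n] hlam; first by exists (poly_iter 0 - 0); rewrite big_ord0.
  (* Composing the previous expansion with [P0] changes its k-th term, modulo p^(n+1), into the k-th
     term of S; the difference is p^k times one controlled by [ndvd_frobenius_expn]. *)
  rewrite /= hlam // raddf_sum -sumrB; apply: ndvd_sum => -[k /=]; rewrite ltnS => kn.
  rewrite comp_polyE -?comp_polyE raddfMn /= rmorphXn /= -mulrnBl.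
  have [d] := ndvd_frobenius_expn (lam k) (n - k).
  rewrite -subSn // => ->; exists d; rewrite -mulrnA; congr (_ *+ _).
  by rewrite -expnD subnK // ltnW.
exists (fun k => if k == n then mu else if (k < n)%N then lam k else 0); split=> [k|i].
  case: eqP => _; last by case: ifP; rewrite ?coef0.
  apply/eqP; have : (mu *+ (p ^ n))`_0 = 0 by rewrite -emu coefB iter0 S0 subrr.
  by rewrite coefMn => /eqP; rewrite mulrn_eq0 (negPf (p0 _)).
rewrite ltnS leq_eqVlt => /orP[/eqP->|lt_in]; last first.
  rewrite hlam //; apply: eq_bigr => -[k /=]; rewrite ltnS => ki _.
  by rewrite (leq_ltn_trans ki lt_in) ltn_eqF // (leq_ltn_trans ki lt_in).
rewrite big_ord_recr /= eqxx subnn expr1 -emu (_ : \sum_(k < n) _ = S).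
  by rewrite addrC subrK.
by apply: eq_bigr => k _; rewrite ltn_ord ltn_eqF.
Qed.

End GhostPolynomials.

(** * The Gauss norm on polynomials *)

Section GaussNorm.
Variables (R : realType) (K : fieldType) (abs : K -> R).
Hypothesis Habs : nonarch_abs abs.
Implicit Types u v : {poly K}.

Definition coefs_le (c : R) u := forall i, abs u`_i <= c.

Lemma coefs_le0 c : 0 <= c -> coefs_le c 0.
Proof. by move=> c0 i; rewrite coef0 (na0 Habs). Qed.

Lemma coefs_leW c d u : c <= d -> coefs_le c u -> coefs_le d u.
Proof. by move=> cd h i; apply: le_trans cd. Qed.

Lemma coefs_leD c u v : coefs_le c u -> coefs_le c v -> coefs_le c (u + v).
Proof. by move=> hu hv i; rewrite coefD; apply: (naD_le Habs). Qed.

Lemma coefs_leB c u v : coefs_le c u -> coefs_le c v -> coefs_le c (u - v).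
Proof. by move=> hu hv i; rewrite coefB; apply: (naB_le Habs). Qed.

Lemma coefs_le_sum c (I : Type) (r : seq I) (P : pred I) (F : I -> {poly K}) : 0 <= c ->
  (forall i, P i -> coefs_le c (F i)) -> coefs_le c (\sum_(i <- r | P i) F i).
Proof.
by move=> c0 h i; rewrite coef_sum; apply: (na_sum_le Habs) => // j /h.
Qed.

Lemma coefs_leM c d u v : 0 <= c -> 0 <= d ->
  coefs_le c u -> coefs_le d v -> coefs_le (c * d) (u * v).
Proof.
move=> c0 d0 hu hv i; rewrite coefM; apply: (na_sum_le Habs); first exact: mulr_ge0.
by move=> j _; apply: (naM_le Habs).
Qed.

Lemma coefs_le_mulr c u v : 0 <= c -> coefs_le c u -> coefs_le 1 v -> coefs_le c (u * v).
Proof. by move=> c0 hu hv; rewrite -[c]mulr1; apply: coefs_leM. Qed.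

Lemma coefs_le1X u n : coefs_le 1 u -> coefs_le 1 (u ^+ n).
Proof.
move=> hu; elim: n => [|n IH]; last by rewrite exprS; apply: coefs_le_mulr.
by move=> i; rewrite expr0 coef1; case: (i == 0)%N; rewrite ?(na1 Habs) ?(na0 Habs).
Qed.

Lemma coefs_leC c a : 0 <= c -> abs a <= c -> coefs_le c a%:P.
Proof. by move=> c0 ha i; rewrite coefC; case: ifP; rewrite // (na0 Habs). Qed.

Lemma coefs_leXn n : coefs_le 1 ('X^n : {poly K}).
Proof. by move=> i; rewrite coefXn; case: eqP; rewrite ?(na1 Habs) ?(na0 Habs). Qed.

Lemma coefs_leMn c u n : coefs_le c u -> coefs_le (c * abs n%:R) (u *+ n).
Proof. by move=> hu i; rewrite coefMn -[u`_i *+ n]mulr_natr (naM Habs) ler_wpM2r ?(na_ge0 Habs). Qed.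

Lemma coefs_le1Mn u n : coefs_le 1 u -> coefs_le 1 (u *+ n).
Proof.
by move=> /(coefs_leMn n); rewrite mul1r; apply/coefs_leW/(na_nat_le1 Habs).
Qed.

Lemma coefs_le_frob_rest p u v : coefs_le 1 u -> coefs_le 1 v ->
  coefs_le 1 (frob_rest p u v).
Proof.
move=> hu hv; apply: coefs_le_sum => // i _.
by apply/coefs_le1Mn/coefs_le_mulr; rewrite ?ler01 //; apply: coefs_le1X.
Qed.

Lemma coefs_le_comp c u v : 0 <= c -> coefs_le c u -> coefs_le 1 v -> coefs_le c (u \Po v).
Proof.
move=> c0 hu hv; rewrite comp_polyE; apply: coefs_le_sum => // i _.
rewrite -mul_polyC; apply: coefs_le_mulr => //; last exact: coefs_le1X.
exact: coefs_leC.
Qed.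

Lemma coefs_le_truncps d (f : nat -> K) c : 0 <= c -> (forall i, (i <= d)%N -> abs (f i) <= c) ->
  coefs_le c (truncps d f).
Proof.
by move=> c0 h i; rewrite coef_truncps; case: ifP => [/h//|_]; rewrite (na0 Habs).
Qed.

End GaussNorm.

(** * Approximation of p-adic integers by integers, and congruences modulo p *)

Section Zp.
Variables (R : realType) (p : nat) (Qp : fieldType) (abs : Qp -> R).
Hypotheses (pr_p : prime p) (hQp : is_Qp p abs).
Local Notation q := (p%:R^-1 : R).
Let Habs : nonarch_abs abs := Qp_abs hQp.
Let abs_p : abs p%:R = q := Qp_abs_p hQp.
Let K0 := natS_neq0 Habs pr_p abs_p.
Let p0 := prime_gt0 pr_p.

Lemma abs_int_lt1 (z : int) : abs z%:~R < 1 -> (p %| `|z|)%N.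
Proof.
move=> h; apply: contraTT h => /(abs_nat_coprime Habs pr_p abs_p) h.
by case: z h => n; rewrite ?NegzE ?mulrNz ?(naN Habs) /= => ->; rewrite ltxx.
Qed.

Lemma abs_intE (z : int) : abs z%:~R = abs `|z|%N%:R.
Proof. by case: z => n; rewrite ?NegzE ?mulrNz ?(naN Habs). Qed.

(** A close rational r has |r| <= 1, so in lowest terms its denominator is prime to p. Replacing the
    inverse of the denominator by its inverse u modulo p^M gives the integer. *)
Lemma Zp_int_approx x M : abs x <= 1 -> exists z : int, abs (x - z%:~R) <= q ^+ M.
Proof.
move=> x1; have [r hr] := Qp_dense hQp x (pinvX_gt0 R pr_p M).
have b0 : (denq r)%:~R != 0 :> Qp.
  rewrite -(na_gt0 Habs) abs_intE (abs_nat_gt0 Habs pr_p abs_p) //.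
  by rewrite absz_gt0 denq_neq0.
have r1 : abs (ratr r) <= 1.
  rewrite -[ratr r](subKr x); apply: (naB_le Habs) => //.
  by apply: le_trans (ltW hr) _; rewrite exprn_ile1 // ltW ?pinv_lt1 ?pinv_gt0.
have er : ratr r * (denq r)%:~R = (numq r)%:~R :> Qp by rewrite /ratr divfK.
have pb : ~~ (p %| `|denq r|)%N.
  apply/negP => pb; have /abs_int_lt1 pa : abs (numq r)%:~R < 1.
    rewrite -er (naM Habs); apply: le_lt_trans (pinv_lt1 R pr_p).
    rewrite -[leRHS]mul1r ler_pM ?(na_ge0 Habs) // abs_intE -[q]expr1.
    by apply: (abs_nat_dvd Habs pr_p abs_p); rewrite expn1.
  have := coprime_num_den r; rewrite /coprime => /eqP g1.
  have : (p %| gcdn `|numq r| `|denq r|)%N by rewrite dvdn_gcd pa pb.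
  by rewrite g1 dvdn1 => /eqP p1; have := prime_gt1 pr_p; rewrite p1.
have b1 : abs (denq r)%:~R = 1 by rewrite abs_intE (abs_nat_coprime Habs pr_p abs_p).
have [u [v uv]] : exists u v : int, u * denq r = 1 + v * (p ^ M)%:Z.
  have cop : coprimez (denq r) (p ^ M)%:Z.
    by rewrite /coprimez /gcdz /= eqz_nat -/(coprime _ _) coprime_sym coprimeXl // prime_coprime.
  have [[u v] e] := coprimezP _ _ cop; exists u, (- v); rewrite /= in e.
  by rewrite -e mulNr addrK.
exists (u * numq r); rewrite -(subrK (ratr r) x) -addrA.
apply: (naD_le Habs); first exact: ltW.
rewrite -[leLHS]mulr1 -[X in _ * X <= _]b1 -(naM Habs) mulrBl er -rmorphM -rmorphB.
have -> : numq r - u * numq r * denq r = (- v * numq r) * (p ^ M)%:Z.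
  by rewrite mulrAC uv; ring.
rewrite rmorphM (naM Habs) -[leRHS]mul1r ler_pM ?(na_ge0 Habs) ?(na_int_le1 Habs) //.
exact: (abs_nat_dvd Habs pr_p abs_p).
Qed.

(** Discreteness of the values, with a precision M in place of a valuation that would be infinite at
    0: an integer close to x either is divisible by p^M or has the same absolute value as x. *)
Lemma Zp_abs_dec x M : abs x <= 1 ->
  abs x <= q ^+ M \/ exists2 k, (k < M)%N & abs x = q ^+ k.
Proof.
move=> /(Zp_int_approx M)[z hz].
have [pz|npz] := boolP (p ^ M %| `|z|)%N.
  left; rewrite -(subrK z%:~R x) (naD_le Habs) // abs_intE.
  exact: (abs_nat_dvd Habs pr_p abs_p).
have z0 : (0 < `|z|)%N by case: `|z|%N npz => //; rewrite dvdn0.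
rewrite pfactor_dvdn // -ltnNge in npz; right; exists (logn p `|z|) => //.
rewrite -(abs_natE Habs pr_p abs_p) // -abs_intE -{1}(subrK z%:~R x).
apply: (naD_eq Habs); apply: le_lt_trans hz _.
by rewrite abs_intE (abs_natE Habs pr_p abs_p) // ltr_iXn2l ?pinv_gt0 ?pinv_lt1.
Qed.

Lemma Zp_fermat x : abs x <= 1 -> abs (x ^+ p - x) <= q.
Proof.
move=> x1; have [z hz] := Zp_int_approx 1 x1; rewrite expr1 in hz.
have -> : x ^+ p - x = (x ^+ p - z%:~R ^+ p) - (x - z%:~R) + (z%:~R ^+ p - z%:~R) by ring.
apply: (naD_le Habs).
  apply: (naB_le Habs) => //; apply: le_trans hz.
  by apply: (na_exp_sub Habs) => //; apply: (na_int_le1 Habs).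
have [c ec] := ndvd_fermat z pr_p.
rewrite -rmorphXn -rmorphB ec rmorphMn -mulr_natr (naM Habs) abs_p.
by rewrite ler_piMl ?(na_int_le1 Habs) // ltW ?pinv_gt0.
Qed.

Lemma coefs_le_pmul u : coefs_le abs 1 u -> coefs_le abs q (u *+ p).
Proof. by move=> /(coefs_leMn Habs p); rewrite abs_p mul1r. Qed.

Lemma q_ge0 : 0 <= q. Proof. by rewrite ltW ?pinv_gt0. Qed.

(** Frobenius fixes the coefficients modulo p because the residue field of Z_p is F_p; this is
    [Zp_fermat]. *)
Lemma coefs_le_frob u : coefs_le abs 1 u -> coefs_le abs q (u ^+ p - (u \Po 'X^p)).
Proof.
elim/poly_ind: u => [|u c IH] hu.
  by rewrite comp_poly0 expr0n gtn_eqF // subr0; apply: (coefs_le0 Habs) q_ge0.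
have hu' : coefs_le abs 1 u.
  by move=> i; have := hu i.+1; rewrite coefD coefMX coefC addr0.
have hc : abs c <= 1 by have := hu 0; rewrite coefD coefMX coefC add0r.
rewrite comp_polyD comp_polyM comp_polyX comp_polyC exprD_prime // exprMn.
rewrite (_ : _ - _ = (u ^+ p - (u \Po 'X^p)) * 'X^p + (c ^+ p - c)%:P
   + frob_rest p (u * 'X) c%:P *+ p); last first.
  by rewrite polyCB polyC_exp; move: (frob_rest _ _ _ *+ p) => s; ring.
apply: (coefs_leD Habs); last first.
  apply/coefs_le_pmul/(coefs_le_frob_rest Habs); last exact: (coefs_leC Habs).
  by apply: (coefs_le_mulr Habs) => //; rewrite -['X]expr1; apply: (coefs_leXn Habs).
apply: (coefs_leD Habs); last by apply: (coefs_leC Habs) (Zp_fermat hc); apply: q_ge0.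
by apply: (coefs_le_mulr Habs); [apply: q_ge0|apply: IH|apply: (coefs_leXn Habs)].
Qed.

Lemma ghost_exp_natmul (x : nat -> Qp) k d n : (n <= d)%N ->
  ghost_exp p (fun i => k%:R * x i) n = (truncps d (ghost_exp p x) ^+ k)`_n.
Proof.
elim: k n => [|k IH] n nd.
  rewrite (eq_ghost_exp K0 _ (y := fun=> 0)) => [|i]; last by rewrite mul0r.
  by rewrite (ghost_exp0 K0) /Xps expr0 coef1.
rewrite (eq_ghost_exp K0 _ (y := fun i => x i + k%:R * x i)) => [|i]; last first.
  by rewrite -nat1r mulrDl mul1r.
rewrite (ghost_expD K0) (mulps_truncps _ _ nd) exprS.
apply: (@coef_eqM _ d.+1) => // i; rewrite ltnS => id.
by rewrite coef_truncps id IH.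
Qed.

(* From AH^p = AH(T^p) exp(pT). *)
Lemma artin_hasse_integral : integral_series abs (ghost_exp p (fun=> 1)).
Proof.
set a := ghost_exp p _; have a0 : a 0 = 1 by have [] := ghost_expP K0 p (fun=> 1).
move=> n; elim/ltn_ind: n => -[|n] IH; first by rewrite a0 (na1 Habs).
pose A := truncps n a; pose B := a n.+1 *: 'X^(n.+1) : {poly Qp}.
have AB : truncps n.+1 a = A + B.
  apply/polyP => i; rewrite coefD coefZ coefXn !coef_truncps leq_eqVlt ltnS.
  by case: eqP => [->|_] /=; rewrite ?ltnn ?add0r ?mulr1 // mulr0 addr0.
(* The unknown coefficient enters linearly: B has order n + 1, and each of the p terms of its
   cofactor has constant term 1. *)
have E1 : ((A + B) ^+ p)`_n.+1 = (A ^+ p)`_n.+1 + p%:R * a n.+1.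
  apply/eqP; rewrite -subr_eq0 opprD addrA -coefB subrXX addrAC subrr add0r.
  rewrite /B -scalerAl coefZ coefXnM ltnn subnn coef_sum.
  rewrite (eq_bigr (fun=> 1)) => [|i _]; last first.
    rewrite -horner_coef0 hornerM !horner_exp hornerD !horner_coef0 coef_truncps a0.
    by rewrite coefZ coefXn mulr0 addr0 !expr1n mulr1.
  by rewrite sumr_const card_ord mulrC subrr.
have E2 : ((A + B) ^+ p)`_n.+1 =
    mulps (fun i => p%:R ^+ i / i`!%:R) (compps a (Xps Qp p)) n.+1.
  rewrite -AB -(ghost_exp_natmul (fun=> 1) p (leqnn _)).
  rewrite (eq_ghost_exp K0 _ (y := fun i => ghost_single p%:R i + ghostV p (fun=> 1) i)).
    rewrite (ghost_expD K0) !mulpsE; apply: eq_bigr => i _.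
    by rewrite (ghost_exp_single K0 pr_p) (ghost_expV K0 pr_p).
  by case=> [|i] /=; rewrite /ghost_single ?mulr1n ?mulr0n ?addr0 ?add0r mulr1.
rewrite mulpsE big_ord_recl /= expr0 fact0 divr1 mul1r subn0 E1 in E2.
have IHle i : (i <= n)%N -> abs (a i) <= 1 by rewrite -ltnS; apply: IH.
have hA : coefs_le abs 1 A by apply: (coefs_le_truncps Habs).
(* The series in T^p therefore only involves coefficients covered by the induction hypothesis. *)
have divn_le : (n.+1 %/ p <= n)%N by rewrite -ltnS ltn_Pdiv // prime_gt1.
have hF := coefs_le_frob hA n.+1.
have hfix : abs (compps a (Xps Qp p) n.+1 - (A ^+ p)`_n.+1) <= q.
  rewrite (naBC Habs); move: hF; rewrite coefB coef_comp_poly_Xn // compps_Xps //.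
  by rewrite coef_truncps divn_le.
have : abs (p%:R * a n.+1) <= q.
  rewrite (_ : p%:R * a n.+1 = (A ^+ p)`_n.+1 + p%:R * a n.+1 - (A ^+ p)`_n.+1).
    rewrite E2 addrAC; apply: (naD_le Habs) => //.
    apply: (na_sum_le Habs) => [|i _]; first exact: q_ge0.
    rewrite -[leRHS]mulr1; apply: (naM_le Habs); first exact: (abs_exp_p_le Habs).
    rewrite compps_Xps //; case: ifP => _; last by rewrite (na0 Habs).
    apply: IHle; apply: leq_trans (leq_div _ _) _.
    by rewrite /bump /= add1n subSS leq_subr.
  by rewrite addrAC subrr add0r.
by rewrite (naM Habs) abs_p ger_pMr ?pinv_gt0.
Qed.

End Zp.

Lemma ghost_exp_map (F K : fieldType) (iota : {rmorphism F -> K}) p x n :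
  (forall n, n.+1%:R != 0 :> F) ->
  iota (ghost_exp p x n) = ghost_exp p (iota \o x) n.
Proof.
move=> F0; have K0 k : k.+1%:R != 0 :> K by rewrite -(rmorph_nat iota) fmorph_eq0.
apply: (exp_rec_uniq K0 (e := fun n => iota (ghost_exp p x n))) (ghost_expP K0 p _) n.
have [e0 re] := ghost_expP F0 p x; split=> [|n]; first by rewrite e0 rmorph1.
rewrite -(rmorph_nat iota) -rmorphM re rmorph_sum; apply: eq_bigr => i _.
rewrite !rmorphM rmorph_nat; congr (_ * _ * _).
by rewrite /ghost_series; case: ifP => _; rewrite ?rmorph0 // fmorph_div rmorphXn /= rmorph_nat.
Qed.

(** * Exponentials attached to the Tate module *)

Section TateExponentials.
Variables (R : realType) (p : nat) (pr_p : prime p).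
Variables (Qp : fieldType) (absQ : Qp -> R) (hQp : is_Qp p absQ).
Variables (K : closedFieldType) (iota : {rmorphism Qp -> K}) (absK : K -> R).
Hypothesis hK : is_Qp_alg absQ iota absK.
Variable w : Qp.
Hypothesis hw : uniformizer absQ w.
Variable P : nat -> Qp.
Hypothesis hP : lubin_tate_series absQ p w P.
Local Notation q := (p%:R^-1 : R).
Let HQ : nonarch_abs absQ := Qp_abs hQp.
Let HK : nonarch_abs absK := Qp_alg_abs hK.
Let absQ_p : absQ p%:R = q := Qp_abs_p hQp.
Let absK_p : absK p%:R = q.
Proof. by rewrite -(rmorph_nat iota) (Qp_alg_ext hK). Qed.
Let KQ := natS_neq0 HQ pr_p absQ_p.
Let KK := natS_neq0 HK pr_p absK_p.
Let q_gt0 := pinv_gt0 R pr_p.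
Let q_lt1 := pinv_lt1 R pr_p.
Let qX_gt0 n : 0 < q ^+ n := pinvX_gt0 R pr_p n.
Let qX_le m n : (m <= n)%N -> q ^+ n <= q ^+ m := @pinvX_le R p pr_p m n.
Let p_gt0 := prime_gt0 pr_p.
Let p_gt1 := prime_gt1 pr_p.

Lemma abs_uniformizer : absQ w = q.
Proof.
have w1 : absQ w < 1 by apply/hw; exists 1; rewrite ?mulr1 // /in_Zp (na1 HQ).
have [] := Zp_abs_dec pr_p hQp 1 (ltW w1); last first.
  by move=> [[|k] // _ e]; rewrite e expr0 ltxx in w1.
rewrite expr1 => le_wq; apply/eqP; rewrite eq_le le_wq /= -absQ_p.
have /hw[y y1 ->] : absQ p%:R < 1 by rewrite absQ_p.
by rewrite (naM HQ) ler_piMr ?(na_ge0 HQ).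
Qed.

Lemma ig_one : ig absK p (fun=> 1).
Proof.
move=> n; rewrite (eq_ghost_exp KK _ (y := iota \o fun=> 1)) => [|i]; last by rewrite /= rmorph1.
rewrite -(ghost_exp_map iota p _ _ KQ) (Qp_alg_ext hK).
exact: artin_hasse_integral.
Qed.

(** The sequence is the sum of the V^k applied to the Teichmüller vectors of [lam k], so its series
    is the product of the Artin-Hasse factors AH(lam_k T^(p^k)). *)
Lemma ig_ghost (lam : nat -> K) : (forall k, absK (lam k) <= 1) ->
  ig absK p (fun i => \sum_(k < i.+1) lam k ^+ (p ^ (i - k)) *+ p ^ k).
Proof.
move=> lam1 n; pose F k := iter k (ghostV p) (fun i => lam k ^+ (p ^ i) * 1).
rewrite (@ghost_exp_local _ KK _ _ (fun i => \sum_(k < n.+1) F k i)).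
  apply: (ig_sum HK pr_p absK_p) => k _.
  apply: (ig_iterV HK pr_p absK_p); apply: (ig_scale HK pr_p absK_p) => //.
  exact: ig_one.
move=> i pin; have lin : (i <= n)%N by apply: leq_trans pin; rewrite ltnW // ltn_expl.
rewrite -[RHS](big_mkord xpredT (fun k => F k i)) (big_cat_nat (n := i.+1)) //=.
rewrite [X in _ = _ + X]big1_seq ?addr0 => [|k /andP[_]]; last first.
  by rewrite mem_index_iota /F iterVE => /andP[ik _]; rewrite leqNgt ik.
rewrite big_mkord; apply: eq_bigr => -[k /=]; rewrite ltnS => ki _.
by rewrite /F iterVE ki mulr1 -natrX mulr_natl.
Qed.

Lemma P_frob n : absQ (P n - (n == p)%:R) <= q.
Proof.
have [z z1 e] := LT_frobenius hP n; rewrite -/(Xps Qp p n) e (naM HQ) abs_uniformizer.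
by rewrite ler_piMr // ltW.
Qed.

(** P has integral coefficients and no constant term, so it maps every closed disk of radius at most
    1 into itself; the bound on partial sums passes to the limit. *)
Lemma series_le rho (y l : K) : rho <= 1 -> absK y <= rho ->
  series_sum_at absK (iota \o P) y l -> absK l <= rho.
Proof.
move=> rho1 yr hl; rewrite leNgt; apply/negP => rl.
have rho0 : 0 <= rho by apply: le_trans (na_ge0 HK _) yr.
have [] := hl (absK l); first exact: le_lt_trans rl.
move=> n /(_ n (leqnn n)); set s := \sum_(i < n) _ => hs.
have sr : absK s <= rho.
  apply: (na_sum_le HK) => // -[[|i] id] _ /=.
    by rewrite (LT_coef0 hP) rmorph0 mul0r (na0 HK).
  rewrite exprS -[leRHS]mul1r; apply: (naM_le HK).
    by rewrite (Qp_alg_ext hK); apply: (LT_integral hP).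
  rewrite -[leRHS]mulr1; apply: (naM_le HK) => //; apply: (naX_le1 HK).
  exact: le_trans rho1.
have : absK l < absK l.
  rewrite -{1}[l](subKr s); apply: le_lt_trans (abs_ultra HK _ _) _.
  by rewrite gt_max (le_lt_trans sr) //= (naN HK).
by rewrite ltxx.
Qed.

(* An integral polynomial lift of Frobenius replacing P on a smaller disk. *)
Definition approx_lift M (rho : R) (P0 R0 : {poly int}) :=
  [/\ P0 = 'X^p + R0 *+ p, R0`_0 = 0, P0`_0 = 0, absQ (w - (P0`_1)%:~R) <= q ^+ M &
    forall y l, absK y <= rho -> series_sum_at absK (iota \o P) y l ->
      absK ((map_poly intr P0).[y] - l) <= q ^+ M].

Lemma approx_liftP M rho : 0 <= rho < 1 -> exists P0 R0, approx_lift M rho P0 R0.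
Proof.
move=> /andP[rho0 rho1].
have /choice[r hr] : forall n, exists z : int,
    absQ ((P n - (n == p)%:R) / p%:R - z%:~R) <= q ^+ M.
  move=> n; apply: (Zp_int_approx pr_p hQp); rewrite (naM HQ) (naV HQ) absQ_p invrK.
  by rewrite -ler_pdivlMr ?mul1r ?P_frob // ltr0n.
have [D0 hD0] := exp_small (introT andP (conj rho0 rho1)) (qX_gt0 M).
(* The cutoff makes rho^D at most |p|^M, so the tail of P is negligible on the disk, and it exceeds
   p, so that neither X^p nor the linear term is lost. *)
pose D := (D0 + p.+2)%N.
have hD n : (D <= n)%N -> rho ^+ n <= q ^+ M.
  move=> Dn; apply: le_trans (ltW hD0); rewrite ler_wiXn2l ?(ltW rho1) //.
  by apply: leq_trans Dn; apply: leq_addr.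
pose R0 : {poly int} := \poly_(i < D) (if i == 0 then 0 else r i).
pose P0 := 'X^p + R0 *+ p.
have P0E i : P0`_i = (i == p)%:R + (if (i < D)%N && (i != 0)%N then r i else 0) *+ p.
  rewrite coefD coefMn coefXn coef_poly; congr (_ + _ *+ _).
  by case: (i < D)%N => //=; case: eqP.
have PP0 i : (i < D)%N -> absQ (P i - (P0`_i)%:~R) <= q ^+ M.
  move=> iD; rewrite P0E iD /=; have [->|i0] := eqVneq i 0 => /=.
    by rewrite (LT_coef0 hP) mul0rn addr0 ltn_eqF // subr0 (na0 HQ) ltW.
  apply: le_trans (qX_le (leqnSn M)); rewrite exprSr.
  have -> : (((i == p)%:R + r i *+ p)%:~R = (i == p)%:R + (r i)%:~R * p%:R :> Qp).
    rewrite rmorphD /= -[r i *+ p]mulr_natr rmorphM /= rmorph_nat.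
    by rewrite rmorph_nat.
  rewrite opprD addrA.
  have -> : P i - (i == p)%:R - (r i)%:~R * p%:R =
      ((P i - (i == p)%:R) / p%:R - (r i)%:~R) * p%:R.
    by rewrite mulrBl divfK // (natr_neq0 HQ pr_p absQ_p p_gt0).
  by apply: (naM_le HQ); rewrite ?absQ_p.
have P00 : P0`_0 = 0 by rewrite P0E ltn_eqF //= andbF mul0rn.
have Dp : (p < D)%N by rewrite /D addnC; lia.
exists P0, R0; split=> //.
- by rewrite coef_poly; case: ifP.
- by rewrite -(LT_coef1 hP); apply: PP0; apply: leq_trans Dp.
move=> y l yr hl; have [n0 hn] := hl _ (qX_gt0 M).
pose n := maxn n0 D; have := hn n (leq_maxl _ _); set s := \sum_(i < n) _ => hs.
rewrite -(subrK s (_.[y])) -addrA; apply: (naD_le HK) (ltW hs).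
have szP0 : (size (map_poly intr P0 : {poly K}) <= n)%N.
  apply: leq_trans (size_poly _ _) _; apply/leq_sizeP => j nj.
  have jD : (D <= j)%N by apply: leq_trans nj; apply: leq_maxr.
  by rewrite P0E ltnNge jD /= mul0rn gtn_eqF // (leq_trans Dp).
rewrite (horner_coef_wide _ szP0) /s -sumrB; apply: (na_sum_le HK) => [|i _]; first exact: ltW.
have y1 : absK y <= 1 by apply: le_trans (ltW rho1).
rewrite coef_map -mulrBl /= -(rmorph_int iota) -rmorphB.
have [iD|Di] := ltnP i D.
  rewrite -[leRHS]mulr1; apply: (naM_le HK); last exact: (naX_le1 HK).
  by rewrite (Qp_alg_ext hK) (naBC HQ); apply: PP0.
rewrite -[leRHS]mul1r; apply: (naM_le HK).
  rewrite P0E ltnNge Di /= mul0rn gtn_eqF ?(leq_trans Dp) // addr0 mulr0z sub0r.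
  by rewrite (Qp_alg_ext hK) (naN HQ); apply: (LT_integral hP).
rewrite (naX HK); apply: le_trans (hD _ Di); rewrite lerXn2r ?nnegrE ?(na_ge0 HK) //.
Qed.

Variable varpi : nat -> K.
Hypothesis hvarpi : tate_generator iota absK P varpi.
Local Notation tg := (tate_ghost varpi).

Let varpi_lt1 j : absK (varpi j) < 1 := tate_disk hvarpi j.
Let varpi_le1 j : absK (varpi j) <= 1 := ltW (varpi_lt1 j).

Lemma varpi_mono i j : (i <= j)%N -> absK (varpi i) <= absK (varpi j).
Proof.
move=> /subnK <-; elim: (j - i)%N => // k IH; apply: le_trans IH _.
exact: series_le (varpi_le1 _) (lexx _) (tate_step hvarpi _).
Qed.

Lemma abs_lift_small M rho P0 R0 t : approx_lift M rho P0 R0 -> absK t <= q ->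
  absK (map_poly intr P0).[t] <= q * absK t.
Proof.
move=> [eP R00 _ _ _] tq; have t1 : absK t <= 1 by apply: le_trans tq (ltW q_lt1).
rewrite eP rmorphD rmorphMn /= map_polyXn hornerD hornerXn hornerMn.
apply: (naD_le HK); last first.
  rewrite -mulr_natl (naM HK) absK_p ler_wpM2l ?(ltW q_gt0) //.
  exact: (na_horner_le HK).
rewrite (naX HK) -{1}(prednK p_gt0) exprSr ler_wpM2r ?(na_ge0 HK) //.
by rewrite pinv_small ?(na_ge0 HK).
Qed.

(** The Newton polygon of P read off by hand: P0(t) = t^p + p t S(t) with |S(t)| = 1. As P0(t) is
    smaller than p t, the two terms must have equal absolute value. *)
Lemma abs_varpi0 : absK (varpi 0) ^+ p.-1 = q.
Proof.
set t := varpi 0; have t0 : 0 < absK t by rewrite (na_gt0 HK); apply: tate_neq0 hvarpi.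
have [M0 hM0] := exp_small (introT andP (conj (ltW q_gt0) q_lt1)) (mulr_gt0 q_gt0 t0).
(* M0 brings the error below |p t|. The extra 2 ensures |w - P0_1| < |p|, so that the linear
   coefficient of P0 still has absolute value |p|. *)
pose M := (M0 + 2)%N; have hM : q ^+ M < q * absK t.
  by apply: le_lt_trans hM0; apply: qX_le; apply: leq_addr.
have [P0 [R0 [eP R00 _ P01 hPl]]] := @approx_liftP M (absK t) (introT andP (conj (na_ge0 HK t) (varpi_lt1 0))).
have := hPl t 0 (lexx _) (tate_root0 hvarpi).
rewrite subr0 => /le_lt_trans/(_ hM).
have r1 : absK (R0`_1)%:~R = 1.
  have : absQ ((P0`_1)%:~R) = q.
    rewrite -[(P0`_1)%:~R](subrK w) -opprB (naD_eq HQ) ?abs_uniformizer //.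
    rewrite (naN HQ); apply: le_lt_trans P01 _.
    by apply: le_lt_trans (qX_le (leq_addl M0 2)) _; rewrite expr2 gtr_pMr.
  rewrite eP coefD coefXn coefMn ltn_eqF // add0r -[R0`_1 *+ p]mulr_natr rmorphM /= rmorph_nat.
  rewrite (naM HQ) absQ_p.
  move=> e; rewrite -(rmorph_int iota) (Qp_alg_ext hK).
  by apply: (mulIf (lt0r_neq0 q_gt0)); rewrite mul1r.
pose S := \poly_(i < size R0) R0`_i.+1.
have RS : R0 = S * 'X.
  apply/polyP => -[|i]; rewrite coefMX //= coef_poly; case: ltnP => // h.
  by rewrite nth_default // ltnW.
have S1 : absK (map_poly intr S).[t] = 1.
  have S0 : (map_poly intr S).[0] = (R0`_1)%:~R :> K.
    by rewrite horner_coef0 coef_map RS coefMX.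
  rewrite -(subrK (map_poly intr S).[0] (_.[t])) -r1 -S0; apply: (naD_eq HK).
  rewrite S0 r1 -S0; apply: le_lt_trans (varpi_lt1 0).
  rewrite -[varpi 0]subr0; apply: (na_horner_sub HK); first exact: varpi_le1.
  by rewrite (na0 HK) ler01.
have -> : (map_poly intr P0).[t] = t ^+ p + p%:R * ((map_poly intr S).[t] * t).
  rewrite eP rmorphD rmorphMn /= map_polyXn hornerD hornerXn hornerMn mulr_natl.
  by rewrite RS rmorphM /= map_polyX hornerMX.
have pt : absK (p%:R * ((map_poly intr S).[t] * t)) = q * absK t.
  by rewrite !(naM HK) absK_p S1 mul1r.
move=> small; apply: (mulIf (lt0r_neq0 t0)); rewrite -exprSr prednK // -(naX HK) -pt.
rewrite -(naN HK (_ * _)) -[t ^+ p](addrK (p%:R * ((map_poly intr S).[t] * t))).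
by apply: (naD_eq HK); rewrite (naN HK) pt.
Qed.

Lemma tate_ghost_lt1 N i : absK (tg N i) < 1.
Proof. by rewrite /tate_ghost; case: ifP => _ //; rewrite (na0 HK) ltr01. Qed.

Lemma tate_ghost_le1 N i : absK (tg N i) <= 1.
Proof. exact/ltW/tate_ghost_lt1. Qed.

Lemma tate_ghost_out N i : (N < i)%N -> tg N i = 0.
Proof. by rewrite /tate_ghost ltnNge => /negPf->. Qed.

Lemma tate_ghostS N i : tg N.+1 i.+1 = tg N i.
Proof. by rewrite /tate_ghost ltnS subSS. Qed.

Lemma lift_tate_ghost M N P0 R0 i : approx_lift M (absK (varpi N)) P0 R0 -> (i <= N)%N ->
  absK ((map_poly intr P0).[tg N i] - tg N i.+1) <= q ^+ M.
Proof.
move=> [_ _ _ _ hPl] iN; rewrite /tate_ghost iN; apply: hPl.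
  by apply: varpi_mono; apply: leq_subr.
move: iN; rewrite leq_eqVlt => /orP[/eqP->|iN].
  by rewrite ltnn subnn; apply: tate_root0 hvarpi.
by rewrite iN -(subnSK iN); apply: tate_step hvarpi _.
Qed.

(** Errors do not accumulate, since P0 is 1-Lipschitz on the unit disk. From index N + 1 on, where
    the Tate ghost vanishes, each iteration contracts by |p|; this decay is what [ig_small] requires
    at infinity. *)
Lemma lift_iter_tate_ghost M N P0 R0 : approx_lift M.+1 (absK (varpi N)) P0 R0 ->
  let v i := (map_poly intr (poly_iter P0 i)).[varpi N] in
  (forall i, (i <= N.+1)%N -> absK (tg N i - v i) <= q ^+ M.+1) /\
  (forall i, absK (v (i + N.+1)%N) <= q ^+ (M.+1 + i)).
Proof.
move=> hPl v.
have vS i : v i.+1 = (map_poly intr P0).[v i].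
  by rewrite /v poly_iterS map_comp_poly horner_comp.
have step i : (i <= N.+1)%N -> absK (tg N i - v i) <= q ^+ M.+1.
  elim: i => [|i IH] iN.
    by rewrite /v /= map_polyX hornerX /tate_ghost subn0 subrr (na0 HK) ltW.
  have {}IH := IH (ltnW iN); rewrite vS (naBC HK).
  rewrite -(subrK (map_poly intr P0).[tg N i] (_.[v i])) -addrA.
  apply: (naD_le HK); last exact: lift_tate_ghost hPl _.
  apply: le_trans (na_horner_sub HK _ _ (tate_ghost_le1 _ _)) _; last by rewrite (naBC HK).
  rewrite -[v i](subKr (tg N i)); apply: (naB_le HK); first exact: tate_ghost_le1.
  by apply: le_trans IH _; rewrite exprn_ile1 // ltW.
split=> //; elim=> [|i IH].
  have := step N.+1 (leqnn _); rewrite tate_ghost_out // sub0r (naN HK) addn0 add0n.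
  by [].
rewrite addSn vS [(M.+1 + _)%N]addnS exprS; apply: le_trans (abs_lift_small hPl _) _.
  by apply: le_trans IH _; rewrite -[leRHS]expr1; apply: qX_le.
by rewrite ler_wpM2l // ltW.
Qed.

(** The components lie in the open disk because the Witt polynomials are integral without constant
    term and |varpi_N| < 1. *)
Lemma ghost_polys_eval P0 R0 M N n : approx_lift M (absK (varpi N)) P0 R0 ->
  exists2 lam : nat -> K, forall k, absK (lam k) < 1 &
  forall i, (i < n)%N -> (map_poly intr (poly_iter P0 i)).[varpi N] =
    \sum_(k < i.+1) lam k ^+ (p ^ (i - k)) *+ p ^ k.
Proof.
move=> [eP _ P00 _ _]; have [lam [lam0 hlam]] := ghost_polys pr_p eP P00 n.
exists (fun k => (map_poly intr (lam k)).[varpi N]) => [k|i iltn].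
  by apply: le_lt_trans (varpi_lt1 N); apply: (na_horner_le HK).
rewrite hlam // rmorph_sum horner_sum; apply: eq_bigr => k _.
by rewrite rmorphMn rmorphXn hornerMn horner_exp.
Qed.

Lemma ig_tate_ghost N : ig absK p (tg N).
Proof.
move=> n.
have [P0 [R0 hPl]] := @approx_liftP N.+3 (absK (varpi N)) (introT andP (conj (na_ge0 HK _) (varpi_lt1 N))).
have [lam lam1 hlam] := ghost_polys_eval n.+1 hPl.
have [h1 h2] := lift_iter_tate_ghost hPl.
pose v i : K := (map_poly intr (poly_iter P0 i)).[varpi N].
pose gh i := \sum_(k < i.+1) lam k ^+ (p ^ (i - k)) *+ p ^ k.
pose z i := if (i < n.+1)%N then tg N i - v i else 0.
rewrite (@ghost_exp_local _ KK _ _ (fun i => gh i + z i)) => [|i pin]; last first.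
  have lin : (i < n.+1)%N by rewrite ltnS (leq_trans _ pin) // ltnW // ltn_expl.
  by rewrite /z lin /gh -hlam // addrC subrK.
apply: (igD HK pr_p absK_p); first by apply: ig_ghost => k; apply: ltW.
apply: (ig_small HK pr_p absK_p) => i; rewrite /z; case: ifP => _; last by rewrite (na0 HK) ltW.
have [iN|Ni] := leqP i N.+1.
  by apply: le_trans (h1 _ iN) _; apply: qX_le; rewrite ltnS ltnW.
rewrite tate_ghost_out 1?ltnW // sub0r (naN HK) -(subnK (ltnW Ni)).
by apply: le_trans (h2 _) _; apply: qX_le; lia.
Qed.

(* As y * x^(N) = sum_j V^j (lam_j . y^(N-j) x^(N-j)) up to a small term. *)
Lemma oc_tate_ghost_mul N (y : nat -> nat -> K) :
  (forall M i, absK (y M i) <= 1) -> (forall M i, (M < i)%N -> y M i = 0) ->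
  (forall M i, y M.+1 i.+1 = y M i) ->
  (forall M nu, absK nu < 1 -> oc absK p (fun i => nu ^+ (p ^ i) * y M i)) ->
  oc absK p (fun i => tg N i * y N i).
Proof.
move=> y1 yout yS hy.
have [P0 [R0 hPl]] := @approx_liftP N.+3 (absK (varpi N))
    (introT andP (conj (na_ge0 HK _) (varpi_lt1 N))).
have [lam lam1 hlam] := ghost_polys_eval N.+1 hPl.
have [h1 _] := lift_iter_tate_ghost hPl.
pose v i : K := (map_poly intr (poly_iter P0 i)).[varpi N].
pose F j := iter j (ghostV p) (fun i => lam j ^+ (p ^ i) * y (N - j)%N i).
(* Shift compatibility lets y pass inside V^j at the cost of replacing N by N - j. *)
have yD j i : (j <= i)%N -> (j <= N)%N -> y (N - j)%N (i - j)%N = y N i.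
  have ySn M k : y (M + j)%N (k + j)%N = y M k.
    by elim: j => [|j IHj]; rewrite ?addn0 // !addnS yS.
  by move=> ji jN; rewrite -(ySn (N - j)%N) (subnK ji) (subnK jN).
have ocF : oc absK p (fun i => \sum_(j < N.+1) F j i).
  by apply: (oc_sum HK pr_p absK_p) => j _; apply/(oc_iterV HK pr_p absK_p)/hy.
have ocz : oc absK p (fun i => (tg N i - v i) * y N i).
  apply: (oc_small HK pr_p absK_p (n := N.+1)) => i; first by move/yout->; rewrite mulr0.
  have [iN|Ni] := leqP i N; last by rewrite yout // mulr0 (na0 HK).
  apply: (@le_lt_trans _ _ (q ^+ N.+3)).
    rewrite -[leRHS]mulr1; apply: (naM_le HK) => //; apply: h1.
    exact: leq_trans iN _.
  by rewrite ltr_iXn2l // !ltnS (leq_trans iN).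
apply: (oc_ext HK pr_p absK_p) (ocD HK pr_p absK_p ocF ocz) => i.
have [iN|Ni] := leqP i N; last first.
  rewrite (yout N i) // !mulr0 addr0 big1 // => j _; rewrite /F iterVE.
  case: ifP => // ji; rewrite yout ?mulr0 // ltn_sub2r //.
  by apply: leq_trans Ni; rewrite ltn_ord.
rewrite mulrBl addrCA -[RHS]addr0; congr (_ + _).
rewrite -[X in X - _](big_mkord xpredT (F ^~ i)).
rewrite (big_cat_nat (n := i.+1)) //= [X in _ + X - _]big1_seq ?addr0 => [|k /andP[_]]; last first.
  by rewrite mem_index_iota /F iterVE => /andP[ik _]; rewrite leqNgt ik.
rewrite /v hlam // mulr_suml big_mkord -sumrB big1 // => j _.
have ji : (j <= i)%N by rewrite -ltnS.
rewrite /F iterVE ji (yD _ _ ji (leq_trans ji iN)) mulrA -natrX mulr_natl.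
by rewrite subrr.
Qed.

(** Exponents start at 2: the first power is only integral, and scaling it by |lam_j| < 1 gives the
    square. Later steps scale a sequence already known to be overconvergent. *)
Lemma oc_tate_ghost_exp k N : oc absK p (fun i => tg N i ^+ k.+2).
Proof.
elim: k N => [|k IH] N; apply: (oc_ext HK pr_p absK_p (fun i => esym (exprS _ _))).
  apply: (@oc_tate_ghost_mul N (fun M i => tg M i ^+ 1)) => [M i|M i h|M i|M nu nu1].
  - exact: tate_ghost_le1.
  - exact: tate_ghost_out.
  - exact: tate_ghostS.
  - by apply: (ig_scale_oc HK pr_p absK_p) nu1; apply: ig_tate_ghost.
apply: (@oc_tate_ghost_mul N (fun M i => tg M i ^+ k.+2)) => [M i|M i h|M i|M nu nu1].
- exact/(naX_le1 HK)/tate_ghost_le1.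
- by rewrite tate_ghost_out // expr0n.
- by rewrite tate_ghostS.
- exact/(oc_scale HK pr_p absK_p)/ltW.
Qed.

Lemma not_oc_tate_ghost N k c : (k <= N)%N -> absK c = q ^+ k ->
  ~ oc absK p (fun i => c * tg N i).
Proof.
elim: N k c => [|N IH] k c.
  rewrite leqn0 => /eqP-> c1 h.
  apply: (@not_oc_single _ _ _ HK _ pr_p absK_p (c * varpi 0)).
    by rewrite (naM HK) c1 mul1r abs_varpi0.
  apply: (oc_ext HK pr_p absK_p) h => i; rewrite /ghost_single /tate_ghost leqn0.
  by case: eqP => _; rewrite ?mulr0 // subn0.
case: k => [|k] kN ck h.
  (* When |c| = 1 the leading component may be too large to remove. Multiplication by p makes it
     smaller than |p|, and the shift divides by p again, so c is unchanged. *)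
  have {}h : oc absK p (fun i => p%:R * (c * tg N.+1 i)) by apply: (oc_nat HK pr_p absK_p).
  apply: (IH 0%N c) => //.
  apply: (oc_ext HK pr_p absK_p) (oc_shift HK pr_p absK_p _ h) => [i|].
    by rewrite tate_ghostS mulrC mulKf // (natr_neq0 HK pr_p absK_p).
  by rewrite !(naM HK) absK_p ck mul1r gtr_pMr // tate_ghost_lt1.
apply: (IH k (c / p%:R)) => //.
  by rewrite (naM HK) (naV HK) absK_p ck exprSr mulfK // lt0r_neq0.
apply: (oc_ext HK pr_p absK_p) (oc_shift HK pr_p absK_p _ h) => [i|].
  by rewrite tate_ghostS mulrAC.
rewrite (naM HK) ck exprS -mulrA gtr_pMr //.
apply: le_lt_trans (tate_ghost_lt1 N.+1 0); rewrite ler_piMl ?(na_ge0 HK) //.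
by rewrite exprn_ile1 ?ltW.
Qed.

Lemma oc_E_quotient m : oc absK p (fun i => ghostV p (tg m) i - tg m i) <->
  absQ (w - p%:R) <= q ^+ m.+2.
Proof.
set N := m.+1; set y := fun i => _.
have [P0 [R0 hPl]] := @approx_liftP N.+3 (absK (varpi N))
    (introT andP (conj (na_ge0 HK _) (varpi_lt1 N))).
have [_ _ P00 P01 _] := hPl.
pose D := size P0; pose x := tg N.
have x1 i : absK (x i) < 1 := tate_ghost_lt1 N i.
have hx k z : oc absK p (fun i => z%:~R * x i ^+ k.+2).
  apply: (oc_int HK pr_p absK_p (n := N.+1)) (oc_tate_ghost_exp k N) => i.
    by move=> iN; rewrite /x tate_ghost_out // expr0n.
  by rewrite (naX HK) exprn_ilt1 ?(na_ge0 HK).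
(* The sign e, like the scalar s in [hu] and [hs], is present because the two directions of [yz]
   need correction terms of opposite signs. *)
pose S (e : int) i := \sum_(k < D) (e * P0`_k.+2)%:~R * x i ^+ k.+2.
have hS e : oc absK p (S e).
  by apply: (oc_sum HK pr_p absK_p (F := fun k i => (e * P0`_k.+2)%:~R * x i ^+ k.+2)).
have SN i : S (-1) i = - S 1 i.
  by rewrite /S -sumrN; apply: eq_bigr => k _; rewrite mulN1r mul1r rmorphN mulNr.
have P0E i : (map_poly intr P0).[x i] = (P0`_1)%:~R * x i + S 1 i.
  rewrite (@horner_coef_wide _ D.+2); last first.
    by rewrite (leq_trans (size_poly _ _)) // leqW.
  rewrite !big_ord_recl !coef_map P00 /= mul0r add0r expr1; congr (_ + _).
  by apply: eq_bigr => k _; rewrite coef_map mul1r.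
(* The two errors made in replacing P by P0, in the value at x_i and in the linear coefficient. Both
   are at most |p|^(N+3), below the bound |p|^(i+1) of [oc_small] for i <= N. *)
pose u i := x i.+1 - (map_poly intr P0).[x i] + ((P0`_1)%:~R - iota w) * x i.
have hu (s : K) : absK s = 1 -> oc absK p (fun i => s * u i).
  move=> s1; apply: (oc_small HK pr_p absK_p (n := N.+1)) => i.
    move=> iN; rewrite /u /x !tate_ghost_out // ?(leq_trans iN) //.
    by rewrite horner_coef0 coef_map P00 subrr mulr0 addr0 mulr0.
  rewrite (naM HK) s1 mul1r.
  have [iN|Ni] := leqP i N; last first.
    rewrite /u /x !tate_ghost_out // ?(leq_trans Ni) //.
    by rewrite horner_coef0 coef_map P00 subrr mulr0 addr0 (na0 HK).
  apply: (@le_lt_trans _ _ (q ^+ N.+3)); last first.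
    by rewrite ltr_iXn2l // !ltnS (leq_trans iN).
  apply: (naD_le HK); first by rewrite (naBC HK); apply: lift_tate_ghost hPl iN.
  rewrite -[leRHS]mulr1; apply: (naM_le HK); last exact: ltW.
  by rewrite -(rmorph_int iota) -rmorphB (Qp_alg_ext hK) (naBC HQ).
have hs (s : K) : absK s = 1 -> oc absK p (ghost_single (s * (p%:R * x 0))).
  move=> s1; apply: (oc_single HK pr_p absK_p); apply: pinv_small_lt => //.
  by rewrite (na_ge0 HK) (naM HK) s1 mul1r (naM HK) absK_p gtr_pMr //=.
pose z i := (p%:R - iota w) * x i.
(* P0 = a_1 X + sum_(k >= 2) a_k X^k maps x_i to x_(i+1) up to u_i. *)
have E i : z i = y i + ghost_single (p%:R * x 0) i + S 1 i + u i.
  rewrite /u P0E /z; case: i => [|i]; rewrite /y /ghost_single /= ?mulr1n ?mulr0n.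
    by rewrite -[tg m 0]tate_ghostS -/N -/x; ring.
  by rewrite -[tg m i.+1]tate_ghostS -[tg m i]tate_ghostS -/N -/x; ring.
have yz : oc absK p y <-> oc absK p z.
  have a1 := na1 HK; have aN1 : absK (-1) = 1 by rewrite (naN HK).
  split=> h.
    apply: (oc_ext HK pr_p absK_p) (ocD HK pr_p absK_p (ocD HK pr_p absK_p
      (ocD HK pr_p absK_p h (hs _ a1)) (hS 1)) (hu _ a1)) => i.
    by rewrite E !mul1r.
  apply: (oc_ext HK pr_p absK_p) (ocD HK pr_p absK_p (ocD HK pr_p absK_p
      (ocD HK pr_p absK_p h (hs _ aN1)) (hS (-1))) (hu _ aN1)) => i.
  rewrite E SN /ghost_single; case: (i == 0); rewrite ?mulr1n ?mulr0n; ring.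
apply: iff_trans yz _; have absz : absK (p%:R - iota w) = absQ (w - p%:R).
  by rewrite -(rmorph_nat iota) -rmorphB (Qp_alg_ext hK) (naBC HQ).
split=> [h|h].
  have : absQ (w - p%:R) <= 1.
    by apply: (naB_le HQ); rewrite ?abs_uniformizer ?absQ_p ltW.
  (* k < m + 2 is exactly k <= N, the range in which [not_oc_tate_ghost] applies. *)
  move=> /(Zp_abs_dec pr_p hQp m.+2)[//|[k km ek]].
  by case: (@not_oc_tate_ghost N k (p%:R - iota w)); rewrite // absz.
apply: (oc_small HK pr_p absK_p (n := N.+1)) => i; first by move=> iN; rewrite /z /x tate_ghost_out // mulr0.
have [iN|Ni] := leqP i N; last by rewrite /z /x tate_ghost_out // mulr0 (na0 HK).
rewrite (naM HK) absz; apply: (@le_lt_trans _ _ (q ^+ m.+2 * absK (x i))).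
  by rewrite ler_wpM2r // (na_ge0 HK).
(* At i = N the exponents coincide, and strictness comes from |x_i| < 1. *)
apply: lt_le_trans (qX_le (_ : i.+1 <= m.+2)%N) => //.
by rewrite gtr_pMr.
Qed.

End TateExponentials.

(** * Convergence over the algebraic closure *)

Section Convergence.
Variables (R : realType) (p : nat) (pr_p : prime p).
Variables (Qp : fieldType) (absQ : Qp -> R) (hQp : is_Qp p absQ).
Variables (K : closedFieldType) (iota : {rmorphism Qp -> K}) (absK : K -> R).
Hypothesis hK : is_Qp_alg absQ iota absK.
Let HQ : nonarch_abs absQ := Qp_abs hQp.
Let HK : nonarch_abs absK := Qp_alg_abs hK.

(** The Q_p-subspace of K spanned by s, given by peeling off one generator at a time so that
    completeness can be proved by induction on s. The generators may be dependent. *)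
Fixpoint inspan (s : seq K) (v : K) : Prop :=
  if s is e :: s' then exists c, inspan s' (v - iota c * e) else v = 0.

Lemma inspan0 s : inspan s 0.
Proof. by elim: s => //= e s IH; exists 0; rewrite rmorph0 mul0r subr0. Qed.

Lemma inspanD s u v : inspan s u -> inspan s v -> inspan s (u + v).
Proof.
elim: s u v => [|e s IH] u v /=; first by move=> -> ->; rewrite addr0.
move=> [c hc] [d hd]; exists (c + d); rewrite rmorphD mulrDl opprD addrACA.
exact: IH.
Qed.

Lemma inspanZ s a v : inspan s v -> inspan s (iota a * v).
Proof.
elim: s v => [|e s IH] v /=; first by move=> ->; rewrite mulr0.
by move=> [c hc]; exists (a * c); rewrite rmorphM -mulrA -mulrBr; apply: IH.
Qed.

Lemma inspanB s u v : inspan s u -> inspan s v -> inspan s (u - v).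
Proof.
move=> hu hv; apply: inspanD => //; rewrite -mulN1r -(rmorph1 iota) -rmorphN.
exact: inspanZ.
Qed.

Lemma inspan_lin s (c : nat -> Qp) x0 :
  inspan s (\sum_(i < size s) iota (c i) * nth x0 s i).
Proof.
elim: s c => [|e s IH] c /=; first by rewrite big_ord0.
exists (c 0); rewrite big_ord_recl /= addrAC subrr add0r.
exact: (IH (fun i => c i.+1)).
Qed.

Lemma converges_cauchy (u : nat -> K) l : converges_to absK u l -> cauchy_seq absK u.
Proof.
move=> h e /h[N hN]; exists N => m n Nm Nn; rewrite -(subrKA l (u m)).
by rewrite -opprB; apply: (naD_lt HK); rewrite ?(naN HK) ?hN // (naBC HK) hN.
Qed.

Lemma converges_unique (u : nat -> K) l l' :
  converges_to absK u l -> converges_to absK u l' -> l = l'.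
Proof.
move=> h h'; apply/eqP; rewrite -subr_eq0 -(na_eq0 HK) eq_le (na_ge0 HK) andbT.
rewrite leNgt; apply/negP => lt0; have [N hN] := h _ lt0; have [N' hN'] := h' _ lt0.
pose n := maxn N N'; suff : absK (l - l') < absK (l - l') by rewrite ltxx.
rewrite -{1}(subrKA (u n)); apply: (naD_lt HK); last by apply: hN'; apply: leq_maxr.
by rewrite (naBC HK); apply: hN; apply: leq_maxl.
Qed.

(** If the new generator e is outside the span of s, that span is complete, hence closed, and lies
    at a distance d > 0 from e. Then |c_m - c_n| d <= |u_m - u_n|, so the coordinates along e form a
    Cauchy sequence in Q_p. *)
Lemma inspan_complete s (u : nat -> K) : (forall n, inspan s (u n)) ->
  cauchy_seq absK u -> exists2 l, inspan s l & converges_to absK u l.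
Proof.
elim: s u => [|e s IH] u hu cu.
  exists 0 => // eps eps0; exists 0%N => n _.
  by rewrite (hu n) subrr (na0 HK).
have [es|nes] := EM (inspan s e).
  have hu' n : inspan s (u n).
    have [c hc] := hu n; rewrite -(subrK (iota c * e) (u n)).
    by apply: inspanD => //; apply: inspanZ.
  have [l hl cl] := IH u hu' cu; exists l => //.
  by exists 0; rewrite rmorph0 mul0r subr0.
have [d d0 hd] : exists2 d : R, 0 < d & forall v, inspan s v -> d <= absK (e - v).
  apply: contrapT => nd.
  have /choice[v hv] : forall n : nat, exists v, inspan s v /\ absK (e - v) < n.+1%:R^-1.
    move=> n; apply: contrapT => nv; apply: nd; exists n.+1%:R^-1.
      by rewrite invr_gt0 ltr0n.
    by move=> v sv; rewrite leNgt; apply/negP => lt; apply: nv; exists v.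
  have cv : converges_to absK v e.
    move=> eps eps0; have /archi_boundP : 0 <= eps^-1 by rewrite invr_ge0 ltW.
    set N := Num.bound _ => hN; exists N => n Nn; rewrite (naBC HK).
    apply: lt_trans (proj2 (hv n)) _; rewrite invf_plt ?posrE ?ltr0n //.
    by apply: lt_le_trans hN _; rewrite ler_nat ltnW.
  have [l hl cl] := IH v (fun n => proj1 (hv n)) (converges_cauchy cv).
  by apply: nes; rewrite (converges_unique cv cl).
have /choice[c hc] := hu.
pose v n := u n - iota (c n) * e.
have dle m n : absQ (c m - c n) * d <= absK (u m - u n).
  have [->|c0] := eqVneq (c m) (c n).
    by rewrite subrr (na0 HQ) mul0r (na_ge0 HK).
  have cd0 : c m - c n != 0 by rewrite subr_eq0.
  have -> : u m - u n = iota (c m - c n) * (e - iota (c m - c n)^-1 * (v n - v m)).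
    rewrite mulrBr mulrA -rmorphM divff // rmorph1 mul1r /v rmorphB; ring.
  rewrite (naM HK) (Qp_alg_ext hK) ler_wpM2l ?(na_ge0 HQ) //.
  by apply: hd; apply: inspanZ; apply: inspanB; apply: hc.
have cc : cauchy_seq absQ c.
  move=> eps eps0; have [N hN] := cu _ (mulr_gt0 eps0 d0); exists N => m n Nm Nn.
  by rewrite -(ltr_pM2r d0); apply: le_lt_trans (dle _ _) (hN _ _ Nm Nn).
have [c0 hc0] := Qp_complete hQp cc.
have e0 : e != 0 by apply: contra_notN nes => /eqP->; apply: inspan0.
have ce : converges_to absK (fun n => iota (c n) * e) (iota c0 * e).
  move=> eps eps0; have ae : 0 < absK e by rewrite (na_gt0 HK).
  have [N hN] := hc0 _ (divr_gt0 eps0 ae); exists N => n Nn.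
  rewrite -mulrBl -rmorphB (naM HK) (Qp_alg_ext hK) -ltr_pdivlMr //.
  exact: hN.
have cv : cauchy_seq absK v.
  move=> eps eps0; have [N1 h1] := cu _ eps0.
  have [N2 h2] := converges_cauchy ce eps0; exists (maxn N1 N2) => m n.
  rewrite !geq_max => /andP[m1 m2] /andP[n1 n2].
  have -> : v m - v n = (u m - u n) - (iota (c m) * e - iota (c n) * e) by rewrite /v; ring.
  by apply: (naD_lt HK); rewrite ?(naN HK); [apply: h1|apply: h2].
have [l hl cl] := IH v hc cv; exists (l + iota c0 * e).
  by exists c0; rewrite addrK.
move=> eps eps0; have [N1 h1] := cl _ eps0; have [N2 h2] := ce _ eps0.
exists (maxn N1 N2) => n; rewrite geq_max => /andP[n1 n2].
have -> : u n - (l + iota c0 * e) = (v n - l) + (iota (c n) * e - iota c0 * e).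
  by rewrite /v; ring.
by apply: (naD_lt HK); [apply: h1|apply: h2].
Qed.

Definition inadj (z v : K) := exists r : {poly Qp}, (map_poly iota r).[z] = v.

Lemma inadjD z u v : inadj z u -> inadj z v -> inadj z (u + v).
Proof. by move=> [r <-] [s <-]; exists (r + s); rewrite rmorphD hornerD. Qed.

Lemma inadjM z u v : inadj z u -> inadj z v -> inadj z (u * v).
Proof. by move=> [r <-] [s <-]; exists (r * s); rewrite rmorphM hornerM. Qed.

Lemma inadj_iota z c : inadj z (iota c).
Proof. by exists c%:P; rewrite map_polyC hornerC. Qed.

Lemma inadj_nat z n : inadj z n%:R.
Proof. by rewrite -(rmorph_nat iota); apply: inadj_iota. Qed.

Lemma inadj_natV z n : inadj z n%:R^-1.
Proof. by rewrite -(rmorph_nat iota) -fmorphV; apply: inadj_iota. Qed.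

Lemma inadjN z v : inadj z v -> inadj z (- v).
Proof. by move=> [r <-]; exists (- r); rewrite rmorphN hornerN. Qed.

Lemma inadjX z v n : inadj z v -> inadj z (v ^+ n).
Proof. by move=> [r <-]; exists (r ^+ n); rewrite rmorphXn horner_exp. Qed.

Lemma inadj_sum z (I : Type) (r : seq I) (Q : pred I) (F : I -> K) :
  (forall i, inadj z (F i)) -> inadj z (\sum_(i <- r | Q i) F i).
Proof.
move=> h; elim/big_ind: _ => [|x y|i _] //; last exact: inadjD.
by rewrite -(rmorph0 iota); apply: inadj_iota.
Qed.

Lemma inadj_trans z y v : inadj z y -> inadj y v -> inadj z v.
Proof.
move=> [r hr] [s hs]; exists (s \Po r).
by rewrite map_comp_poly horner_comp hr.
Qed.

Lemma primitive_elt (s : seq K) : exists z, forall v, v \in s -> inadj z v.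
Proof.
elim: s => [|x s [y hy]]; first by exists 0.
have [px px0 rx] := Qp_alg_algebraic hK x; have [py py0 ry] := Qp_alg_algebraic hK y.
have [n [zx zy]] := pchar0_PET px0 rx py0 ry (pchar_padic HQ pr_p (Qp_abs_p hQp)).
eexists => v; rewrite inE => /orP[/eqP->|/hy]; first exact: zx.
exact: inadj_trans zy.
Qed.

(** Division by a polynomial annihilating z leaves combinations of finitely many powers of z. *)
Lemma inadj_inspan z : exists s, forall v, inadj z v -> inspan s v.
Proof.
have [f f0 fz] := Qp_alg_algebraic hK z.
exists (mkseq (fun i => z ^+ i) (size f)) => v [r <-].
rewrite (divp_eq r f) rmorphD rmorphM hornerD hornerM (rootP fz) mulr0 add0r.
have sz : (size (map_poly iota (r %% f)%R) <= size f)%N.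
  by apply: leq_trans (size_poly _ _) _; rewrite ltnW // ltn_modp.
rewrite (horner_coef_wide _ sz).
pose b := mkseq (fun i => z ^+ i) (size f).
have := inspan_lin b (fun i => (r %% f)%R`_i) 0.
rewrite -(big_mkord xpredT (fun i => iota (r %% f)%R`_i * nth 0 b i)) size_mkseq.
rewrite big_mkord; congr (inspan _ _).
by apply: eq_bigr => i _; rewrite nth_mkseq ?coef_map.
Qed.

(** All partial sums at x lie in the finite extension generated by z and x, where Cauchy sequences
    converge. The choice e = (s^-1 - 1) / 2 gives the ratio s (1 + e) = (s + 1) / 2 < 1. *)
Lemma bounded_overconvergent a : geometric_decay absK a ->
  (exists z, forall n, inadj z (a n)) -> overconvergent absK a.
Proof.
move=> [C [s [C0 /andP[s0 s1] ha]]] [z hz]; exists ((s^-1 - 1) / 2).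
  by rewrite divr_gt0 // subr_gt0 invf_gt1.
move=> x hx; have [y hy] := primitive_elt [:: z; x].
have zy : inadj y z by apply: hy; rewrite mem_head.
have xy : inadj y x by apply: hy; rewrite inE mem_head orbT.
have [l hl] := inadj_inspan y.
pose u n := \sum_(i < n) a i * x ^+ i.
have hu n : inspan l (u n).
  apply/hl/inadj_sum => i; apply: inadjM; last exact: inadjX.
  exact: inadj_trans zy (hz _).
pose t := s * (1 + (s^-1 - 1) / 2).
have t01 : 0 <= t < 1.
  have -> : t = (s + 1) / 2 by rewrite /t; field; rewrite gt_eqF.
  by apply/andP; split; lra.
have [t0 t1] := andP t01.
have term n : absK (a n * x ^+ n) <= C * t ^+ n.
  rewrite /t exprMn mulrA; apply: (naM_le HK) => //.
  by rewrite (naX HK) lerXn2r ?nnegrE ?(na_ge0 HK) ?ltW // (le_lt_trans _ hx) // (na_ge0 HK).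
have tail N k : absK (u (k + N)%N - u N) <= C * t ^+ N.
  elim: k => [|k IH]; first by rewrite subrr (na0 HK) mulr_ge0 // exprn_ge0.
  rewrite addSn /u big_ord_recr /= -/(u _) addrAC; apply: (naD_le HK) => //.
  apply: le_trans (term _) _; rewrite ler_wpM2l // ler_wiXn2l ?(ltW t1) //.
  exact: leq_addl.
have [L _ cL] : exists2 L, inspan l L & converges_to absK u L.
  apply: inspan_complete => // eps eps0.
  have C1 : 0 < C + 1 by rewrite ltr_wpDl.
  have [N hN] := exp_small t01 (divr_gt0 eps0 C1).
  have small : C * t ^+ N < eps.
    rewrite ltr_pdivlMr // mulrC in hN; apply: le_lt_trans hN.
    by rewrite ler_wpM2r ?exprn_ge0 // lerDl.
  exists N => m n Nm Nn; rewrite -(subrKA (u N)) -[u N - u n]opprB.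
  apply: (naD_lt HK); rewrite ?(naN HK); apply: le_lt_trans small.
    by rewrite -(subnK Nm).
  by rewrite -(subnK Nn).
by exists L.
Qed.

(** An n-th root of 1/p in the algebraically closed field K, with n so large that p < (1 + e)^n. *)
Lemma exists_abs_gt1 (e : R) : 0 < e -> exists x, 1 < absK x < 1 + e.
Proof.
move=> e0; have pK : absK p%:R = p%:R^-1.
  by rewrite -(rmorph_nat iota) (Qp_alg_ext hK) (Qp_abs_p hQp).
have p0R : 0 < p%:R :> R by rewrite ltr0n prime_gt0.
have i01 : 0 <= (1 + e)^-1 < 1.
  by rewrite invr_ge0 invf_lt1 ?ltrDl ?e0 ?andbT ?addr_ge0 ?ltW // ltr_wpDr // ltW.
have [n hn] := exp_small i01 (pinv_gt0 R pr_p).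
have n0 : (0 < n)%N.
  by case: n hn => //; rewrite expr0 => /lt_trans/(_ (pinv_lt1 R pr_p)); rewrite ltxx.
have [x hx] := @solve_monicpoly K n (fun i => p%:R^-1 *+ (i == 0%N)) n0.
have {}hx : x ^+ n = p%:R^-1.
  rewrite hx (bigD1 (Ordinal n0)) //= expr0 mulr1 mulr1n big1 ?addr0 // => i.
  by rewrite -val_eqE /= => /negPf->; rewrite mulr0n mul0r.
have axn : absK x ^+ n = p%:R by rewrite -(naX HK) hx (naV HK) pK invrK.
exists x; apply/andP; split; rewrite -(ltr_pXn2r n0) ?nnegrE ?(na_ge0 HK) ?ler01 ?addr_ge0 ?ltW //.
  by rewrite expr1n axn (ltr_nat R 1) prime_gt1.
rewrite axn -[ltLHS]invrK -[ltRHS]invrK -exprVn ltf_pV2 ?posrE ?invr_gt0 //.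
by rewrite exprn_gt0 // invr_gt0 addr_gt0.
Qed.

(** Convergence at a single x with |x| > 1 bounds the terms a_n x^n by 1 from some N on; the
    constant C absorbs the first N terms. *)
Lemma overconvergent_decay a : overconvergent absK a -> geometric_decay absK a.
Proof.
move=> [e e0 ha]; have [x /andP[x1 xe]] := exists_abs_gt1 e0.
have x0 : 0 < absK x by apply: lt_trans x1.
have [l hl] := ha x xe; have [N hN] := converges_cauchy hl ltr01.
pose C := 1 + \sum_(i < N) absK (a i) * absK x ^+ i.
have S0 : 0 <= \sum_(i < N) absK (a i) * absK x ^+ i.
  by apply: sumr_ge0 => i _; rewrite mulr_ge0 ?exprn_ge0 ?(na_ge0 HK).
have C1 : 1 <= C by rewrite lerDl.
exists C, (absK x)^-1; split; first exact: le_trans C1.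
  by rewrite invr_gt0 x0 invf_lt1.
move=> n; rewrite exprVn ler_pdivlMr ?exprn_gt0 //.
have [Nn|nN] := leqP N n; last first.
  rewrite /C (bigD1 (Ordinal nN)) //= addrCA lerDl addr_ge0 //.
  by apply: sumr_ge0 => i _; rewrite mulr_ge0 ?exprn_ge0 ?(na_ge0 HK).
apply: le_trans C1; rewrite -(naX HK) -(naM HK).
have := hN n.+1 n (leqW Nn) Nn; rewrite big_ord_recr /= addrAC subrr add0r.
exact: ltW.
Qed.

Lemma ghost_exp_inadj z x : (forall i, inadj z (x i)) ->
  forall n, inadj z (ghost_exp p x n).
Proof.
move=> hx; have K0 n : n.+1%:R != 0 :> K.
  by rewrite -(rmorph_nat iota) fmorph_eq0 (natS_neq0 HQ pr_p (Qp_abs_p hQp)).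
have [e0 re] := ghost_expP K0 p x; elim/ltn_ind => -[|n] IH.
  by rewrite e0; apply: (inadj_nat z 1).
rewrite -[ghost_exp _ _ _](mulKf (K0 n)) re; apply: inadjM; first exact: inadj_natV.
apply: inadj_sum => i; apply: inadjM; last by apply: IH; rewrite ltnS leq_subr.
apply: inadjM; first exact: inadj_nat.
rewrite /ghost_series; case: ifP => _; last exact: (inadj_nat z 0).
by apply: inadjM => //; rewrite -exprVn; apply: inadjX; apply: inadj_natV.
Qed.

End Convergence.

(** * The lemma of Lubin and Tate *)

Section MultivariateTruncation.
Variables (A : comNzRingType).

Section Order.
Variable n : nat.
Implicit Types (U V : {mpoly A[n]}) (m : 'X_{1..n}).

Definition morder d U := forall m, (mdeg m < d)%N -> U@_m = 0.

(* Congruence modulo monomials of degree greater than d. *)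
Definition meq d U V := morder d.+1 (U - V).

Lemma meqP d U V : meq d U V <-> forall m, (mdeg m <= d)%N -> U@_m = V@_m.
Proof.
split=> h m md; first by apply/eqP; rewrite -subr_eq0 -mcoeffB h.
by rewrite mcoeffB h // subrr.
Qed.

Lemma morder0 d : morder d 0. Proof. by move=> m _; rewrite mcoeff0. Qed.

Lemma morder_le c d U : (c <= d)%N -> morder d U -> morder c U.
Proof. by move=> cd h m mc; apply: h; apply: leq_trans cd. Qed.

Lemma morderD d U V : morder d U -> morder d V -> morder d (U + V).
Proof. by move=> hU hV m md; rewrite mcoeffD hU ?hV ?addr0. Qed.

Lemma morderN d U : morder d U -> morder d (- U).
Proof. by move=> hU m md; rewrite mcoeffN hU ?oppr0. Qed.

Lemma morderZ d c U : morder d U -> morder d (c *: U).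
Proof. by move=> hU m md; rewrite mcoeffZ hU ?mulr0. Qed.

Lemma morder_sum d (I : Type) (r : seq I) (Q : pred I) (F : I -> {mpoly A[n]}) :
  (forall i, Q i -> morder d (F i)) -> morder d (\sum_(i <- r | Q i) F i).
Proof.
move=> h; elim/big_ind: _ => [|U V|i /h] //; [exact: morder0|exact: morderD].
Qed.

Lemma morderM c d U V : morder c U -> morder d V -> morder (c + d) (U * V).
Proof.
move=> hU hV m md; rewrite mcoeffM big1 // => -[k1 k2] /eqP em.
have ek : mdeg m = (mdeg k1 + mdeg k2)%N by rewrite {1}em mdegD.
case: (ltnP (mdeg k1) c) => [/hU->|ck]; first by rewrite mul0r.
have aux a b e : (e = a + b -> c <= a -> c + b <= e)%N by lia.
by rewrite hV ?mulr0 // -(ltn_add2l c); apply: leq_ltn_trans (aux _ _ _ ek ck) md.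
Qed.

Lemma morderMl d U V : morder d V -> morder d (U * V).
Proof. by move=> hV; rewrite -[d]add0n; apply: morderM. Qed.

Lemma morderMr d U V : morder d U -> morder d (U * V).
Proof. by rewrite mulrC; apply: morderMl. Qed.

Lemma morderX d U k : morder d U -> morder (d * k) (U ^+ k).
Proof.
by move=> hU; elim: k => [|k IH]; rewrite ?muln0 // mulnS exprS; apply: morderM.
Qed.

Lemma morder1P U : morder 1 U <-> U@_0 = 0.
Proof.
split=> [h|h m]; first by apply: h; rewrite mdeg0.
by rewrite ltnS leqn0 mdeg_eq0 => /eqP->.
Qed.

Lemma morder1X U k : morder 1 U -> morder k (U ^+ k).
Proof. by move=> h; rewrite -[X in morder X]mul1n; apply: morderX. Qed.

Lemma morder_prod (I : Type) (r : seq I) (d : I -> nat) (F : I -> {mpoly A[n]}) :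
  (forall i, morder (d i) (F i)) -> morder (\sum_(i <- r) d i) (\prod_(i <- r) F i).
Proof.
move=> h; elim: r => [|i r IH]; first by rewrite !big_nil.
by rewrite !big_cons; apply: morderM.
Qed.

Lemma meq_refl d U : meq d U U. Proof. by apply/meqP. Qed.

Lemma meq_sym d U V : meq d U V -> meq d V U.
Proof. by move=> h; rewrite /meq -opprB; apply: morderN. Qed.

Lemma meq_trans d U V W : meq d U V -> meq d V W -> meq d U W.
Proof. by move=> h k; rewrite /meq -(subrKA V); apply: morderD. Qed.

Lemma meq_le c d U V : (c <= d)%N -> meq d U V -> meq c U V.
Proof. by move=> cd; apply: morder_le. Qed.

Lemma meqZ d c U V : meq d U V -> meq d (c *: U) (c *: V).
Proof. by move=> h; rewrite /meq -scalerBr; apply: morderZ. Qed.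

Lemma meqM d U U' V V' : meq d U U' -> meq d V V' -> meq d (U * V) (U' * V').
Proof.
move=> h k; rewrite /meq.
have -> : U * V - U' * V' = U * (V - V') + (U - U') * V' by ring.
by apply: morderD; [apply: morderMl|apply: morderMr].
Qed.

Lemma meqX d U V k : meq d U V -> meq d (U ^+ k) (V ^+ k).
Proof.
by move=> h; elim: k => [|k IH]; [apply: meq_refl|rewrite !exprS; apply: meqM].
Qed.

Lemma meq_sum d (I : Type) (r : seq I) (F G : I -> {mpoly A[n]}) :
  (forall i, meq d (F i) (G i)) -> meq d (\sum_(i <- r) F i) (\sum_(i <- r) G i).
Proof. by move=> h; rewrite /meq -sumrB; apply: morder_sum => i _; apply: h. Qed.

Lemma meq_prod d (I : Type) (r : seq I) (F G : I -> {mpoly A[n]}) :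
  (forall i, meq d (F i) (G i)) -> meq d (\prod_(i <- r) F i) (\prod_(i <- r) G i).
Proof.
move=> h; elim: r => [|i r IH]; first by rewrite !big_nil; apply: meq_refl.
by rewrite !big_cons; apply: meqM.
Qed.

Definition ueval (u : {poly A}) U : {mpoly A[n]} := (map_poly (@mpolyC n A) u).[U].

Lemma uevalE u U : ueval u U = \sum_(i < size u) u`_i *: U ^+ i.
Proof.
rewrite /ueval (horner_coef_wide _ (size_poly _ _)); apply: eq_bigr => i _.
by rewrite coef_map mul_mpolyC.
Qed.

Lemma ueval_wide d (u : {poly A}) U : (size u <= d)%N -> ueval u U = \sum_(i < d) u`_i *: U ^+ i.
Proof.
move=> ud; rewrite /ueval (@horner_coef_wide _ d) ?(leq_trans (size_poly _ _)) //.
by apply: eq_bigr => i _; rewrite coef_map mul_mpolyC.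
Qed.

Lemma ueval_truncps d f U : ueval (truncps d f) U = \sum_(i < d.+1) f i *: U ^+ i.
Proof.
rewrite (@ueval_wide d.+1) ?size_poly //; apply: eq_bigr => i _.
by rewrite coef_truncps -ltnS ltn_ord.
Qed.

Lemma uevalD u v U : ueval (u + v) U = ueval u U + ueval v U.
Proof. by rewrite /ueval rmorphD hornerD. Qed.

Lemma uevalB u v U : ueval (u - v) U = ueval u U - ueval v U.
Proof. by rewrite /ueval rmorphB hornerD hornerN. Qed.

Lemma uevalM u v U : ueval (u * v) U = ueval u U * ueval v U.
Proof. by rewrite /ueval rmorphM hornerM. Qed.

Lemma uevalXn u k U : ueval (u ^+ k) U = ueval u U ^+ k.
Proof. by rewrite /ueval rmorphXn horner_exp. Qed.

Lemma uevalC c U : ueval c%:P U = c%:MP.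
Proof. by rewrite /ueval map_polyC hornerC. Qed.

Lemma ueval1 U : ueval 1 U = 1. Proof. by rewrite /ueval rmorph1 hornerC. Qed.

Lemma uevalX U : ueval 'X U = U.
Proof. by rewrite /ueval map_polyX hornerX. Qed.

Lemma ueval_comp u v U : ueval (u \Po v) U = ueval u (ueval v U).
Proof. by rewrite /ueval map_comp_poly horner_comp. Qed.

Lemma meq_ueval d u U V : meq d U V -> meq d (ueval u U) (ueval u V).
Proof. by move=> h; rewrite !uevalE; apply: meq_sum => i; apply/meqZ/meqX. Qed.

Lemma ueval_coef_eq d u v U : morder 1 U -> coef_eq d.+1 u v ->
  meq d (ueval u U) (ueval v U).
Proof.
move=> U1 uv; rewrite /meq -uevalB uevalE; apply: morder_sum => i _.
have [id|di] := ltnP i d.+1; first by rewrite coefB uv // subrr scale0r; apply: morder0.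
by apply/morderZ/(morder_le di)/morder1X.
Qed.

Lemma ueval_morder1 (u : {poly A}) U : u`_0 = 0 -> morder 1 U -> morder 1 (ueval u U).
Proof.
move=> u0 U1; rewrite uevalE; apply: morder_sum => -[[|i] id] _ /=.
  by rewrite u0 scale0r; apply: morder0.
by apply/morderZ/(@morder_le 1 i.+1)/morder1X.
Qed.

End Order.

Section Composition.
Variables n k : nat.
Implicit Types (F G : {mpoly A[k]}) (t : k.-tuple {mpoly A[n]}).

Lemma meq_comp d F t t' : (forall i, meq d (tnth t i) (tnth t' i)) ->
  meq d (F \mPo t) (F \mPo t').
Proof.
move=> h; rewrite !comp_mpolyE; apply: meq_sum => m; apply: meqZ.
by apply: meq_prod => i; apply: meqX.
Qed.

Lemma morder_comp d F t : (forall i, morder 1 (tnth t i)) -> morder d F ->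
  morder d (F \mPo t).
Proof.
move=> t1 hF; rewrite comp_mpolyE; apply: morder_sum => m _.
have [md|dm] := ltnP (mdeg m) d; first by rewrite hF // scale0r; apply: morder0.
apply/morderZ/(morder_le dm); rewrite mdegE.
by apply: morder_prod => i; apply: morder1X.
Qed.

Lemma comp_meq d F G t : (forall i, morder 1 (tnth t i)) -> meq d F G ->
  meq d (F \mPo t) (G \mPo t).
Proof. by move=> t1 h; rewrite /meq -comp_mpolyB; apply: morder_comp. Qed.

Lemma comp_ueval u F t : ueval u F \mPo t = ueval u (F \mPo t).
Proof.
rewrite !uevalE raddf_sum; apply: eq_bigr => i _ /=.
by rewrite comp_mpolyZ rmorphXn.
Qed.

End Composition.

Lemma comp_mpolyA n k l (F : {mpoly A[l]}) (t : l.-tuple {mpoly A[k]})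
    (s : k.-tuple {mpoly A[n]}) :
  (F \mPo t) \mPo s = F \mPo [tuple of map (fun G => G \mPo s) t].
Proof.
rewrite [F \mPo t]comp_mpolyE raddf_sum [RHS]comp_mpolyE; apply: eq_bigr => m _ /=.
rewrite comp_mpolyZ rmorph_prod; congr (_ *: _); apply: eq_bigr => i _.
by rewrite rmorphXn tnth_map.
Qed.

Section Series.
Variable n : nat.
Implicit Types (F : 'X_{1..n} -> A).

Lemma mcoeff_mtruncps d F m : (mtruncps d F)@_m = if (mdeg m <= d)%N then F m else 0.
Proof.
rewrite /mtruncps raddf_sum /=; case: ifP => [md|/negbT].
  rewrite (bigD1 (BMultinom (md : (mdeg m < d.+1)%N))) //= big1 ?addr0.
    by rewrite mcoeffZ mcoeffX eqxx mulr1.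
  move=> j; rewrite -val_eqE /= => jm; rewrite mcoeffZ mcoeffX.
  by rewrite (negPf jm) mulr0.
move=> md; rewrite big1 // => j _; rewrite mcoeffZ mcoeffX.
case: eqP => [e|_]; last by rewrite mulr0.
by move: md; rewrite -e -ltnNge ltnNge -ltnS bmdeg.
Qed.

Lemma meq_mtruncps c d F : (c <= d)%N -> meq c (mtruncps c F) (mtruncps d F).
Proof.
by move=> cd; apply/meqP => m mc; rewrite !mcoeff_mtruncps mc (leq_trans mc cd).
Qed.

Lemma morder1_mtruncps d F : F 0%MM = 0 -> morder 1 (mtruncps d F).
Proof. by move=> F0; apply/morder1P; rewrite mcoeff_mtruncps mdeg0. Qed.

Lemma eq_mtruncps d F G : F =1 G -> meq d (mtruncps d F) (mtruncps d G).
Proof. by move=> FG; apply/meqP => m md; rewrite !mcoeff_mtruncps FG. Qed.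

Lemma mtruncps_eq F G :
  (forall d, meq d.+1 (mtruncps d.+1 F) (mtruncps d.+1 G)) -> F =1 G.
Proof.
move=> h m; have /meqP/(_ m (leqnSn _)) := h (mdeg m).
by rewrite !mcoeff_mtruncps leqnSn.
Qed.

Lemma mtruncps_mcoeff d (U : {mpoly A[n]}) : meq d (mtruncps d (fun m => U@_m)) U.
Proof. by apply/meqP => m md; rewrite mcoeff_mtruncps md. Qed.

Lemma mtruncps_ucompps d f F : F 0%MM = 0 ->
  meq d (mtruncps d (ucompps f F)) (ueval (truncps d f) (mtruncps d F)).
Proof.
move=> F0; apply/meqP => m md; rewrite mcoeff_mtruncps md /ucompps -ueval_truncps.
have F1 := morder1_mtruncps (mdeg m) F0.
suff /meqP : meq (mdeg m) (ueval (truncps (mdeg m) f) (mtruncps (mdeg m) F))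
    (ueval (truncps d f) (mtruncps d F)) by apply.
apply: meq_trans (meq_ueval _ (meq_mtruncps F md)).
by apply: ueval_coef_eq => //; apply/coef_eq_sym/truncps_le.
Qed.

End Series.

Lemma mtruncps_mcompps n d k (G : 'X_{1..k} -> A) (t : k.-tuple ('X_{1..n} -> A)) :
  (forall i, tnth t i 0%MM = 0) ->
  meq d (mtruncps d (mcompps G t)) (mtruncps d G \mPo [tuple of map (mtruncps d) t]).
Proof.
move=> t0; apply/meqP => m md; rewrite mcoeff_mtruncps md /mcompps.
suff /meqP : meq (mdeg m) (mtruncps (mdeg m) G \mPo [tuple of map (mtruncps (mdeg m)) t])
    (mtruncps d G \mPo [tuple of map (mtruncps d) t]) by apply.
apply: (meq_trans (V := mtruncps d G \mPo [tuple of map (mtruncps (mdeg m)) t])).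
  apply: comp_meq; last exact: (meq_mtruncps _ md).
  by move=> i; rewrite tnth_map; apply: morder1_mtruncps.
by apply: meq_comp => i; rewrite !tnth_map; apply: meq_mtruncps.
Qed.

End MultivariateTruncation.

Section LeadingForms.
Variables (A : comNzRingType) (n : nat).
Implicit Types (U V : {mpoly A[n]}) (m : 'X_{1..n}).

(* U and V have order at least a and the same homogeneous part of degree a. *)
Definition mlike a U V := [/\ morder a U, morder a V & meq a U V].

Lemma mlike_refl a U : morder a U -> mlike a U U.
Proof. by move=> h; split=> //; apply: meq_refl. Qed.

Lemma mlikeM a b U U' V V' : mlike a U V -> mlike b U' V' ->
  mlike (a + b) (U * U') (V * V').
Proof.
move=> [hU hV hUV] [hU' hV' hUV']; split; try exact: morderM.
rewrite /meq; have -> : U * U' - V * V' = U * (U' - V') + (U - V) * V' by ring.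
by apply: morderD; [rewrite -addnS|rewrite -addSn]; apply: morderM.
Qed.

Lemma mlikeX U V k : mlike 1 U V -> mlike k (U ^+ k) (V ^+ k).
Proof.
move=> h; elim: k => [|k IH]; first by apply: mlike_refl.
by rewrite !exprS -add1n; apply: mlikeM.
Qed.

Lemma mlike_prod (I : Type) (r : seq I) (d : I -> nat) (F G : I -> {mpoly A[n]}) :
  (forall i, mlike (d i) (F i) (G i)) ->
  mlike (\sum_(i <- r) d i) (\prod_(i <- r) F i) (\prod_(i <- r) G i).
Proof.
move=> h; elim: r => [|i r IH]; first by rewrite !big_nil; apply: mlike_refl.
by rewrite !big_cons; apply: mlikeM.
Qed.

Lemma ueval_low d (u : {poly A}) U : (forall i, (i < d)%N -> u`_i = 0) -> morder 1 U ->
  morder d (ueval u U).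
Proof.
move=> u0 U1; rewrite uevalE; apply: morder_sum => i _.
have [id|di] := ltnP i d; first by rewrite u0 // scale0r; apply: morder0.
by apply/morderZ/(morder_le di)/morder1X.
Qed.

Lemma ueval_linear (u : {poly A}) U : u`_0 = 0 -> morder 1 U ->
  meq 1 (ueval u U) (u`_1 *: U).
Proof.
move=> u0 U1; have -> : u`_1 *: U = ueval (u`_1 *: 'X) U.
  by rewrite -mul_polyC uevalM uevalC uevalX mul_mpolyC.
rewrite /meq -uevalB; apply: ueval_low => // -[|[|i]] // _.
  by rewrite coefB coefZ coefX u0 mulr0 subrr.
by rewrite coefB coefZ coefX mulr1 subrr.
Qed.

(** Linearization: for i >= 2 the cofactor of U - V in U^i - V^i has positive order, so only the
    linear term of u acts on the first degree in which U and V differ. *)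
Lemma ueval_diff e (u : {poly A}) U V : morder 1 U -> morder 1 V -> meq e U V ->
  meq e.+1 (ueval u U - ueval u V) (u`_1 *: (U - V)).
Proof.
move=> U1 V1 UV; rewrite (@ueval_wide _ _ (size u).+2 u U) ?(@ueval_wide _ _ (size u).+2 u V) ?leqW //.
rewrite -sumrB !big_ord_recl /= !expr0 subrr add0r -scalerBr !expr1.
rewrite /meq addrAC subrr add0r; apply: morder_sum => i _.
rewrite -scalerBr; apply: morderZ; rewrite subrXX -[e.+2]addn1.
apply: morderM => //; apply: morder_sum => -[j /=]; rewrite /bump /= !add1n ltnS => ji _.
case: j ji => [|j] _; first by apply: morderMr; apply: (@morder_le _ _ 1 i.+1) => //; apply: morder1X.
by apply: morderMl; apply: (@morder_le _ _ 1 j.+1) => //; apply: morder1X.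
Qed.

(** The part of degree d of the composite sees only the linear forms of the substituted series. *)
Lemma comp_mlike k d (D : {mpoly A[k]}) (t t' : k.-tuple {mpoly A[n]}) :
  (forall i, mlike 1 (tnth t i) (tnth t' i)) -> morder d D ->
  meq d (D \mPo t) (D \mPo t').
Proof.
move=> tt' hD; rewrite /meq !comp_mpolyE -sumrB; apply: morder_sum => m _.
have [md|dm] := ltnP (mdeg m) d; first by rewrite hD // !scale0r subrr; apply: morder0.
rewrite -scalerBr; apply: morderZ; apply: (@morder_le _ _ d.+1 (mdeg m).+1) => //.
by rewrite mdegE; have [_ _] := @mlike_prod _ (index_enum 'I_k) (fun i => m i)
  (fun i => tnth t i ^+ m i) (fun i => tnth t' i ^+ m i) (fun i => mlikeX (m i) (tt' i)).
Qed.

Lemma comp_scale c (D : {mpoly A[n]}) m :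
  (D \mPo [tuple c *: 'X_i | i < n])@_m = c ^+ mdeg m * D@_m.
Proof.
have E (k : 'X_{1..n}) : \prod_(i < n) tnth [tuple c *: ('X_i : {mpoly A[n]}) | i < n] i ^+ k i
    = c ^+ mdeg k *: 'X_[k].
  rewrite mpolyXE_id mdegE -prodrXr -scaler_prod.
  by apply: eq_bigr => i _; rewrite tnth_mktuple exprZn.
rewrite comp_mpolyE [in RHS](mpolyE D) !raddf_sum /= mulr_sumr.
apply: eq_bigr => k _; rewrite /= E !mcoeffZ mcoeffX mulrCA.
by case: eqP => [->|_]; rewrite ?mulr1 // !mulr0.
Qed.

Lemma mcoeff_uevalX (u : {poly A}) i k : (ueval u ('X_i : {mpoly A[n]}))@_(U_(i) *+ k)%MM = u`_k.
Proof.
rewrite uevalE raddf_sum /=.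
have E j : ('X_i ^+ j : {mpoly A[n]})@_(U_(i) *+ k)%MM = (j == k)%:R.
  rewrite mcoeffXn; congr (nat_of_bool _)%:R; apply/eqP/eqP => [e|->] //.
  by have := congr1 (fun m : 'X_{1..n} => m i) e; rewrite !mulmnE mnm1E eqxx !mul1n.
have [ks|sk] := ltnP k (size u).
  rewrite (bigD1 (Ordinal ks)) //= big1 ?addr0 => [|j].
    by rewrite mcoeffZ E eqxx mulr1.
  by rewrite -val_eqE /= => jk; rewrite mcoeffZ E (negPf jk) mulr0.
rewrite nth_default // big1 // => j _; rewrite mcoeffZ E ltn_eqF ?mulr0 //.
exact: leq_trans sk.
Qed.

Definition usubst (u : {poly A}) : n.-tuple {mpoly A[n]} := [tuple ueval u 'X_i | i < n].

Lemma morder1_X (i : 'I_n) : morder 1 ('X_i : {mpoly A[n]}).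
Proof. by apply/morder1P; rewrite mcoeffX -mdeg_eq0 mdeg1. Qed.

End LeadingForms.

Arguments morder1_X {A n}.

(** * Uniqueness of solutions of Q(F) = F(P, ..., P) with a given linear part *)

Section LubinTateUniqueness.
Variables (A : fieldType) (c : A).
Hypothesis c_dil : forall e, c ^+ e.+2 != c.

(** If F1 and F2 first differ in degree e + 2, comparing that degree in both equations shows that
    the difference D satisfies c D = c^(e+2) D, which [c_dil] excludes. *)
Lemma ueval_unique n d (P Q : {poly A}) (F1 F2 : {mpoly A[n]}) :
  P`_0 = 0 -> Q`_0 = 0 -> P`_1 = c -> Q`_1 = c -> morder 1 F1 -> morder 1 F2 ->
  meq 1 F1 F2 ->
  meq d (ueval Q F1) (F1 \mPo usubst n P) -> meq d (ueval Q F2) (F2 \mPo usubst n P) ->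
  meq d F1 F2.
Proof.
move=> P0 Q0 P1 Q1 o1 o2 lin h1 h2.
suff all e : (e <= d)%N -> meq e F1 F2 by apply: all.
elim: e => [|[|e] IH] ed; [exact: meq_le lin|exact: lin|].
have {}IH := IH (ltnW ed); have hd := ueval_diff Q o1 o2 IH; rewrite Q1 in hd.
have hs : meq e.+2 ((F1 - F2) \mPo usubst n P) ((F1 - F2) \mPo [tuple c *: 'X_i | i < n]).
  apply: comp_mlike => // i; rewrite !tnth_mktuple; split.
  - by apply: ueval_morder1 => //; apply: morder1_X.
  - by apply/morderZ/morder1_X.
  - by rewrite -P1; apply: ueval_linear => //; apply: morder1_X.
apply/meqP => m; rewrite leq_eqVlt => /orP[/eqP me|me]; last first.
  by move/meqP: IH; apply; rewrite -ltnS.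
apply/eqP; rewrite -subr_eq0 -mcoeffB.
have E : c * (F1 - F2)@_m = c ^+ e.+2 * (F1 - F2)@_m.
  move/meqP: hd => /(_ m); rewrite me leqnn mcoeffZ => <- //.
  rewrite -me -comp_scale; move/meqP: hs => /(_ m); rewrite me => <- //.
  rewrite comp_mpolyB !mcoeffB.
  move/meqP: h1 => /(_ m); rewrite me => -> //.
  by move/meqP: h2 => /(_ m); rewrite me => -> //.
have : (c ^+ e.+2 - c) * (F1 - F2)@_m == 0 by rewrite mulrBl E subrr.
by rewrite mulf_eq0 subr_eq0 (negPf (c_dil e)).
Qed.

Lemma poly_unique d (P u1 u2 : {poly A}) :
  P`_0 = 0 -> P`_1 = c -> u1`_0 = 0 -> u2`_0 = 0 -> u1`_1 = u2`_1 ->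
  coef_eq d.+1 (P \Po u1) (u1 \Po P) -> coef_eq d.+1 (P \Po u2) (u2 \Po P) ->
  coef_eq d.+1 u1 u2.
Proof.
move=> P0 P1 u10 u20 u12 h1 h2.
have o (u : {poly A}) : u`_0 = 0 -> morder 1 (ueval u ('X_0 : {mpoly A[1]})).
  by move=> u0; apply: ueval_morder1 => //; apply: morder1_X.
have C u : coef_eq d.+1 (P \Po u) (u \Po P) ->
    meq d (ueval P (ueval u ('X_0 : {mpoly A[1]}))) (ueval u 'X_0 \mPo usubst 1 P).
  move=> h; rewrite -ueval_comp comp_ueval.
  have -> : 'X_0 \mPo usubst 1 P = ueval P 'X_0.
    by rewrite comp_mpolyXU -tnth_nth tnth_mktuple.
  by rewrite -ueval_comp; apply: ueval_coef_eq => //; apply: morder1_X.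
have L : meq 1 (ueval u1 ('X_0 : {mpoly A[1]})) (ueval u2 'X_0).
  apply: meq_trans (ueval_linear u10 (morder1_X _)) _; rewrite u12.
  by apply/meq_sym/ueval_linear => //; apply: morder1_X.
have /meqP h := ueval_unique P0 P0 P1 P1 (o _ u10) (o _ u20) L (C _ h1) (C _ h2).
move=> i; rewrite ltnS => id; rewrite -(mcoeff_uevalX u1 (0 : 'I_1)).
by rewrite -(mcoeff_uevalX u2 (0 : 'I_1)) h // mdegMn mdeg1 mul1n.
Qed.

(** Both f(F) and G(f, ..., f) intertwine P and Q and have the same linear part, so uniqueness
    identifies them. *)
Lemma ueval_hom n d (P Q f : {poly A}) (F G : {mpoly A[n]}) :
  P`_0 = 0 -> Q`_0 = 0 -> P`_1 = c -> Q`_1 = c -> f`_0 = 0 -> f`_1 = 1 ->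
  morder 1 F -> morder 1 G -> meq 1 F G ->
  meq d (ueval P F) (F \mPo usubst n P) -> meq d (ueval Q G) (G \mPo usubst n Q) ->
  coef_eq d.+1 (Q \Po f) (f \Po P) ->
  meq d (ueval f F) (G \mPo usubst n f).
Proof.
move=> P0 Q0 P1 Q1 f0 f1 oF oG FG hP hQ hf.
have o (u : {poly A}) i : u`_0 = 0 -> morder 1 (tnth (usubst n u) i).
  by move=> u0; rewrite tnth_mktuple; apply: ueval_morder1 => //; apply: morder1_X.
have lin (U : {mpoly A[n]}) : morder 1 U -> meq 1 (ueval f U) U.
  by move=> U1; rewrite -[X in meq _ _ X]scale1r -f1; apply: ueval_linear.
apply: (ueval_unique P0 Q0 P1 Q1).
- exact: ueval_morder1.
- by apply: morder_comp => // i; apply: o.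
- apply: meq_trans (lin _ oF) _; apply: meq_trans FG _.
  rewrite -{1}[G]comp_mpoly_id; apply: meq_comp => i; rewrite !tnth_mktuple.
  by apply/meq_sym/lin/morder1_X.
- rewrite -ueval_comp; apply: meq_trans (ueval_coef_eq oF hf) _.
  by rewrite ueval_comp comp_ueval; apply: meq_ueval.
rewrite -comp_ueval; apply: (meq_trans (V := (G \mPo usubst n Q) \mPo usubst n f)).
  by apply: comp_meq => // i; apply: o.
rewrite !comp_mpolyA; apply: meq_comp => i.
have X v : 'X_i \mPo usubst n v = ueval v 'X_i.
  by rewrite comp_mpolyXU -tnth_nth tnth_mktuple.
have T u v : tnth [tuple of [seq U \mPo usubst n v | U <- usubst n u]] i
    = ueval (u \Po v) 'X_i.
  by rewrite tnth_map tnth_mktuple comp_ueval X ueval_comp.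
by rewrite !T; apply: ueval_coef_eq => //; apply: morder1_X.
Qed.

End LubinTateUniqueness.

Section CompositionTruncation.
Variable A : comNzRingType.
Implicit Types u v h : {poly A}.

Lemma coef_eq_compl d u u' v : v`_0 = 0 -> coef_eq d u u' -> coef_eq d (u \Po v) (u' \Po v).
Proof.
move=> v0 uu' i id; apply/eqP; rewrite -subr_eq0 -coefB -comp_polyB comp_polyE coef_sum.
rewrite big1 // => k _; rewrite coefZ; have [kd|dk] := ltnP k d.
  by rewrite coefB uu' // subrr mul0r.
by rewrite coef_exp_low ?mulr0 //; apply: leq_trans dk.
Qed.

Lemma coef_eq_compr d u v v' : coef_eq d v v' -> coef_eq d (u \Po v) (u \Po v').
Proof.
by move=> vv'; rewrite !comp_polyE; apply: coef_eq_sum => k; apply/coef_eqZ/coef_eqX.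
Qed.

Lemma coef0_comp u v : v`_0 = 0 -> (u \Po v)`_0 = u`_0.
Proof. by move=> v0; rewrite -!horner_coef0 horner_comp [v.[0]]horner_coef0 v0. Qed.

Lemma coef1_comp u v : v`_0 = 0 -> (u \Po v)`_1 = u`_1 * v`_1.
Proof.
move=> v0; have := coef_deriv (u \Po v) 0; rewrite mulr1n => <-.
by rewrite deriv_comp coef0M coef0_comp // !coef_deriv !mulr1n.
Qed.

Lemma coef_exp_lead u n : u`_0 = 0 -> (u ^+ n)`_n = u`_1 ^+ n.
Proof.
move=> u0; elim: n => [|n IH]; first by rewrite !expr0 coef1.
rewrite !exprS coefM big_ord_recl u0 mul0r add0r big_ord_recl /= big1 ?addr0.
  by rewrite /bump /= addn0 subn1 IH.
move=> i _; rewrite /bump /= !add1n subSS coef_exp_low ?mulr0 //.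
by case: n {IH} i => [[]//|n] i; rewrite subSS ltnS leq_subr.
Qed.

Lemma coef_comp_perturb n c u h i : h`_0 = 0 -> (i <= n.+1)%N ->
  (u \Po (h + c *: 'X^(n.+1)))`_i = (u \Po h)`_i + u`_1 * c *+ (i == n.+1).
Proof.
move=> h0 ni; set B := c *: _; apply/eqP; rewrite [eqbRHS]addrC -subr_eq -coefB; apply/eqP.
have B0 : B`_0 = 0 by rewrite coefZ coefXn mulr0.
rewrite !comp_polyE -sumrB coef_sum.
have E k : (u`_k *: (h + B) ^+ k - u`_k *: h ^+ k)`_i = (u`_1 * c *+ (i == n.+1)) *+ (k == 1)%N.
  rewrite -scalerBr subrXX addrAC subrr add0r /B -scalerAl !coefZ coefXnM.
  move: ni; rewrite leq_eqVlt => /orP[/eqP->|ni]; last first.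
    by rewrite ltnS in ni; rewrite ltnS ni ltn_eqF // mulr0 mulr0 mul0rn.
  rewrite ltnn subnn eqxx coef_sum; case: k => [|[|k]].
  - by rewrite big_ord0 !mulr0.
  - by rewrite big_ord_recl big_ord0 subnn !expr0 mulr1 addr0 coef1 mulr1.
  rewrite big1 ?mulr0 ?mulr0 // => -[j /=]; rewrite ltnS => jk _.
  rewrite coef0M; case: j jk => [|j] jk; last by rewrite [X in _ * X]coef_exp_low ?mulr0.
  by rewrite coef_exp_low ?mul0r // coefD h0 B0 addr0.
rewrite (eq_bigr (fun k : 'I_(size u) => u`_1 * c *+ (i == n.+1) *+ (nat_of_ord k == 1)%N));
  last by move=> k _; apply: E.
have [s1|s1] := ltnP 1 (size u).
  rewrite (bigD1 (Ordinal s1)) //= big1 ?addr0 // => k.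
  by rewrite -val_eqE /= => /negPf->.
rewrite nth_default // mul0r mul0rn big1 // => k _.
by rewrite ltn_eqF // (leq_trans (ltn_ord k)).
Qed.

End CompositionTruncation.

Section GaussComposition.
Variables (R : realType) (K : fieldType) (abs : K -> R).
Hypothesis Habs : nonarch_abs abs.

Lemma coefs_le_comp_sub c (u v v' : {poly K}) : 0 <= c -> coefs_le abs 1 u ->
  coefs_le abs 1 v -> coefs_le abs 1 v' -> coefs_le abs c (v - v') ->
  coefs_le abs c ((u \Po v) - (u \Po v')).
Proof.
move=> c0 hu hv hv' hvv'; rewrite !comp_polyE -sumrB; apply: (coefs_le_sum Habs) => // i _.
rewrite -scalerBr subrXX -mul_polyC mulrC -mulrA.
apply: (coefs_le_mulr Habs) => //; apply: (coefs_le_mulr Habs) => //.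
  apply: (coefs_le_sum Habs) => // j _.
  by apply: (coefs_le_mulr Habs) => //; apply: (coefs_le1X Habs).
exact: (coefs_leC Habs).
Qed.

End GaussComposition.

(** * Construction of the integral series intertwining two Lubin-Tate series for p *)

Section LubinTateExistence.
Variables (R : realType) (p : nat) (pr_p : prime p).
Variables (Qp : fieldType) (abs : Qp -> R) (hQp : is_Qp p abs).
Local Notation q := (p%:R^-1 : R).
Let HQ : nonarch_abs abs := Qp_abs hQp.
Let abs_p : abs p%:R = q := Qp_abs_p hQp.
Let q_gt0 := pinv_gt0 R pr_p.
Let q_lt1 := pinv_lt1 R pr_p.

(* P is a Lubin-Tate series for the uniformizer p. *)
Record lift_p (P : nat -> Qp) : Prop := LiftP {
  lift_p0 : P 0 = 0;
  lift_p1 : P 1 = p%:R;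
  lift_p_int : forall n, abs (P n) <= 1;
  lift_p_frob : forall n, abs (P n - (n == p)%:R) <= q }.

Lemma coefs_le_lift (P : nat -> Qp) d : (forall n, abs (P n - (n == p)%:R) <= q) ->
  (p <= d)%N -> coefs_le abs q (truncps d P - 'X^p).
Proof.
move=> hP pd i; rewrite coefB coefXn coef_truncps.
case: leqP => id; first exact: hP.
by rewrite gtn_eqF ?(leq_ltn_trans pd) // subrr (na0 HQ) ltW.
Qed.

Lemma p_dilates e : p%:R ^+ e.+2 != p%:R :> Qp.
Proof.
apply/eqP => /(congr1 abs); rewrite (naX HQ) abs_p => /eqP.
by rewrite -[X in _ == X]expr1 lt_eqF // ltr_iXn2l.
Qed.

Lemma abs_expp_sub n : abs (p%:R ^+ n.+2 - p%:R) = q.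
Proof.
rewrite -abs_p -(naN HQ p%:R); apply: (naD_eq HQ).
by rewrite (naN HQ) (naX HQ) abs_p -[ltRHS]expr1 ltr_iXn2l.
Qed.

Variables P Q : nat -> Qp.
Hypotheses (hP : lift_p P) (hQ : lift_p Q).

(** Adding a X^n to h changes the degree n coefficient of Q(h) - h(P) by (p - p^n) a, and this a
    cancels it. Truncation at n + p keeps the term X^p, needed for congruences modulo p. *)
Definition lt_coef (h : {poly Qp}) n : Qp :=
  ((truncps (n + p) Q \Po h) - (h \Po truncps (n + p) P))`_n / (p%:R ^+ n - p%:R).

(** In degree 1 the denominator p^n - p vanishes and the coefficient is free; 1 is chosen, which
    makes the series invertible. *)
Fixpoint lt_poly n : {poly Qp} :=
  if n is k.+1 then lt_poly k + (if k == 0 then 1 else lt_coef (lt_poly k) k.+1) *: 'X^(k.+1)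
  else 0.

Lemma coef_lt_poly_out n i : (n < i)%N -> (lt_poly n)`_i = 0.
Proof.
elim: n i => [|n IH] i ni; first by rewrite coef0.
by rewrite /= coefD coefZ coefXn IH 1?ltnW // [i == _]gtn_eqF // mulr0 addr0.
Qed.

Lemma coef_lt_polyS n i : (i <= n)%N -> (lt_poly n.+1)`_i = (lt_poly n)`_i.
Proof. by move=> id; rewrite /= coefD coefZ coefXn [i == _]ltn_eqF // mulr0 addr0. Qed.

Lemma lt_poly_coherent n i : (i <= n)%N -> (lt_poly n)`_i = (lt_poly i)`_i.
Proof.
move=> /subnK <-; elim: (n - i)%N => // k IH.
by rewrite addSn coef_lt_polyS ?leq_addl.
Qed.

Definition lt_series n : Qp := (lt_poly n)`_n.

Lemma truncps_lt_series n : truncps n lt_series = lt_poly n.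
Proof.
apply/polyP => i; rewrite coef_truncps; case: leqP => id; last by rewrite coef_lt_poly_out.
by rewrite [RHS]lt_poly_coherent.
Qed.

Lemma lt_series0 : lt_series 0 = 0. Proof. by rewrite /lt_series coef0. Qed.

Lemma lt_series1 : lt_series 1 = 1.
Proof. by rewrite /lt_series /= coefD coef0 coefZ coefXn mulr1 add0r. Qed.

Lemma trunc0 (f : nat -> Qp) d : f 0 = 0 -> (truncps d f)`_0 = 0.
Proof. by move=> f0; rewrite coef_truncps. Qed.

Lemma lt_poly_comm n d : (n <= d)%N ->
  coef_eq n.+1 (truncps d Q \Po lt_poly n) (lt_poly n \Po truncps d P).
Proof.
have h0 k : (lt_poly k)`_0 = 0 by rewrite lt_poly_coherent // coef0.
have P0 k := trunc0 k (lift_p0 hP); have Q0 k := trunc0 k (lift_p0 hQ).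
elim: n d => [|n IH] d nd i ni.
  by case: i ni => // _; rewrite !coef0_comp // !Q0 coef0.
rewrite ltnS in ni; have Q1 : (truncps d Q)`_1 = p%:R.
  by rewrite coef_truncps (leq_trans _ nd) // (lift_p1 hQ).
have P1 : (truncps d P)`_1 = p%:R.
  by rewrite coef_truncps (leq_trans _ nd) // (lift_p1 hP).
rewrite coef_comp_perturb // Q1 comp_polyD comp_polyZ comp_Xn_poly coefD coefZ.
move: ni; rewrite leq_eqVlt => /orP[/eqP->|ni]; last first.
  rewrite (IH d (ltnW nd)) // [i == _]ltn_eqF // mulr0n addr0.
  by rewrite coef_exp_low ?mulr0 ?addr0.
rewrite coef_exp_lead // P1 eqxx mulr1n; case: eqP => [->|/eqP n0].
  by rewrite mulr1 mul1r expr1 /= comp_poly0 comp_poly0r coef0 coefC.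
rewrite /lt_coef coefB; set D := (n.+1 + p)%N.
have ndD : (n.+1 <= D)%N by apply: leq_addr.
have e1 : (truncps D Q \Po lt_poly n)`_n.+1 = (truncps d Q \Po lt_poly n)`_n.+1.
  apply: (@coef_eq_compl _ n.+2) => // j; rewrite ltnS => jn.
  by rewrite !coef_truncps (leq_trans jn nd) (leq_trans jn ndD).
have e2 : (lt_poly n \Po truncps D P)`_n.+1 = (lt_poly n \Po truncps d P)`_n.+1.
  apply: (@coef_eq_compr _ n.+2) => // j; rewrite ltnS => jn.
  by rewrite !coef_truncps (leq_trans jn nd) (leq_trans jn ndD).
rewrite e1 e2; set a := _`_n.+1; set b := _`_n.+1.
have dn : p%:R ^+ n.+1 - p%:R != 0 :> Qp.
  by rewrite subr_eq0; case: n n0 {IH nd a b e1 e2 D ndD} => // n _; apply: p_dilates.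
by field.
Qed.

(** Modulo p both P and Q are X^p, so the numerator of the new coefficient is h^p - h(X^p) = 0
    modulo p, while the denominator has absolute value exactly |p|. *)
Lemma lt_poly_integral n : coefs_le abs 1 (lt_poly n).
Proof.
elim: n => [|n IH]; first exact: (coefs_le0 HQ).
apply: (coefs_leD HQ) => //; rewrite -mul_polyC; apply: (coefs_le_mulr HQ) => //; last first.
  exact: (coefs_leXn HQ).
apply: (coefs_leC HQ) => //; case: eqP => [_|/eqP n0]; first by rewrite (na1 HQ).
rewrite /lt_coef; case: n n0 IH => // n _ IH; rewrite (naM HQ) (naV HQ) abs_expp_sub.
rewrite ler_pdivrMr // mul1r; set h := lt_poly _ in IH *; set D := (n.+2 + p)%N.
have pD : (p <= D)%N by apply: leq_addl.
have iP := coefs_le_lift (lift_p_frob hP) pD.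
have iQ := coefs_le_lift (lift_p_frob hQ) pD.
have -> : (truncps D Q \Po h) - (h \Po truncps D P) =
   ((truncps D Q - 'X^p) \Po h) + (h ^+ p - (h \Po 'X^p)) - ((h \Po truncps D P) - (h \Po 'X^p)).
  by rewrite comp_polyB comp_Xn_poly; ring.
apply: (coefs_leB HQ).
  apply: (coefs_leD HQ); last exact: (coefs_le_frob pr_p hQp).
  by apply: (coefs_le_comp HQ) => //; apply: ltW.
apply: (coefs_le_comp_sub HQ) => //; first exact: ltW.
  by apply: (coefs_le_truncps HQ) => // i _; apply: (lift_p_int hP).
exact: (coefs_leXn HQ).
Qed.

Lemma lt_series_integral n : abs (lt_series n) <= 1.
Proof. exact: lt_poly_integral. Qed.

Lemma lt_series_comm d : coef_eq d.+1 (truncps d Q \Po truncps d lt_series)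
  (truncps d lt_series \Po truncps d P).
Proof. by rewrite truncps_lt_series; apply: lt_poly_comm. Qed.

End LubinTateExistence.

(** * Homomorphisms to the multiplicative group *)

Section HomTruncation.
Variable A : comNzRingType.
Implicit Types (F G H : 'X_{1..2} -> A) (f : nat -> A).

Lemma comp_usubst n (u v : {poly A}) (H : {mpoly A[n]}) :
  (H \mPo usubst n u) \mPo usubst n v = H \mPo usubst n (u \Po v).
Proof.
rewrite comp_mpolyA; congr (_ \mPo _); apply: eq_from_tnth => i.
rewrite tnth_map !tnth_mktuple comp_ueval ueval_comp; congr (ueval _ _).
by rewrite comp_mpolyXU -tnth_nth tnth_mktuple.
Qed.

Lemma morder1_usubst n (u : {poly A}) i : u`_0 = 0 -> morder 1 (tnth (usubst n u) i).
Proof. by move=> u0; rewrite tnth_mktuple; apply: ueval_morder1 => //; apply: morder1_X. Qed.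

Lemma ueval_hom_comp n d (u v : {poly A}) (F G H : {mpoly A[n]}) : u`_0 = 0 ->
  meq d (ueval u F) (G \mPo usubst n u) -> meq d (ueval v G) (H \mPo usubst n v) ->
  meq d (ueval (v \Po u) F) (H \mPo usubst n (v \Po u)).
Proof.
move=> u0 hu hv; rewrite ueval_comp; apply: meq_trans (meq_ueval v hu) _.
rewrite -comp_ueval -comp_usubst; apply: comp_meq => // i.
exact: morder1_usubst.
Qed.

Lemma ord2P (T : 'I_2 -> Prop) : T 0 -> T 1 -> forall i, T i.
Proof.
move=> T0 T1 [[|[|i]] hi] //; [have -> // : Ordinal hi = 0|have -> // : Ordinal hi = 1].
  exact: val_inj.
exact: val_inj.
Qed.

Lemma mXps0 n (i : 'I_n) : mXps A i 0%MM = 0.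
Proof. by rewrite /mXps mcoeffX -mdeg_eq0 mdeg1. Qed.

Lemma ucompps0 n f (F : 'X_{1..n} -> A) : f 0 = 0 -> F 0%MM = 0 -> ucompps f F 0%MM = 0.
Proof.
move=> f0 F0; have /meqP/(_ 0%MM) := mtruncps_ucompps (d := 0) f F0.
rewrite mdeg0 mcoeff_mtruncps mdeg0 /= => -> //.
apply/morder1P/ueval_morder1; first by rewrite coef_truncps.
exact: morder1_mtruncps.
Qed.

(** Replaces an identity of series by congruences of polynomials, for which composition is
    associative. The positive order [d.+1] always retains the linear coefficient of f. *)
Lemma hom_truncP F G f : f 0 = 0 -> F 0%MM = 0 ->
  ucompps f F =1 mcompps G [tuple ucompps f (mXps A 0); ucompps f (mXps A 1)] <->
  forall d, meq d.+1 (ueval (truncps d.+1 f) (mtruncps d.+1 F))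
                     (mtruncps d.+1 G \mPo usubst 2 (truncps d.+1 f)).
Proof.
move=> f0 F0.
have L d := mtruncps_ucompps (d := d) f F0.
have RH d : meq d (mtruncps d (mcompps G [tuple ucompps f (mXps A 0); ucompps f (mXps A 1)]))
    (mtruncps d G \mPo usubst 2 (truncps d f)).
  apply: meq_trans (mtruncps_mcompps _ _) _.
    by apply: ord2P; apply: ucompps0 => //; apply: mXps0.
  have X i : meq d (mtruncps d (ucompps f (mXps A i))) (ueval (truncps d f) ('X_i : {mpoly A[2]})).
    apply: meq_trans (mtruncps_ucompps _ (mXps0 _)) _.
    exact/meq_ueval/mtruncps_mcoeff.
  by apply: meq_comp => i; rewrite tnth_map tnth_mktuple; move: i; apply: ord2P; apply: X.
split=> [h d|h].
  apply: meq_trans (meq_sym (L _)) _; apply: meq_trans (eq_mtruncps h) (RH _).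
apply: mtruncps_eq => d; apply: meq_trans (L _) _.
by apply: meq_trans (h d) _; apply/meq_sym/RH.
Qed.

Definition gm_poly : {mpoly A[2]} := 'X_0 + 'X_1 + 'X_0 * 'X_1.

Lemma comp_gm u : gm_poly \mPo usubst 2 u =
  ueval u 'X_0 + ueval u 'X_1 + ueval u 'X_0 * ueval u 'X_1.
Proof.
have X (i : 'I_2) : 'X_i \mPo usubst 2 u = ueval u 'X_i.
  by rewrite comp_mpolyXU -tnth_nth tnth_mktuple.
by rewrite /gm_poly !rmorphD rmorphM /= !X.
Qed.

Lemma morder1_gm : morder 1 gm_poly.
Proof. by do ?apply: morderD; try apply: morderMl; apply: morder1_X. Qed.

(* {mpoly A[2]} as polynomials in the second variable. *)
Definition bipoly : {mpoly A[2]} -> {poly {poly A}} :=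
  mmap (@polyC {poly A} \o @polyC A) (fun i : 'I_2 => if i == 0 then 'X%:P else 'X).

Lemma bipoly_monomial (m : 'X_{1..2}) i j :
  (mmap1 (fun i : 'I_2 => if i == 0 then 'X%:P else 'X : {poly {poly A}}) m)`_j`_i
  = ((m 0 == i) && (m 1 == j))%:R.
Proof.
rewrite /mmap1 !big_ord_recl big_ord0 mulr1 /= -polyC_exp coefCM coefXn.
have -> : lift ord0 ord0 = 1 :> 'I_2 by apply: val_inj.
rewrite [_ == j]eq_sym; case: eqP => _; last by rewrite mulr0 coef0 andbF.
by rewrite mulr1 coefXn eq_sym andbT.
Qed.

Lemma bipoly_meq d U V i j : meq d U V -> (i + j <= d)%N ->
  (bipoly U)`_j`_i = (bipoly V)`_j`_i.
Proof.
move=> UV ij; apply/eqP; rewrite -subr_eq0 -!coefB /bipoly -mmapB /mmap !coef_sum big1 //.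
move=> m _; rewrite !coefCM bipoly_monomial; case: eqP => [mi|]; last by rewrite mulr0.
case: eqP => [mj|]; last by rewrite mulr0.
rewrite UV ?mul0r // mdegE !big_ord_recl big_ord0 addn0 ltnS.
have -> : lift ord0 ord0 = 1 :> 'I_2 by apply: val_inj.
by rewrite mi mj.
Qed.

End HomTruncation.

Section MultiplicativeGroup.
Variable A : comNzRingType.

Lemma bipolyD (U V : {mpoly A[2]}) : bipoly (U + V) = bipoly U + bipoly V.
Proof. exact: mmapD. Qed.

Lemma bipolyM (U V : {mpoly A[2]}) : bipoly (U * V) = bipoly U * bipoly V.
Proof. exact: rmorphM. Qed.

Lemma bipolyX (i : 'I_2) : bipoly ('X_i : {mpoly A[2]}) = if i == 0 then 'X%:P else 'X.
Proof. by rewrite /bipoly mmapX mmap1U. Qed.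

Lemma bipoly_ueval (u : {poly A}) U :
  bipoly (ueval u U) = map_poly polyC u \Po bipoly U.
Proof.
elim/poly_ind: u => [|u c IH].
  by rewrite /ueval !map_poly0 horner0 comp_poly0; apply: mmap0.
rewrite uevalD uevalM uevalX uevalC bipolyD bipolyM IH rmorphD rmorphM /=.
rewrite map_polyX map_polyC comp_polyD comp_polyM comp_polyX comp_polyC /=.
by rewrite /bipoly mmapC.
Qed.

(* Comparison of the terms linear in the second variable. *)
Lemma gm_hom_ode d (e : {poly A}) : e`_0 = 0 ->
  meq d (ueval e (gm_poly A)) (gm_poly A \mPo usubst 2 e) ->
  coef_eq d (e^`() * (1 + 'X)) (e`_1 *: (1 + e)).
Proof.
move=> e0 h i id; have := bipoly_meq (i := i) (j := 1) h; rewrite addn1 => /(_ id).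
rewrite comp_gm !bipolyD !bipolyM !bipoly_ueval !bipolyD bipolyM !bipolyX /=.
set e2 := map_poly polyC e.
(* The coefficient is the derivative in the second variable at 0; by the chain rule the inner
   polynomial X + Y + XY contributes 1 + X. *)
have -> : (e2 \Po ('X%:P + 'X + 'X%:P * 'X))`_1 = e^`() * (1 + 'X).
  have := coef_deriv (e2 \Po ('X%:P + 'X + 'X%:P * 'X)) 0; rewrite mulr1n => <-.
  rewrite deriv_comp coef0M; congr (_ * _).
    rewrite -horner_coef0 horner_comp !(hornerD, hornerM, hornerC, hornerX) mulr0 !addr0.
    by rewrite /e2 deriv_map -[RHS]comp_polyXr.
  by rewrite !derivD derivC derivX derivM derivC derivX mul0r !add0r mulr1 coefD coef1 coefC.
have -> : e2 \Po 'X%:P = e%:P by rewrite comp_polyCr -[e2.['X]]/(e \Po 'X) comp_polyXr.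
rewrite comp_polyXr !coefD coefC /= coef0 add0r coefCM /e2 coef_map /= => ->.
by rewrite -mul_polyC mulrDr mulr1 [e * _]mulrC coefD.
Qed.

End MultiplicativeGroup.

(** * The equation (1 + X) y' = w y and the binomial series *)

Section ScaledOde.
Variable K : fieldType.
Hypothesis K0 : forall n, n.+1%:R != 0 :> K.

Lemma ode_unique d (w : K) (u v : {poly K}) : u`_0 = v`_0 ->
  coef_eq d (u^`() * (1 + 'X)) (w *: u) -> coef_eq d (v^`() * (1 + 'X)) (w *: v) ->
  coef_eq d.+1 u v.
Proof.
move=> uv0 hu hv; elim=> // i IH; rewrite ltnS => id; have {}IH := IH (ltnW id).
have E (f : {poly K}) : coef_eq d (f^`() * (1 + 'X)) (w *: f) ->
    i.+1%:R * f`_i.+1 = (w - i%:R) * f`_i.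
  move=> /(_ i id); rewrite mulrDr mulr1 coefD coefMX coefZ !coef_deriv mulrBl => <-.
  rewrite -[f`_i.+1 *+ _]mulr_natl; case: i {IH id} => [|i] /=; first by rewrite mul0r subr0 addr0.
  by rewrite mulr_natl [X in _ - X]mulr_natl addrK.
by apply: (mulfI (K0 i)); rewrite (E u hu) (E v hv) IH.
Qed.

(* The coefficients of (1 + X)^c. *)
Fixpoint gbin (c : K) n : K := if n is k.+1 then gbin c k * (c - k%:R) / k.+1%:R else 1.

Lemma gbin_ode d (c : K) :
  coef_eq d ((truncps d (gbin c))^`() * (1 + 'X)) (c *: truncps d (gbin c)).
Proof.
move=> i id; rewrite mulrDr mulr1 coefD coefMX coefZ !coef_deriv !coef_truncps id.
rewrite (ltnW id) -[gbin c i.+1 *+ _]mulr_natr /= divfK //.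
case: i id => [|i] id /=; first by rewrite addr0 subr0 mulrC.
rewrite (ltnW id); set g := _ / _; rewrite -[g *+ _]mulr_natr.
by rewrite mulrBr subrK mulrC.
Qed.

End ScaledOde.

Section LubinTateGroups.
Variables (R : realType) (p : nat) (pr_p : prime p).
Variables (Qp : fieldType) (abs : Qp -> R) (hQp : is_Qp p abs).
Local Notation q := (p%:R^-1 : R).
Let HQ : nonarch_abs abs := Qp_abs hQp.
Let abs_p : abs p%:R = q := Qp_abs_p hQp.
Let q_gt0 := pinv_gt0 R pr_p.
Let q_lt1 := pinv_lt1 R pr_p.
Let p_gt0 := prime_gt0 pr_p.

(** The series (1 + X)^p - 1, multiplication by p on the multiplicative group, which is a Lubin-Tate
    series for p. *)
Definition gm_series (n : nat) : Qp := if n is 0 then 0 else 'C(p, n)%:R.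

Lemma lift_p_gm : lift_p p abs gm_series.
Proof.
split=> //; first by rewrite /= bin1.
  by case=> [|n]; rewrite /= ?(na0 HQ) ?ler01 // (na_nat_le1 HQ).
case=> [|n]; first by rewrite ltn_eqF // subr0 (na0 HQ) ltW.
rewrite /=; case: eqP => [->|/eqP np]; first by rewrite binn subrr (na0 HQ) ltW.
rewrite subr0; have [le_np|lt_pn] := leqP n.+1 p; last by rewrite bin_small // (na0 HQ) ltW.
rewrite -[leRHS]expr1; apply: (abs_nat_dvd HQ pr_p abs_p).
by rewrite expn1 prime_dvd_bin //= ltn_neqAle np.
Qed.

Lemma gm_series_poly d : coef_eq d.+1 (truncps d gm_series) ((1 + 'X) ^+ p - 1).
Proof.
move=> i; rewrite ltnS => id; rewrite coef_truncps id coefB coef1 [1 + 'X]addrC.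
suff -> : (('X + 1) ^+ p : {poly Qp})`_i = 'C(p, i)%:R.
  by case: i {id} => [|i] /=; rewrite ?bin0 ?subrr ?subr0.
rewrite exprD1n coef_sum; have [ip|pi] := ltnP i p.+1.
  rewrite (bigD1 (Ordinal ip)) //= big1 => [|k].
    by rewrite coefMn coefXn eqxx addr0.
  by rewrite -val_eqE /= eq_sym coefMn coefXn => /negPf->; rewrite mul0rn.
rewrite bin_small // big1 // => k _; rewrite coefMn coefXn gtn_eqF ?mul0rn //.
exact: leq_trans pi.
Qed.

Lemma gm_hom d : meq d (ueval (truncps d gm_series) (gm_poly Qp))
  (gm_poly Qp \mPo usubst 2 (truncps d gm_series)).
Proof.
pose u : {poly Qp} := (1 + 'X) ^+ p - 1; have e := @gm_series_poly d.
apply: meq_trans (ueval_coef_eq (morder1_gm _) e) _.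
apply: (meq_trans (V := gm_poly Qp \mPo usubst 2 u)); last first.
  apply: meq_comp => i; rewrite !tnth_mktuple; apply/meq_sym/ueval_coef_eq => //.
  exact: morder1_X.
have E (U : {mpoly Qp[2]}) : ueval u U = (1 + U) ^+ p - 1.
  by rewrite /u uevalB uevalXn uevalD ueval1 uevalX.
rewrite comp_gm !E /gm_poly.
have -> : 1 + ('X_0 + 'X_1 + 'X_0 * 'X_1) = (1 + 'X_0) * (1 + 'X_1) :> {mpoly Qp[2]} by ring.
rewrite exprMn; set a := _ ^+ p; set b := _ ^+ p.
have -> : a * b - 1 = a - 1 + (b - 1) + (a - 1) * (b - 1) by ring.
exact: meq_refl.
Qed.

Lemma meq_Gm d : meq d (mtruncps d (Gm_hat Qp)) (gm_poly Qp).
Proof. exact: mtruncps_mcoeff. Qed.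

Lemma Gm_hat0 : Gm_hat Qp 0%MM = 0.
Proof. by apply/morder1P/morder1_gm. Qed.

Lemma gm_linear : meq 1 (gm_poly Qp) ('X_0 + 'X_1).
Proof. by rewrite /meq /gm_poly addrAC subrr add0r; apply: (@morderM _ _ 1 1); apply: morder1_X. Qed.

Lemma fgl_linear d (F : 'X_{1..2} -> Qp) : F 0%MM = 0 -> (forall i, F U_(i)%MM = 1) ->
  meq 1 (mtruncps d.+1 F) ('X_0 + 'X_1).
Proof.
move=> F0 F1; apply/meqP => m; rewrite leq_eqVlt ltnS leqn0 => /orP[/mdeg1P[i /eqP->]|].
  rewrite mcoeff_mtruncps mdeg1 /= F1 mcoeffD !mcoeffX.
  by move: i; apply: ord2P; rewrite !eq_mnm1 /= ?addr0 ?add0r.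
rewrite mdeg_eq0 => /eqP->; rewrite mcoeff_mtruncps mdeg0 /= F0 mcoeffD !mcoeffX.
by rewrite -!mdeg_eq0 !mdeg1 addr0.
Qed.

Section Homs.
Variables P Q : nat -> Qp.
Hypotheses (hP : lift_p p abs P) (hQ : lift_p p abs Q).
Local Notation f := (lt_series p P Q).

Lemma lt_series_hom (F G : 'X_{1..2} -> Qp) : F 0%MM = 0 -> G 0%MM = 0 ->
  (forall d, meq 1 (mtruncps d.+1 F) (mtruncps d.+1 G)) ->
  (forall d, meq d.+1 (ueval (truncps d.+1 P) (mtruncps d.+1 F))
     (mtruncps d.+1 F \mPo usubst 2 (truncps d.+1 P))) ->
  (forall d, meq d.+1 (ueval (truncps d.+1 Q) (mtruncps d.+1 G))
     (mtruncps d.+1 G \mPo usubst 2 (truncps d.+1 Q))) ->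
  FGL_hom abs F G f.
Proof.
move=> F0 G0 FG FP GQ; split.
- exact: (lt_series_integral pr_p hQp hP hQ).
- exact: lt_series0.
apply/hom_truncP; [exact: lt_series0|exact: F0|] => d.
have p_dil := p_dilates pr_p hQp.
apply: (ueval_hom p_dil (P := truncps d.+1 P) (Q := truncps d.+1 Q)) => //.
- by rewrite coef_truncps; apply: lift_p0 hP.
- by rewrite coef_truncps; apply: lift_p0 hQ.
- by rewrite coef_truncps; apply: lift_p1 hP.
- by rewrite coef_truncps; apply: lift_p1 hQ.
- by rewrite coef_truncps; apply: lt_series0.
- by rewrite coef_truncps; apply: lt_series1.
- exact: morder1_mtruncps.
- exact: morder1_mtruncps.
exact: (lt_series_comm pr_p hQp hP hQ).
Qed.

End Homs.

(** The composite commutes with Q and has linear coefficient 1, as does X, so uniqueness in one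
    variable applies. *)
Lemma lt_series_inv P Q : lift_p p abs P -> lift_p p abs Q ->
  compps (lt_series p P Q) (lt_series p Q P) =1 Xps Qp 1.
Proof.
move=> hP hQ n; set f := lt_series p P Q; set g := lt_series p Q P; pose d := n.+1.
have g0 : (truncps d g)`_0 = 0 by rewrite coef_truncps; apply: lt_series0.
have f0 : (truncps d f)`_0 = 0 by rewrite coef_truncps; apply: lt_series0.
rewrite (@compps_truncps _ d) //; [|exact: lt_series0].
have -> : Xps Qp 1 n = ('X : {poly Qp})`_n by rewrite coefX.
have Q0 : (truncps d Q)`_0 = 0 by rewrite coef_truncps; apply: lift_p0 hQ.
have P0 : (truncps d P)`_0 = 0 by rewrite coef_truncps; apply: lift_p0 hP.
have hf := lt_series_comm pr_p hQp hP hQ (d := d).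
have hg := lt_series_comm pr_p hQp hQ hP (d := d).
apply: (poly_unique (p_dilates pr_p hQp) (P := truncps d Q) (d := d)) => //.
- by rewrite coef_truncps; apply: lift_p1 hQ.
- by rewrite coef0_comp.
- by rewrite coefX.
- by rewrite coef1_comp // !coef_truncps /= /f /g !lt_series1 mulr1 coefX.
- rewrite comp_polyA; apply: coef_eq_trans (coef_eq_compl g0 hf) _.
  rewrite -!comp_polyA; exact: coef_eq_compr.
- by rewrite comp_polyXr comp_polyX.
Qed.

End LubinTateGroups.

(** * Isomorphism with the multiplicative group *)

Section Isomorphism.
Variables (R : realType) (p : nat) (pr_p : prime p).
Variables (Qp : fieldType) (abs : Qp -> R) (hQp : is_Qp p abs).
Local Notation q := (p%:R^-1 : R).
Let HQ : nonarch_abs abs := Qp_abs hQp.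
Let abs_p : abs p%:R = q := Qp_abs_p hQp.
Let KQ := natS_neq0 HQ pr_p abs_p.
Let q_gt0 := pinv_gt0 R pr_p.
Let q_lt1 := pinv_lt1 R pr_p.
Let p_gt0 := prime_gt0 pr_p.

(** For 0 < j < p^k one has |c - j| = |j|, so the product of the factors (c - j) / (j + 1)
    telescopes in absolute value. *)
Lemma abs_gbin c k n : abs c = q ^+ k -> (n < p ^ k)%N ->
  abs (gbin c n.+1) = abs c / abs n.+1%:R.
Proof.
move=> ck; elim: n => [|n IH] lt_n.
  by rewrite /= subr0 mul1r (naM HQ) (naV HQ).
have -> : gbin c n.+2 = gbin c n.+1 * (c - n.+1%:R) / n.+2%:R by [].
have {}IH := IH (ltnW lt_n); move: (gbin c n.+1) IH => g IH.
rewrite !(naM HQ) (naV HQ) IH.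
have n0 : 0 < abs n.+1%:R by rewrite (abs_nat_gt0 HQ pr_p abs_p).
have -> : abs (c - n.+1%:R) = abs n.+1%:R.
  rewrite -(naN HQ n.+1%:R); apply: (naD_eq HQ); rewrite (naN HQ) ck.
  rewrite (abs_natE HQ pr_p abs_p) // ltr_iXn2l //.
  rewrite ltnNge -pfactor_dvdn //; apply/negP => /dvdn_leq-/(_ isT).
  by rewrite leqNgt lt_n.
by rewrite divfK // gt_eqF.
Qed.

Lemma abs_gbin_pow c k : abs c = q ^+ k -> abs (gbin c (p ^ k)) = 1.
Proof.
move=> ck; have pk : (0 < p ^ k)%N by rewrite expn_gt0 p_gt0.
rewrite -(prednK pk) (abs_gbin ck) ?prednK // natrX (naX HQ) abs_p ck.
by rewrite divff // gt_eqF // exprn_gt0.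
Qed.

Lemma endomorphism_uniformizer d (e : {poly Qp}) (w : Qp) : abs w <= 1 ->
  coef_eq d (e^`() * (1 + 'X)) (w *: (1 + e)) -> e`_0 = 0 -> (p <= d)%N ->
  (forall i, (i <= d)%N -> abs (e - 'X^p)`_i <= q) ->
  forall k, (p ^ k <= d)%N -> abs (w - p%:R) != q ^+ k.
Proof.
move=> w1 ode e0 pd frob k kd; apply/eqP => wk.
set c := w - p%:R in wk; pose B := truncps d (gbin c); pose V : {poly Qp} := (1 + 'X) ^+ p.
have X1 : ((1 + 'X : {poly Qp})^`() = 1) by rewrite derivD derivC derivX add0r.
have V0 : V`_0 = 1 by rewrite -horner_coef0 horner_exp !hornerE expr1n.
have I1X : coefs_le abs 1 (1 + 'X : {poly Qp}).
  apply: (coefs_leD HQ); last by rewrite -['X]expr1; apply: (coefs_leXn HQ).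
  by rewrite -(expr0 'X); apply: (coefs_leXn HQ).
have IV : coefs_le abs 1 V by apply: (coefs_le1X HQ).
have eVB : coef_eq d.+1 (1 + e) (V * B).
  apply: (ode_unique KQ (w := w)); first by rewrite coefD coef1 e0 addr0 coef0M V0 coef_truncps mulr1.
    by rewrite derivD derivC add0r.
  rewrite derivM /V deriv_exp X1 mul1r -/V.
  apply: (@coef_eq_trans _ _ _ (p%:R *: (V * B) + V * (c *: B))).
    have -> : ((1 + 'X) ^+ p.-1 *+ p * B + V * B^`()) * (1 + 'X)
       = p%:R *: (V * B) + V * (B^`() * (1 + 'X)).
      rewrite mulrDl -mulrA [B * _]mulrC mulrA mulrnAl -exprSr prednK // -/V.
      by rewrite -mulrA mulrnAl scaler_nat.
    apply: coef_eqD => //; apply: coef_eqM => //; exact: gbin_ode.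
  by move=> i id; rewrite -scalerAr -scalerDl /c addrC subrK.
have fr : coefs_le abs q (V - (1 + 'X^p)).
  have := coefs_le_frob pr_p hQp I1X; rewrite comp_polyD comp_polyX.
  by rewrite -[1 \Po _]/((1%:P) \Po _) comp_polyC.
have small i : (i <= d)%N -> abs (V * (B - 1))`_i <= q.
  move=> id; have -> : (V * (B - 1))`_i = (e - 'X^p)`_i - (V - (1 + 'X^p))`_i.
    rewrite mulrBr mulr1 coefB -(eVB i) // !coefB !coefD; ring.
  by apply: (naB_le HQ); [apply: frob|apply: fr].
(* V is integral with constant term 1, so the congruence V (B - 1) = 0 modulo p can be divided by V
   degree by degree. *)
have small2 i : (i <= d)%N -> abs (B - 1)`_i <= q.
  elim/ltn_ind: i => i IH id; have := small i id.
  rewrite coefM big_ord_recl V0 mul1r subn0 => h.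
  rewrite -[(B - 1)`_i](addrK (\sum_(j < i) V`_(lift ord0 j) * (B - 1)`_(i - lift ord0 j))).
  apply: (naB_le HQ) => //; apply: (na_sum_le HQ) => [|j _]; first exact: ltW.
  rewrite -[leRHS]mul1r; apply: (naM_le HQ) => //; apply: IH.
    by rewrite ltn_subrL /=; apply: leq_ltn_trans (ltn_ord j).
  by apply: leq_trans id; apply: leq_subr.
have := small2 _ kd; rewrite coefB coef_truncps kd coef1.
by rewrite gtn_eqF ?expn_gt0 ?p_gt0 // subr0 (abs_gbin_pow wk) leNgt q_lt1.
Qed.

Lemma iso_Gm_uniformizer (w : Qp) (P : nat -> Qp) (G : 'X_{1..2} -> Qp) :
  abs w <= 1 -> P 1 = w -> (forall n, abs (P n - (n == p)%:R) <= q) ->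
  lubin_tate_group abs P G -> FGL_isomorphic abs G (Gm_hat Qp) -> w = p%:R.
Proof.
move=> w1 P1 Pfrob [hG hPG] [f [g [hf hg fg _]]].
have [P_int P0 PG] := hPG; have [f_int f0 fG] := hf; have [g_int g0 gG] := hg.
have G0 := FGL_coef0 hG.
apply/eqP; rewrite -subr_eq0 -(na_eq0 HQ); apply/eqP.
apply: contrapT => /eqP c0; have {}c0 : 0 < abs (w - p%:R) by rewrite lt_def c0 (na_ge0 HQ).
have [M hM] := exp_small (introT andP (conj (ltW q_gt0) q_lt1)) c0.
have c1 : abs (w - p%:R) <= 1 by apply: (naB_le HQ) => //; rewrite abs_p ltW.
have [|[k _ ck]] := Zp_abs_dec pr_p hQp M c1; first by rewrite leNgt hM.
(* Large enough to see both X^p and the coefficient of degree p^k, where the contradiction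
   occurs. *)
pose d := (p + p ^ k)%N; pose T := @truncps Qp d.+1.
pose e := T f \Po (T P \Po T g).
have z0 (h : nat -> Qp) : h 0 = 0 -> (T h)`_0 = 0 by move=> h0; rewrite coef_truncps.
have Pg0 : (T P \Po T g)`_0 = 0 by rewrite coef0_comp ?z0.
have e0 : e`_0 = 0 by rewrite coef0_comp ?z0.
have fg1 : f 1 * g 1 = 1.
  have := fg 1%N; rewrite (@compps_truncps _ 1) // coef1_comp ?coef_truncps //=.
have e1 : e`_1 = w.
  by rewrite !coef1_comp ?z0 // !coef_truncps /= P1 mulrCA fg1 mulr1.
have hom : meq d.+1 (ueval e (gm_poly Qp)) (gm_poly Qp \mPo usubst 2 e).
  have Gm := @meq_Gm Qp d.+1.
  have h1 : meq d.+1 (ueval (T g) (gm_poly Qp)) (mtruncps d.+1 G \mPo usubst 2 (T g)).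
    apply: meq_trans (meq_ueval _ (meq_sym Gm)) _.
    by move/(hom_truncP _ g0 (Gm_hat0 _)): gG; apply.
  have h2 : meq d.+1 (ueval (T P) (mtruncps d.+1 G)) (mtruncps d.+1 G \mPo usubst 2 (T P)).
    by move/(hom_truncP _ P0 G0): PG; apply.
  have h3 : meq d.+1 (ueval (T f) (mtruncps d.+1 G)) (gm_poly Qp \mPo usubst 2 (T f)).
    move/(hom_truncP _ f0 G0): fG => /(_ d) h; apply: meq_trans h _.
    by apply: comp_meq => // i; apply: morder1_usubst; apply: z0.
  by apply: (ueval_hom_comp Pg0 _ h3); apply: (ueval_hom_comp _ h1 h2); apply: z0.
have ode := gm_hom_ode e0 hom; rewrite e1 in ode.
have le_d j : (j <= d)%N -> (j <= d.+1)%N by apply: leqW.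
have int_T (h : nat -> Qp) : (forall n, abs (h n) <= 1) -> coefs_le abs 1 (T h).
  by move=> hh; apply: (coefs_le_truncps HQ).
have q0 : 0 <= q by apply: ltW.
have If := int_T f f_int; have Ig := int_T g g_int; have IP := int_T P P_int.
have IPg : coefs_le abs 1 (T P \Po T g) by apply: (coefs_le_comp HQ).
have frob i : (i <= d.+1)%N -> abs (e - 'X^p)`_i <= q.
  move=> id; have fgX : coef_eq d.+2 (T f \Po T g) 'X.
    move=> j jd; rewrite -(@compps_truncps _ d.+1) // fg /Xps coefX //.
  (* Modulo p, e = f(P(g)) is f(g^p), and f(X^p) is f^p, so e becomes f(g)^p = X^p. *)
  have -> : (e - 'X^p)`_i = ((e - (T f \Po (T g ^+ p)))
      - ((T f ^+ p - (T f \Po 'X^p)) \Po T g))`_i.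
    rewrite comp_polyB -comp_polyA comp_Xn_poly opprB addrA subrK !coefB; congr (_ - _).
    by rewrite rmorphXn; apply/esym/(coef_eqX _ fgX).
  move: i {id}; apply: (coefs_leB HQ).
    apply: (coefs_le_comp_sub HQ) => //; first exact: (coefs_le1X HQ).
    rewrite -comp_Xn_poly -comp_polyB; apply: (coefs_le_comp HQ) => //.
    by apply: (coefs_le_lift pr_p hQp) => //; rewrite leqW // leq_addr.
  apply: (coefs_le_comp HQ) => //; exact: (coefs_le_frob pr_p hQp).
have pd : (p <= d.+1)%N by rewrite leqW // leq_addr.
have kd : (p ^ k <= d.+1)%N by rewrite leqW // leq_addl.
by have /eqP := endomorphism_uniformizer w1 ode e0 pd frob kd.
Qed.

Lemma Gm_iso (P : nat -> Qp) (G : 'X_{1..2} -> Qp) :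
  lift_p p abs P -> lubin_tate_group abs P G -> FGL_isomorphic abs G (Gm_hat Qp).
Proof.
move=> hP [hG [_ P0 PG]]; have hQ := lift_p_gm pr_p hQp.
have G0 := FGL_coef0 hG; have Gm0 := Gm_hat0 Qp.
have GP := (hom_truncP _ P0 G0).1 PG.
have GQ d : meq d.+1 (ueval (truncps d.+1 (gm_series p Qp)) (mtruncps d.+1 (Gm_hat Qp)))
    (mtruncps d.+1 (Gm_hat Qp) \mPo usubst 2 (truncps d.+1 (gm_series p Qp))).
  apply: meq_trans (meq_ueval _ (@meq_Gm Qp d.+1)) _.
  apply: meq_trans (@gm_hom p Qp d.+1) _.
  apply: comp_meq; last exact: (meq_sym (@meq_Gm Qp d.+1)).
  by move=> i; apply: morder1_usubst; rewrite coef_truncps.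
have lin d : meq 1 (mtruncps d.+1 G) (mtruncps d.+1 (Gm_hat Qp)).
  apply: meq_trans (fgl_linear d G0 (FGL_coefX hG)) _; apply: meq_sym.
  apply: meq_trans (@gm_linear Qp); exact: (@meq_le _ _ 1 d.+1 _ _ _ (@meq_Gm Qp d.+1)).
exists (lt_series p P (gm_series p Qp)), (lt_series p (gm_series p Qp) P); split.
- exact: (lt_series_hom pr_p hQp).
- by apply: (lt_series_hom pr_p hQp) => // d; apply/meq_sym/lin.
- exact: (lt_series_inv pr_p hQp).
- exact: (lt_series_inv pr_p hQp).
Qed.

End Isomorphism.

(** * From ghost vectors back to convergence, and from the condition for all m to w = p *)

Theorem theorem2p13 (R : realType) (p : nat) (p_prime : prime p)
    (Qp : fieldType) (absQ : Qp -> R) (hQp : is_Qp p absQ)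
    (K : closedFieldType) (iota : {rmorphism Qp -> K}) (absK : K -> R)
    (hK : is_Qp_alg absQ iota absK)
    (w : Qp) (hw : uniformizer absQ w)
    (P : nat -> Qp) (hP : lubin_tate_series absQ p w P)
    (varpi : nat -> K) (hvarpi : tate_generator iota absK P varpi) :
  (forall m : nat,
     overconvergent absK (E_quotient p varpi m)
     <-> absQ (w - p%:R) <= absQ p%:R ^+ (m + 2)) /\
  (forall G : 'X_{1..2} -> Qp, lubin_tate_group absQ P G ->
     ((forall m : nat, overconvergent absK (E_quotient p varpi m))
      <-> FGL_isomorphic absQ G (Gm_hat Qp))).
Proof.
have HQ := Qp_abs hQp; have HK := Qp_alg_abs hK.
have pQ := Qp_abs_p hQp; have KQ := natS_neq0 HQ p_prime pQ.
have KK n : n.+1%:R != 0 :> K by rewrite -(rmorph_nat iota) fmorph_eq0.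
have w_abs := abs_uniformizer p_prime hQp hw.
have main m : overconvergent absK (E_quotient p varpi m)
     <-> absQ (w - p%:R) <= absQ p%:R ^+ (m + 2).
  rewrite pQ addn2; apply: iff_trans (oc_E_quotient p_prime hQp hK hw hP hvarpi m).
  have E := E_quotientE KK p_prime varpi m.
  split=> [/(overconvergent_decay p_prime hQp hK)|h].
    exact: geometric_decay_ext.
  apply: (bounded_overconvergent p_prime hQp hK).
    by apply: geometric_decay_ext h => n; rewrite E.
  (* Only varpi_0, ..., varpi_m occur, so all coefficients lie in one finite extension of Q_p, as
     required to recover convergence from decay. *)
  have [z hz] := primitive_elt p_prime hQp hK (mkseq varpi m.+1).
  exists z => n; rewrite E; apply: (ghost_exp_inadj p_prime hQp) => i.
  have hx j : inadj iota z (tate_ghost varpi m j).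
    rewrite /tate_ghost; case: ifP => _; last exact: (inadj_nat iota z 0).
    by apply: hz; rewrite map_f // mem_iota /= add0n ltnS leq_subr.
  apply: inadjD; last exact/inadjN/hx.
  by case: i => [|i]; [apply: (inadj_nat iota z 0)|apply: inadjM; [apply: inadj_nat|apply: hx]].
split=> // G hG.
have q01 : 0 <= (p%:R^-1 : R) < 1 by rewrite (ltW (pinv_gt0 R p_prime)) pinv_lt1.
have Pfrob := P_frob p_prime hQp hw hP.
have allm : (forall m, overconvergent absK (E_quotient p varpi m)) <-> w = p%:R.
  split=> [h|wp m]; last by apply/main; rewrite wp subrr (na0 HQ) exprn_ge0 // (na_ge0 HQ).
  apply/eqP; rewrite -subr_eq0 -(na_eq0 HQ) eq_le (na_ge0 HQ) andbT leNgt.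
  apply/negP => /(exp_small q01)[n hn]; have /main := h n.
  rewrite pQ leNgt => /negP; apply; apply: le_lt_trans hn.
  by apply: (pinvX_le _ p_prime); apply: leq_addr.
apply: iff_trans allm _; split=> [wp|].
  apply: (Gm_iso p_prime hQp) hG; split=> //; [exact: LT_coef0 hP|by rewrite (LT_coef1 hP)|].
  exact: (LT_integral hP).
apply: (iso_Gm_uniformizer p_prime hQp _ (LT_coef1 hP) Pfrob hG).
by rewrite w_abs ltW // pinv_lt1.
Qed.
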